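(* Let $M=(M,J)$ be a compact complex manifold of complex dimension $n$, let $I=(-\epsilon,\epsilon)$ with $\epsilon>0$, and let $\{M_t\}_{t\in I}$ be a small differentiable family of deformations of $M$ with $M_0=M$, whose complex structures are described by $\varphi(t)\in A^{0,1}(T^{1,0}M)$, $t\in I$. Let $\{\omega_t\}_{t\in I}$ be a smooth family of Hermitian metrics (identified with their fundamental $2$-forms) along $\{M_t\}_{t\in I}$, and write $\omega_t=e^{\iota_{\varphi(t)}|\iota_{\overline{\varphi(t)}}}(\omega(t))$ with $\omega(t)\in A^{1,1}(M)$ and $\omega:=\omega(0)=\omega_0$. Let $k$ be an integer with $1\le k\le n-1$. If every metric $\omega_t$ satisfies $\partial_t\bar\partial_t\,\omega_t^k=0$ for $t\in I$, then $$2i\,\mathfrak{Im}\big(\partial\circ\iota_{\varphi'(0)}\circ\partial\big)(\omega^k)=\partial\bar\partial\,(\omega^k(0))'.$$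
   Context: A Hermitian metric $g$ on a complex manifold with complex structure $J$ has fundamental $2$-form $\omega(X,Y)=g(JX,Y)$; powers $\omega^k$ are wedge powers. $A^{p,q}(M)$ denotes smooth complex-valued $(p,q)$-forms with respect to $J$, and $A^{0,1}(T^{1,0}M)$ denotes smooth $(0,1)$-forms with values in $T^{1,0}M$. Deformations. A differentiable family of compact complex manifolds over $I$ is a smooth surjective submersion $\pi:\mathcal M\to I$ from a smooth manifold such that each $M_t=\pi^{-1}(t)$ is a compact connected submanifold endowed with a complex structure, and there are a locally finite open cover $\{\mathcal U_j\}$ of $\mathcal M$ and smooth complex-valued functions $\xi_j^1,\dots,\xi_j^n$ on $\mathcal U_j$ whose restrictions to $\mathcal U_j\cap M_t$ form a system of holomorphic coordinates on $M_t$ for every $t$. By Ehresmann's theorem one fixes a diffeomorphism $\mathcal M\simeq M\times I$ (the identity on $M_0=M$), so that $M_t=(M,J_t)$ with $J_t$ an integrable complex structure on the smooth manifold $M$. With $z=(z^1,\dots,z^n)$ local holomorphic coordinates on $M_0$ and $\xi^\alpha=\xi_j^\alpha(z,t)$ the holomorphic coordinates on $M_t$ viewed as functions of $(z,t)$, for small $|t|$ the matrix $(\partial\xi^\alpha/\partial z^\lambda)$ is invertible, and $$\varphi(t)=\sum_{\lambda,\alpha}\Big(\big(\tfrac{\partial\xi}{\partial z}\big)^{-1}\Big)^{\lambda}_{\alpha}\,\bar\partial\xi^\alpha\otimes\frac{\partial}{\partial z^\lambda}$$ is a globally well-defined element of $A^{0,1}(T^{1,0}M)$, smooth in $t$, with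 $\varphi(0)=0$. A smooth function $f$ is holomorphic for $J_t$ iff $(\bar\partial-\sum_i\varphi^i(t)\,\partial/\partial z^i)f=0$, where $\varphi(t)=\sum_i\varphi^i(t)\otimes\partial/\partial z^i$. ''Small'' means that $\epsilon$ is small enough for these statements and the isomorphism below to hold. $\varphi'(0)\in A^{0,1}(T^{1,0}M)$ is the derivative of $\varphi(t)$ in $t$ at $t=0$. Contraction. For $\varphi=\bar\eta\otimes Z$ with $\bar\eta\in A^{0,1}(M)$ and $Z$ of type $(1,0)$, $\iota_\varphi(\alpha)=\bar\eta\wedge\iota_Z\alpha$, extended linearly; so $\iota_\varphi:A^{p,q}(M)\to A^{p-1,q+1}(M)$. Similarly, for $\bar\varphi\in A^{1,0}(T^{0,1}M)$, $\iota_{\bar\varphi}$ is the conjugate operation. Put $e^{\iota_\varphi}=\sum_{m\ge0}\frac1{m!}\iota_\varphi^m$. Extension map. For $\alpha\in A^{p,q}(M)$ with local expression $\alpha=\sum\alpha_{i_1\cdots i_p\bar j_1\cdots\bar j_q}\,dz^{i_1}\wedge\cdots\wedge dz^{i_p}\wedge d\bar z^{j_1}\wedge\cdots\wedge d\bar z^{j_q}$, $$e^{\iota_{\varphi(t)}|\iota_{\overline{\varphi(t)}}}(\alpha)=\sum\alpha_{i_1\cdots i_p\bar j_1\cdots\bar j_q}\,e^{\iota_{\varphi(t)}}(dz^{i_1}\wedge\cdots\wedge dz^{i_p})\wedge e^{\iota_{\overline{\varphi(t)}}}(d\bar z^{j_1}\wedge\cdots\wedge d\bar z^{j_q}).$$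 For small $t$ this is a linear isomorphism $A^{p,q}(M_0)\to A^{p,q}(M_t)$, which is why $\omega(t)$ exists and is unique. Operators. On $M_t$, $\partial_t:=\pi_t^{p+1,q}\circ d$ and $\bar\partial_t:=\pi_t^{p,q+1}\circ d$ on $A^{p,q}(M_t)$, where $\pi_t^{r,s}$ is the projection onto $A^{r,s}(M_t)$; $\partial,\bar\partial$ denote the operators on $M=M_0$. Derivative. $\omega^k(t)$ is the $k$-th wedge power of $\omega(t)$. Writing locally on $M$ $\omega^k(t)=\sum_I\omega_I(t)\,dz^{i_1}\wedge d\bar z^{j_1}\wedge\cdots\wedge dz^{i_k}\wedge d\bar z^{j_k}$ (sum over $i_1<\cdots<i_k$, $j_1<\cdots<j_k$), set $(\omega^k(t))'=\sum_I\frac{\partial\omega_I(t)}{\partial t}\,dz^{i_1}\wedge d\bar z^{j_1}\wedge\cdots\wedge dz^{i_k}\wedge d\bar z^{j_k}\in A^{k,k}(M)$; $(\omega^k(0))'$ is its value at $t=0$. Imaginary part. For an operator $P$ on complex forms with conjugate $\overline P(\alpha)=\overline{P(\bar\alpha)}$, $2i\,\mathfrak{Im}(P)=P-\overline P$; thus $2i\,\mathfrak{Im}(\partial\circ\iota_{\varphi'(0)}\circ\partial)=\partial\circ\iota_{\varphi'(0)}\circ\partial-\bar\partial\circ\iota_{\overline{\varphi'(0)}}\circ\bar\partial$. *)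

(* Defs.v *)
From HB Require Import structures.
From mathcomp Require Import all_boot all_order all_algebra.
From mathcomp Require Import complex.
From mathcomp Require Import all_classical all_reals all_analysis.
Import numFieldNormedType.Exports.
Import Order.TTheory GRing.Theory Num.Theory.

Set Implicit Arguments.
Unset Strict Implicit.
Unset Printing Implicit Defensive.

Local Open Scope classical_set_scope.
Local Open Scope ring_scope.
Local Open Scope complex_scope.

(** * Exterior algebra on a finite basis e_0, ..., e_(m-1)

    [a S] is the coefficient of e_(s_1) /\ ... /\ e_(s_k), where
    S = {s_1 < ... < s_k}. *)

Definition ext (F : fieldType) (m : nat) := {ffun {set 'I_m} -> F^o}.

Section Exterior.
Variables (F : fieldType) (m : nat).
Implicit Types (a b : ext F m) (S A B : {set 'I_m}).

Definition ebase S : ext F m := [ffun T => (T == S)%:R].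

Definition inversions A B : nat :=
  #|[set ij : 'I_m * 'I_m | [&& ij.1 \in A, ij.2 \in B & (ij.2 < ij.1)%N]]%SET|.

Definition wedge a b : ext F m :=
  [ffun S : {set 'I_m} => \sum_(A in powerset S)
     (-1) ^+ inversions A (S :\: A) * a A * b (S :\: A)].

Definition wedge_seq (s : seq (ext F m)) : ext F m :=
  foldr wedge (ebase finset.set0) s.

Definition wedge_pow a (k : nat) : ext F m := wedge_seq (nseq k a).

(* The algebra endomorphism sending e_s to [theta s]. *)
Definition esubst (theta : 'I_m -> ext F m) a : ext F m :=
  \sum_(S : {set 'I_m}) a S *: wedge_seq [seq theta s | s <- enum S].

Definition covector (c : 'rV[F]_m) : ext F m :=
  \sum_(s < m) c 0 s *: ebase [set s]%SET.

(* Interior product with the s-th vector of the dual basis. *)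
Definition interior (s : 'I_m) a : ext F m :=
  [ffun S : {set 'I_m} => if s \in S then 0
     else (-1) ^+ #|[set j in S | (j < s)%N]%SET| * a (s |: S)%SET].

Definition interior_vec (v : 'rV[F]_m) a : ext F m :=
  \sum_(s < m) v 0 s *: interior s a.

Definition homogeneous (k : nat) a : Prop := forall S, a S != 0 -> #|S| = k.

End Exterior.

(** * Pointwise complex linear algebra

    C^n is modelled by R^(2n) = {(x_1, ..., x_n, y_1, ..., y_n)}; tangent
    vectors are row vectors in the frame (d/dx^i, d/dy^i), and an endomorphism
    J of the tangent space acts by X |-> X *m J.  Complex forms are elements of
    [cext R n], with e_(lshift i) = dz^i and e_(rshift i) = d(zbar)^i. *)

Notation cext R n := (ext R[i] (n + n)).

Section Pointwise.
Variables (R : realType) (n : nat).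
Local Notation C := R[i].
Implicit Types (a : cext R n) (J : 'M[R]_(n + n)) (f : 'M[C]_n).

Definition ccoord (x : 'rV[R]_(n + n)) (i : 'I_n) : C :=
  x 0 (lshift n i) +i* x 0 (rshift n i).

Definition dz_ (i : 'I_n) : cext R n := ebase C [set lshift n i]%SET.
Definition dzbar_ (i : 'I_n) : cext R n := ebase C [set rshift n i]%SET.

Definition conj_ext a : cext R n :=
  \sum_(S : {set 'I_(n + n)}) (a S)^*%C *: wedge_seq
    [seq (match fintype.split s with inl i => dzbar_ i | inr i => dz_ i end)
    | s <- enum S].

(* From components in the frame (d/dx, d/dy) to components in (d/dz, d/dzbar). *)
Definition frame_mx : 'M[C]_(n + n) :=
  block_mx 1%:M 1%:M 'i%:M (- 'i)%:M.

Definition cvec (X : 'rV[R]_(n + n)) : 'rV[C]_(n + n) :=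
  map_mx (real_complex R) X *m frame_mx.

Definition eval2 a (X Y : 'rV[R]_(n + n)) : C :=
  interior_vec (cvec Y) (interior_vec (cvec X) a) finset.set0.

(* The complex linear extension of J, in the frame (d/dz, d/dzbar). *)
Definition complexify_mx J : 'M[C]_(n + n) :=
  invmx frame_mx *m map_mx (real_complex R) J *m frame_mx.

(* theta^(1,0) = (theta - i theta o J) / 2 and
   theta^(0,1) = (theta + i theta o J) / 2, for theta = e_s. *)
Definition cov10 J (s : 'I_(n + n)) : cext R n :=
  let theta : 'rV[C]_(n + n) := delta_mx 0 s in
  covector (2^-1 *: (theta - 'i *: (theta *m (complexify_mx J)^T))).
Definition cov01 J (s : 'I_(n + n)) : cext R n :=
  let theta : 'rV[C]_(n + n) := delta_mx 0 s in
  covector (2^-1 *: (theta + 'i *: (theta *m (complexify_mx J)^T))).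

(* The component of type (p, q) with respect to J: in every monomial e_S,
   expand each factor as e_s = e_s^(1,0) + e_s^(0,1) and keep the terms with
   p factors of type (1,0) and q factors of type (0,1). *)
Definition type_proj J (p q : nat) a : cext R n :=
  \sum_(S : {set 'I_(n + n)}) a S *:
    \sum_(A in powerset S | (#|A| == p) && (#|S :\: A| == q))
      wedge_seq [seq (if s \in A then cov10 J s else cov01 J s) | s <- enum S].

(* A matrix f stands for the T^(1,0)-valued (0,1)-form
   \sum_(l, m) f l m d(zbar)^m (x) d/dz^l. *)
Definition contr f a : cext R n :=
  \sum_(l < n) \sum_(m < n)
    f l m *: wedge (dzbar_ m) (interior (lshift n l) a).

Definition contr_bar f a : cext R n :=
  \sum_(l < n) \sum_(m < n)
    (f l m)^*%C *: wedge (dz_ m) (interior (rshift n l) a).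

(* [contr f] and [contr_bar f] lower one of the two degrees, which are at
   most n, so the exponential series stops at order n. *)
Definition exp_op (P : cext R n -> cext R n) a : cext R n :=
  \sum_(j < n.+1) ((j`!)%:R : C)^-1 *: iter j P a.

Definition holo_part (S : {set 'I_(n + n)}) :=
  [set s in S | (s < n)%N]%SET.
Definition antiholo_part (S : {set 'I_(n + n)}) :=
  [set s in S | (n <= s)%N]%SET.

Definition extension f a : cext R n :=
  \sum_(S : {set 'I_(n + n)}) a S *:
    wedge (exp_op (contr f) (ebase C (holo_part S)))
          (exp_op (contr_bar f) (ebase C (antiholo_part S))).

End Pointwise.

(** * Smooth functions *)

Section Smooth.
Variables (R : realType).

Fixpoint Ck (V : normedModType R) (k : nat) (U : set V) (f : V -> R) : Prop :=
  (forall x, U x -> {for x, continuous f}) /\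
  match k with
  | 0 => True
  | k'.+1 => forall v, (forall x, U x -> derivable f x v) /\ Ck k' U ('D_v f)
  end.

Definition smooth_on (V : normedModType R) (U : set V) (f : V -> R) : Prop :=
  forall k, Ck k U f.

Definition csmooth_on (V : normedModType R) (U : set V) (f : V -> R[i]) :=
  smooth_on U (fun x => complex.Re (f x)) /\
  smooth_on U (fun x => complex.Im (f x)).

Definition cderive (V : normedModType R) (f : V -> R[i]) (x v : V) : R[i] :=
  'D_v (fun y => complex.Re (f y)) x +i* 'D_v (fun y => complex.Im (f y)) x.

Definition cderive1 (f : R -> R[i]) (t : R) : R[i] :=
  derive1 (fun s => complex.Re (f s)) t +i* derive1 (fun s => complex.Im (f s)) t.

Variable n : nat.
Local Notation V := 'rV[R]_(n + n).

Definition wirt (i : 'I_n) (f : V -> R[i]) (x : V) : R[i] :=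
  2^-1 * (cderive f x (delta_mx 0 (lshift n i))
          - 'i * cderive f x (delta_mx 0 (rshift n i))).
Definition wirt_bar (i : 'I_n) (f : V -> R[i]) (x : V) : R[i] :=
  2^-1 * (cderive f x (delta_mx 0 (lshift n i))
          + 'i * cderive f x (delta_mx 0 (rshift n i))).

Definition holomorphic_on (U : set V) (f : V -> R[i]) : Prop :=
  csmooth_on U f /\ forall x i, U x -> wirt_bar i f x = 0.

Definition dfun (f : V -> R[i]) (x : V) : cext R n :=
  \sum_(i < n) (wirt i f x *: dz_ R i + wirt_bar i f x *: dzbar_ R i).

(* Pullback by h of the form with value a at [h x]. *)
Definition pullback (h : V -> V) (x : V) (a : cext R n) : cext R n :=
  esubst (fun s => match fintype.split s with
                   | inl i => dfun (fun y => ccoord (h y) i) x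
                   | inr i => dfun (fun y => (ccoord (h y) i)^*%C) x
                   end) a.

End Smooth.

(** * Complex manifolds *)

Record complexManifold (R : realType) (n : nat) := ComplexManifold {
  carrier :> topologicalType;
  carrier_hausdorff : hausdorff_space carrier;
  carrier_countable : @second_countable carrier;
  chartIdx : Type;
  cdom : chartIdx -> set carrier;
  coord : chartIdx -> carrier -> 'rV[R]_(n + n);
  param : chartIdx -> 'rV[R]_(n + n) -> carrier;
  cdom_open : forall a, open (cdom a);
  cdom_cover : forall p, exists a, cdom a p;
  coordK : forall a p, cdom a p -> param a (coord a p) = p;
  crange_open : forall a, open (coord a @` cdom a);
  coord_continuous : forall a p, cdom a p -> {for p, continuous (coord a)};
  param_continuous : forall a x,
    (coord a @` cdom a) x -> {for x, continuous (param a)};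
  transition_holomorphic : forall a b i,
    holomorphic_on [set x | (coord a @` cdom a) x /\ cdom b (param a x)]
                   (fun x => ccoord (coord b (param a x)) i)
}.

Arguments chartIdx {R n}.
Arguments cdom {R n M} : rename.
Arguments coord {R n M} : rename.
Arguments param {R n M} : rename.

Section Manifold.
Variables (R : realType) (n : nat) (M : complexManifold R n).
Local Notation V := 'rV[R]_(n + n).

Definition crange (a : chartIdx M) : set V := coord a @` cdom a.
Definition transition (a b : chartIdx M) (x : V) : V := coord b (param a x).
Definition overlap (a b : chartIdx M) : set V :=
  [set x | crange a x /\ cdom b (param a x)].

(* Forms and tensors are given by their expressions in all the charts, as
   functions of the coordinates; only the values on [crange] are meaningful. *)
Definition cform := chartIdx M -> V -> cext R n.
Definition tensor := chartIdx M -> V -> 'M[R]_(n + n).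
Definition beltrami := chartIdx M -> V -> 'M[R[i]]_n.

Definition eqf (alpha beta : cform) : Prop :=
  forall a x, crange a x -> alpha a x = beta a x.

Definition zero_form : cform := fun _ _ => 0.

Definition smooth_form (alpha : cform) : Prop :=
  (forall a S, csmooth_on (crange a) (fun x => alpha a x S)) /\
  (forall a b x, overlap a b x ->
     alpha a x = pullback (transition a b) x (alpha b (transition a b x))).

Definition pow_form (alpha : cform) (k : nat) : cform :=
  fun a x => wedge_pow (alpha a x) k.

Definition conj_form (alpha : cform) : cform := fun a x => conj_ext (alpha a x).

Definition d_form (alpha : cform) : cform := fun a x =>
  \sum_(S : {set 'I_(n + n)})
    wedge (dfun (fun y => alpha a y S) x) (ebase R[i] S).

(** ** Almost complex structures *)

Definition almost_complex (J : tensor) : Prop :=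
  [/\ forall a r s, smooth_on (crange a) (fun x => J a x r s),
      forall a x, crange a x -> J a x *m J a x = - 1%:M
    & forall a b x X, overlap a b x ->
        'D_X (transition a b) x *m J b (transition a b x)
        = 'D_(X *m J a x) (transition a b) x].

(* The complex structure of M: d/dx^i |-> d/dy^i, d/dy^i |-> - d/dx^i. *)
Definition J_std : tensor := fun _ _ => block_mx 0 1%:M (- 1%:M) 0.

Definition proj_form (J : tensor) (p q : nat) (alpha : cform) : cform :=
  fun a x => type_proj (J a x) p q (alpha a x).

Definition is_pq_form (J : tensor) (p q : nat) (alpha : cform) : Prop :=
  smooth_form alpha /\ eqf (proj_form J p q alpha) alpha.

(* proj^(p+1,q) o d on forms of type (p,q), extended linearly to all forms. *)
Definition del (J : tensor) (alpha : cform) : cform := fun a x =>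
  \sum_(p < n.+1) \sum_(q < n.+1)
    proj_form J p.+1 q (d_form (proj_form J p q alpha)) a x.
Definition delbar (J : tensor) (alpha : cform) : cform := fun a x =>
  \sum_(p < n.+1) \sum_(q < n.+1)
    proj_form J p q.+1 (d_form (proj_form J p q alpha)) a x.

(** ** Hermitian metrics *)

Definition hermitian_metric (J g : tensor) : Prop :=
  (forall a r s, smooth_on (crange a) (fun x => g a x r s)) /\
  (forall a b x X Y, overlap a b x ->
     X *m g a x *m Y^T
     = 'D_X (transition a b) x *m g b (transition a b x)
       *m ('D_Y (transition a b) x)^T) /\
  (forall a x, crange a x ->
     [/\ (g a x)^T = g a x,
         forall X : V, X != 0 -> 0 < (X *m g a x *m X^T) 0 0
       & J a x *m g a x *m (J a x)^T = g a x]).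

(* omega(X, Y) = g(JX, Y) *)
Definition fundamental_form (J g : tensor) (omega : cform) : Prop :=
  forall a x, crange a x ->
    homogeneous 2 (omega a x) /\
    forall X Y : V,
      eval2 (omega a x) X Y = ((X *m J a x *m g a x *m Y^T) 0 0)%:C.

Definition hermitian_form (J : tensor) (omega : cform) : Prop :=
  exists2 g, hermitian_metric J g & fundamental_form J g omega.

(** ** Operators attached to T^(1,0)-valued (0,1)-forms *)

Definition contr_form (f : beltrami) (alpha : cform) : cform :=
  fun a x => contr (f a x) (alpha a x).

Definition extension_form (f : beltrami) (alpha : cform) : cform :=
  fun a x => extension (f a x) (alpha a x).

(* 2i Im(P) = P - Pbar *)
Definition two_i_Im (P : cform -> cform) (alpha : cform) : cform :=
  fun a x => P alpha a x - conj_form (P (conj_form alpha)) a x.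

(** ** Dependence on the parameter *)

Definition time_interval (eps : R) : set R := [set t | - eps < t < eps].

Definition smooth_family (eps : R) (alpha : R -> cform) : Prop :=
  forall a S,
    csmooth_on [set xt : V * R | crange a xt.1 /\ time_interval eps xt.2]
               (fun xt => alpha xt.2 a xt.1 S).

Definition form_deriv (alpha : R -> cform) (t : R) : cform := fun a x =>
  [ffun S : {set 'I_(n + n)} => cderive1 (fun s => alpha s a x S) t].

Definition beltrami_deriv (f : R -> beltrami) (t : R) : beltrami := fun a x =>
  \matrix_(l < n, m < n) cderive1 (fun s => f s a x l m) t.

End Manifold.

Arguments zero_form {R n} M.
Arguments J_std {R n} M.

(** * Differentiable families of deformations

    The total space is identified with M x I by a fixed trivialization which is
    the identity over 0, so that M_t = (M, J_t). *)

Record deformation (R : realType) (n : nat) (M : complexManifold R n) (eps : R)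
    := Deformation {
  def_J : R -> tensor M;
  def_J_almost_complex : forall t, time_interval eps t ->
    almost_complex (def_J t);
  def_J0 : forall a x, crange a x -> def_J 0 a x = J_std M a x;
  famIdx : Type;
  fdom : famIdx -> set (M * R)%type;
  fdom_open : forall j, open (fdom j);
  fdom_time : forall j p t, fdom j (p, t) -> time_interval eps t;
  fdom_cover : forall p t, time_interval eps t -> exists j, fdom j (p, t);
  fdom_locally_finite : forall p t, time_interval eps t ->
    exists2 N, nbhs ((p, t) : (M * R)%type) N &
      finite_set [set j | fdom j `&` N !=set0];
  xi : famIdx -> 'I_n -> (M * R)%type -> R[i];
  xi_smooth : forall a j al,
    csmooth_on [set xt : 'rV[R]_(n + n) * R |
                  crange a xt.1 /\ fdom j (param a xt.1, xt.2)]
               (fun xt => xi j al (param a xt.1, xt.2));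
  (* On each M_t, the functions xi_j are holomorphic coordinates for J_t:
     they are injective, their differentials are complex linear
     with respect to J_t, and they are jointly injective on tangent spaces. *)
  xi_injective : forall j t p q, fdom j (p, t) -> fdom j (q, t) ->
    (forall al, xi j al (p, t) = xi j al (q, t)) -> p = q;
  xi_holomorphic : forall a j al t x (X : 'rV[R]_(n + n)),
    crange a x -> fdom j (param a x, t) ->
    cderive (fun y => xi j al (param a y, t)) x (X *m def_J t a x)
    = 'i * cderive (fun y => xi j al (param a y, t)) x X;
  xi_immersive : forall a j t x (X : 'rV[R]_(n + n)),
    crange a x -> fdom j (param a x, t) ->
    (forall al, cderive (fun y => xi j al (param a y, t)) x X = 0) -> X = 0
}.

Section Deformation.
Variables (R : realType) (n : nat) (M : complexManifold R n) (eps : R).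
Variable D : deformation M eps.

Definition xi_loc (a : chartIdx M) (j : famIdx D) (t : R) (al : 'I_n)
  (x : 'rV[R]_(n + n)) : R[i] := xi j al (param a x, t).

Definition dxi_dz a j t x : 'M[R[i]]_n :=
  \matrix_(al < n, l < n) wirt l (xi_loc a j t al) x.
Definition dxi_dzbar a j t x : 'M[R[i]]_n :=
  \matrix_(al < n, m < n) wirt_bar m (xi_loc a j t al) x.

Definition describes (phi : R -> beltrami M) : Prop :=
  forall a j t x, crange a x -> fdom j (param a x, t) ->
    phi t a x = invmx (dxi_dz a j t x) *m dxi_dzbar a j t x.

Definition extension_iso (f : beltrami M) (J : tensor M) (p q : nat) : Prop :=
  (forall alpha, is_pq_form (J_std M) p q alpha ->
     is_pq_form J p q (extension_form f alpha)) /\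
  (forall beta, is_pq_form J p q beta ->
     exists alpha, [/\ is_pq_form (J_std M) p q alpha,
       eqf (extension_form f alpha) beta
     & forall alpha', is_pq_form (J_std M) p q alpha' ->
         eqf (extension_form f alpha') beta -> eqf alpha' alpha]).

Definition small_deformation (phi : R -> beltrami M) : Prop :=
  (forall a j t x, crange a x -> fdom j (param a x, t) ->
     dxi_dz a j t x \in unitmx) /\
  (forall t p q, time_interval eps t -> extension_iso (phi t) (def_J D t) p q).

End Deformation.

(* Main.v *)
Require Import Defs.
From HB Require Import structures.
From mathcomp Require Import all_boot all_order all_algebra.
From mathcomp Require Import complex.
From mathcomp Require Import all_classical all_reals all_analysis.
From mathcomp Require Import ring lra zify.
Import numFieldNormedType.Exports.
Import Order.TTheory GRing.Theory Num.Theory.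

(** The identity is the first-order term at t = 0 of the equation
    del_t (delbar_t (omega_t^k)) = 0, read in one chart of M.

    Write f for phi'(0), and theta for the sum of the contraction by f and of
    its conjugate. Both contractions are even derivations of the exterior
    algebra, and so is theta. Three quantities depend on t, and each of them
    varies to first order by theta.

    - The type decomposition. The forms of type (1, 0) for J_t are spanned by
      dz^l + phi(t)(dz^l); hence to first order the projection on the forms of
      type (p, q) is conjugated by 1 + t theta, and its derivative is the
      commutator of theta with that projection ([type_variation],
      [type_monos_t]).

    - The Dolbeault operators, which are sums of (projection) o d o
      (projection). Expanding the derivative of such a sum and sorting its terms
      by bidegree, one finds that the derivative of delbar_t is
      [theta, delbar] + [del, i_f], and that of del_t is
      [theta, del] + [delbar, i_fbar] ([fam_del_t]).

    - The forms omega_t^k. The extension map is 1 + t theta to first order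
      ([eder_ext_mono]), and theta is a derivation; hence the derivative of
      omega_t^k is b + theta (omega^k), with b = (omega^k(0))' ([preimage_t],
      [wedge_pow_t]).

    When del_t (delbar_t (omega_t^k)) is differentiated, the squares del^2 and
    delbar^2 vanish, the value of delbar (omega^k) is annihilated by del, and all
    the terms that contain theta cancel. What remains is
      del (delbar b) - del (i_f (del omega^k)) + delbar (i_fbar (delbar omega^k))
      = 0
    ([variation_identity]), and the conjugate of del i_f del is
    delbar i_fbar delbar ([conj_std_del_contr]).

    The complex structures J_t enter through their holomorphic coordinates: these
    show that the rows of (1 phi; phibar 1) are covectors of pure type
    ([chart_phi_J]), which gives the derivative of J_t at t = 0. All the data are
    differentiated on V x R, where V = R^(2n) carries the chart. The smoothness of
    omega(t) in t is recovered from that of omega_t by inverting the matrix of the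
    extension map, which is the identity at t = 0 ([preimage_smooth]). *)

Set Implicit Arguments.
Unset Strict Implicit.
Unset Printing Implicit Defensive.

Local Open Scope ring_scope.
Local Open Scope complex_scope.

(** * The exterior algebra on a finite basis *)

Section ExteriorAlgebra.
Variables (F : fieldType) (m : nat).
Local Notation ext := (ext F m).
Local Notation ebase := (@ebase F m).
Implicit Types (a b c : ext) (S A B T : {set 'I_m}) (s r : 'I_m).
Local Notation set0 := finset.set0.

Lemma extE a : a = \sum_S a S *: ebase S.
Proof.
apply/ffunP => T; rewrite sum_ffunE (bigD1 T)//= !ffunE eqxx.
rewrite big1 ?addr0 /GRing.scale/= ?mulr1// => S ST.
by rewrite !ffunE /GRing.scale/= eq_sym (negbTE ST) mulr0.
Qed.

Lemma ext_ind (P : ext -> Prop) : (forall S, P (ebase S)) ->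
  (forall a b, P a -> P b -> P (a + b)) -> (forall k a, P a -> P (k *: a)) ->
  forall a, P a.
Proof.
move=> Pb PD PZ a; rewrite [a]extE; elim/big_ind: _ => //; last by move=> S _; exact: PZ.
by rewrite -(scale0r (ebase set0)); exact: PZ.
Qed.

Lemma wedge_is_linear a : linear (wedge a).
Proof.
move=> k b c; apply/ffunP => S; rewrite !ffunE /GRing.scale/= big_distrr -big_split/=.
by apply: eq_bigr => A _; rewrite !ffunE /GRing.scale/=; ring.
Qed.
HB.instance Definition _ a :=
  GRing.isLinear.Build F ext ext _ (wedge a) (wedge_is_linear a).

Lemma wedgeDl a b c : wedge (a + b) c = wedge a c + wedge b c.
Proof.
apply/ffunP => S; rewrite !ffunE -big_split/=.
by apply: eq_bigr => A _; rewrite !ffunE; ring.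
Qed.

Lemma wedgeZl k a c : wedge (k *: a) c = k *: wedge a c.
Proof.
apply/ffunP => S; rewrite !ffunE /GRing.scale/= big_distrr /=.
by apply: eq_bigr => A _; rewrite !ffunE /GRing.scale/=; ring.
Qed.

Lemma wedgeNl a c : wedge (- a) c = - wedge a c.
Proof. by rewrite -scaleN1r wedgeZl scaleN1r. Qed.

Lemma wedge0l c : wedge 0 c = 0.
Proof. by have := wedgeZl 0 0 c; rewrite !scale0r. Qed.

Lemma wedge_suml I (r : seq I) (P : pred I) (G : I -> ext) c :
  wedge (\sum_(i <- r | P i) G i) c = \sum_(i <- r | P i) wedge (G i) c.
Proof.
exact: (big_morph (fun x => wedge x c) (fun x y => wedgeDl x y c) (wedge0l c)).
Qed.

Lemma interior_is_linear s : linear (@Defs.interior F m s).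
Proof.
move=> k b c; apply/ffunP => S; rewrite !ffunE /GRing.scale/=.
by case: ifP => _; rewrite ?mulr0 ?addr0//; ring.
Qed.
HB.instance Definition _ s :=
  GRing.isLinear.Build F ext ext _ (@Defs.interior F m s) (interior_is_linear s).

Lemma inversionsE A B :
  inversions A B = (\sum_(i in A) \sum_(j in B) (j < i)%N)%N.
Proof.
rewrite /inversions -sum1_card pair_big/= big_mkcond [RHS]big_mkcond/=.
by apply: eq_bigr => -[i j] _ /=; rewrite inE/= andbA; case: (i \in A);
  case: (j \in B) => //=; case: ltnP.
Qed.

Lemma count_below A s : #|[set j in A | (j < s)%N]%SET| = (\sum_(j in A) (j < s)%N)%N.
Proof.
rewrite -sum1_card big_mkcond [RHS]big_mkcond/=.
by apply: eq_bigr => j _; rewrite inE; case: (j \in A) => //=; case: ltnP.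
Qed.

Lemma wedge_base A B : wedge (ebase A) (ebase B) =
  if [disjoint A & B] then (-1) ^+ inversions A B *: ebase (A :|: B)%SET else 0.
Proof.
apply/ffunP => S; rewrite ffunE.
transitivity (if (A \subset S) && (S :\: A == B)%SET then (-1) ^+ inversions A B else 0 : F).
  case: ifPn => [/andP[AS /eqP SA]|].
    rewrite (bigD1 A) ?inE//= big1 ?addr0; first by rewrite !ffunE SA !eqxx !mulr1.
    by move=> A' /andP[_ nA]; rewrite !ffunE (negbTE nA) mulr0 mul0r.
  move=> H; rewrite big1// => A'; rewrite inE => A'S; rewrite !ffunE.
  case: eqP => [E|]; last by rewrite mulr0 mul0r.
  by subst A'; move: H; rewrite A'S/= => /negbTE ->; rewrite mulr0.
rewrite -finset.setI_eq0; have [E|nE] := eqVneq (A :&: B)%SET set0; last first.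
  rewrite ifF ?ffunE//; apply: contraNF nE => /andP[_ /eqP <-].
  by apply/eqP/finset.setP => x; rewrite !inE; case: (x \in A).
rewrite !ffunE /GRing.scale/=.
have AB x : x \in A -> x \in B = false.
  by move=> xA; move/finset.setP/(_ x): E; rewrite !inE xA.
case: (S =P (A :|: B)%SET) => [->|nS].
  rewrite finset.subsetUl/= (_ : _ :\: A = B)%SET ?eqxx ?mulr1//.
  by apply/finset.setP => x; rewrite !inE; have := AB x; case: (x \in A) => // ->.
rewrite mulr0 ifF//; apply/negP => /andP[/fintype.subsetP AS /eqP SA]; apply: nS.
by apply/finset.setP => x; rewrite -SA !inE; have := AS x; case: (x \in A) => // ->.
Qed.

Lemma disjointsU A B T :
  [disjoint A & (B :|: T)%SET] = [disjoint A & B] && [disjoint A & T].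
Proof. by rewrite -!finset.setI_eq0 finset.setIUr finset.setU_eq0. Qed.

Lemma disjointUs A B T :
  [disjoint (A :|: B)%SET & T] = [disjoint A & T] && [disjoint B & T].
Proof. by rewrite -!finset.setI_eq0 finset.setIUl finset.setU_eq0. Qed.

Lemma inversions_setUl A B T : [disjoint A & B] ->
  inversions (A :|: B)%SET T = (inversions A T + inversions B T)%N.
Proof. by move=> AB; rewrite !inversionsE -bigU//; apply: eq_bigl => x; rewrite !inE. Qed.

Lemma inversions_setUr A B T : [disjoint A & B] ->
  inversions T (A :|: B)%SET = (inversions T A + inversions T B)%N.
Proof.
move=> AB; rewrite !inversionsE -big_split/=; apply: eq_bigr => i _; rewrite -bigU//.
by apply: eq_bigl => x; rewrite !inE.
Qed.

(** By linearity it suffices to compare the signs on basis elements, where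
    inversions are additive in each of their two arguments. *)
Lemma wedgeA a b c : wedge a (wedge b c) = wedge (wedge a b) c.
Proof.
elim/ext_ind: a => [A|a a' IH IH'|k a IH]; last 2 first.
- by rewrite !wedgeDl IH IH'.
- by rewrite !wedgeZl IH.
elim/ext_ind: b => [B|b b' IH IH'|k b IH]; last 2 first.
- by rewrite !(wedgeDl, linearD)/= ?wedgeDl IH IH'.
- by rewrite !(wedgeZl, linearZ)/= ?wedgeZl IH.
elim/ext_ind: c => [T|c c' IH IH'|k c IH]; last 2 first.
- by rewrite !linearD /= IH IH'.
- by rewrite !linearZ /= IH.
rewrite !wedge_base.
have [AB|nAB] := boolP [disjoint A & B]; have [BT|nBT] := boolP [disjoint B & T];
  rewrite ?linear0 ?wedge0l// ?(linearZ, wedgeZl)/= !wedge_base.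
- rewrite disjointsU disjointUs AB BT/= andbT; case: ifP => AT; last by rewrite !scaler0.
  rewrite !scalerA -!exprD inversions_setUl// inversions_setUr// finset.setUA.
  by congr (_ ^+ _ *: _); ring.
- by rewrite disjointUs (negbTE nBT) andbF scaler0.
- by rewrite disjointsU (negbTE nAB) scaler0.
Qed.

Definition emul s : ext -> ext := wedge (ebase [set s]%SET).
HB.instance Definition _ s := GRing.Linear.on (emul s).

Lemma emulZ s k a : emul s (k *: a) = k *: emul s a.
Proof. exact: linearZ. Qed.

Lemma emul_wedge s a b : wedge (emul s a) b = emul s (wedge a b).
Proof. by rewrite /emul wedgeA. Qed.

Lemma wedge1l a : wedge (ebase set0) a = a.
Proof.
elim/ext_ind: a => [A|a b IH IH'|k a IH]; rewrite ?linearD ?linearZ/= ?IH ?IH'//.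
rewrite wedge_base -finset.setI_eq0 finset.set0I eqxx inversionsE big_set0.
by rewrite expr0 scale1r finset.set0U.
Qed.

Lemma emul_base s S : emul s (ebase S) =
  if s \in S then 0 else (-1) ^+ (\sum_(j in S) (j < s)%N)%N *: ebase (s |: S)%SET.
Proof.
rewrite /emul wedge_base disjoints1 inversionsE big_set1.
by case: (s \in S).
Qed.

Lemma interior_base s S : Defs.interior s (ebase S) =
  if s \in S then (-1) ^+ (\sum_(j in S) (j < s)%N)%N *: ebase (S :\ s)%SET else 0.
Proof.
apply/ffunP => T; rewrite !ffunE count_below.
case: ifPn => sT; case: ifPn => sS; rewrite ?ffunE//.
- rewrite /GRing.scale/= (_ : (T == _) = false) ?mulr0//.
  by apply/negP => /eqP E; move: sT; rewrite E !inE eqxx.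
- rewrite /GRing.scale/=.
  have [->|nT] := eqVneq T (S :\ s)%SET; last first.
    rewrite (_ : (_ == S) = false) ?mulr0//; apply/negP => /eqP E.
    by move/eqP: nT; apply; rewrite -E finset.setU1K.
  rewrite finset.setD1K// eqxx; congr (_ ^+ _ * _).
  by rewrite [RHS](big_setD1 s)//= ltnn add0n.
- rewrite (_ : (_ == S) = false) ?mulr0//; apply/negP => /eqP E.
  by move: sS; rewrite -E !inE eqxx.
Qed.

Lemma below_setD1 S s :
  (\sum_(j in (S :\ s)%SET) (j < s)%N)%N = (\sum_(j in S) (j < s)%N)%N.
Proof.
rewrite big_mkcond [RHS]big_mkcond; apply: eq_bigr => j _; rewrite !inE.
by case: eqP => [->|//]; rewrite ltnn if_same.
Qed.

Lemma below_setU1 S s :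
  (\sum_(j in (s |: S)%SET) (j < s)%N)%N = (\sum_(j in S) (j < s)%N)%N.
Proof.
rewrite big_mkcond [RHS]big_mkcond; apply: eq_bigr => j _; rewrite !inE.
by case: eqP => [->|//]; rewrite ltnn if_same.
Qed.

Lemma emul_anticomm s r a : emul s (emul r a) = - emul r (emul s a).
Proof.
rewrite /emul !wedgeA -wedgeNl; congr wedge.
rewrite !wedge_base !disjoints1 !inE !inversionsE !big_set1 eq_sym.
case: eqP => [->|/eqP sr]; first by rewrite oppr0.
rewrite /= finset.setUC; have : (s != r :> nat) by apply: contraNneq sr => /val_inj ->.
by rewrite neq_ltn => /orP[] sr'; rewrite sr' ltnNge (ltnW sr')/= expr0 expr1 scale1r
  scaleN1r ?opprK.
Qed.

Lemma emul_sqr s a : emul s (emul s a) = 0.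
Proof.
by rewrite /emul wedgeA wedge_base disjoints1 inE eqxx wedge0l.
Qed.

(** The Clifford relation: interior multiplication is an odd derivation. On basis
    elements the two signs differ by one because exactly one of s, r precedes the
    other. *)
Lemma interior_emul s r a :
  Defs.interior s (emul r a) = (s == r)%:R *: a - emul r (Defs.interior s a).
Proof.
elim/ext_ind: a => [S|a b IH IH'|k a IH]; last 2 first.
- by rewrite !linearD /= IH IH'; rewrite addrACA -opprD.
- by rewrite !linearZ /= IH scalerBr !scalerA mulrC scalerN.
rewrite emul_base interior_base; have [<-{r}|nsr] := eqVneq s r.
  rewrite scale1r; have [sS|sS] := boolP (s \in S).
    rewrite linear0 linearZ/= emul_base !inE eqxx/= finset.setD1K//.
    by rewrite below_setD1 scalerA -expr2 sqrr_sign scale1r subrr.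
  rewrite linear0 subr0 linearZ/= interior_base !inE eqxx/= finset.setU1K//.
  by rewrite below_setU1 scalerA -expr2 sqrr_sign scale1r.
rewrite scale0r sub0r.
have [rS|rS] := boolP (r \in S); have [sS|sS] := boolP (s \in S); rewrite ?linear0 ?oppr0//.
- by rewrite linearZ/= emul_base !inE rS eq_sym nsr/= scaler0 oppr0.
- rewrite !linearZ/= interior_base emul_base !inE sS orbT eq_sym (negbTE nsr)/= (negbTE rS).
  have <- : ((r |: S) :\ s)%SET = (r |: S :\ s)%SET.
    apply/finset.setP => x; rewrite !inE; have [->|//] := eqVneq x s.
    by rewrite (negbTE nsr).
  rewrite scalerN -scaleNr !scalerA; congr (_ *: _).
  rewrite mulNr -[RHS]mulN1r -!exprD -exprS big_setU1// [X in (X + _)%N](big_setD1 s)//=.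
  rewrite -[LHS]signr_odd -[RHS]signr_odd; congr (_ ^+ (nat_of_bool _)).
  have : (s != r :> nat) by apply: contraNneq nsr => /val_inj ->.
  rewrite neq_ltn /= !oddD.
  by case: (ltngtP s r) => //= _ _; move: (odd _) (odd _) => [] [].
- by rewrite linearZ/= interior_base !inE (negbTE nsr) (negbTE sS)/= scaler0.
Qed.

Lemma enum_sorted S : sorted (fun i j : 'I_m => (i < j)%N) (enum S).
Proof.
rewrite {1}/enum_mem; apply: sorted_filter; first by move=> x y z; exact: ltn_trans.
have := iota_ltn_sorted 0 m; rewrite -val_enum_ord sorted_map.
by rewrite enumT.
Qed.

Lemma enum_setU1_min s T : (forall t, t \in T -> (s < t)%N) ->
  enum (s |: T)%SET = s :: enum T.
Proof.
move=> sT; apply: (@irr_sorted_eq _ (fun i j : 'I_m => (i < j)%N)).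
- by move=> x y z; exact: ltn_trans.
- by move=> x; exact: ltnn.
- exact: enum_sorted.
- rewrite /= path_min_sorted ?enum_sorted//.
  by apply/allP => t; rewrite mem_enum => /sT.
- by move=> x; rewrite inE !mem_enum !inE.
Qed.

(** Building a set by adding elements below all the previous ones matches the
    increasing enumeration used in [wedge_seq], so that no sign appears. *)
Lemma set_min_ind (P : {set 'I_m} -> Prop) : P set0 ->
  (forall s T, (forall t, t \in T -> (s < t)%N) -> P T -> P (s |: T)%SET) ->
  forall S, P S.
Proof.
move=> P0 PU S.
suff Pl (l : seq 'I_m) : sorted (fun i j : 'I_m => (i < j)%N) l -> P [set x in l]%SET.
  have -> : S = [set x in enum S]%SET by apply/finset.setP => x; rewrite !inE mem_enum.
  by apply: Pl; exact: enum_sorted.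
elim: l => [|s l IH].
  by rewrite (_ : [set x in [::]]%SET = set0)//; apply/finset.setP => x; rewrite !inE.
move=> /= sl; have ltT : transitive (fun i j : 'I_m => (i < j)%N).
  by move=> x y z; exact: ltn_trans.
rewrite (_ : [set x in s :: l]%SET = (s |: [set x in l])%SET); last first.
  by apply/finset.setP => x; rewrite !inE.
apply: PU; first by move=> t; rewrite inE; move/(allP (order_path_min ltT sl)).
exact: IH (path_sorted sl).
Qed.

Lemma wedge_seq_enum0 (X : 'I_m -> ext) :
  wedge_seq [seq X s | s <- enum set0] = ebase set0.
Proof. by rewrite finset.enum_set0. Qed.

Lemma wedge_seq_enumU1 (X : 'I_m -> ext) s T : (forall t, t \in T -> (s < t)%N) ->
  wedge_seq [seq X t | t <- enum (s |: T)%SET] =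
  wedge (X s) (wedge_seq [seq X t | t <- enum T]).
Proof. by move=> sT; rewrite enum_setU1_min. Qed.

Lemma emul_min s T : (forall t, t \in T -> (s < t)%N) ->
  emul s (ebase T) = ebase (s |: T)%SET.
Proof.
move=> sT; rewrite emul_base ifF; last first.
  by apply/negP => /sT; rewrite ltnn.
by rewrite big1 ?expr0 ?scale1r// => t /sT st; rewrite ltnNge (ltnW st).
Qed.

(** The even derivation of the exterior algebra that sends e_r to e_q and every other
    generator to 0. The contractions are linear combinations of such operators. *)
Definition shift_op q r a := emul q (Defs.interior r a).
Lemma shift_op_is_linear q r : linear (shift_op q r).
Proof. by move=> k a b; rewrite /shift_op !linearP. Qed.
HB.instance Definition _ q r :=
  GRing.isLinear.Build F ext ext _ (shift_op q r) (shift_op_is_linear q r).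

Lemma shift_op_emul q r s a :
  shift_op q r (emul s a) = (r == s)%:R *: emul q a + emul s (shift_op q r a).
Proof.
by rewrite /shift_op interior_emul linearB linearZ/= emul_anticomm opprK.
Qed.

Lemma interior1 r : Defs.interior r (ebase set0) = 0.
Proof. by rewrite interior_base inE. Qed.

(** An odd derivation followed by left multiplication by a generator is an even
    derivation; the sign of the generator and that of the derivation cancel. *)
Lemma shift_op_wedge q r a b :
  shift_op q r (wedge a b) = wedge (shift_op q r a) b + wedge a (shift_op q r b).
Proof.
elim/ext_ind: a => [S|a a' IH IH'|k a IH]; last 2 first.
- by rewrite wedgeDl !linearD/= IH IH' !wedgeDl addrACA.
- by rewrite wedgeZl !linearZ/= IH !wedgeZl scalerDr.
elim/set_min_ind: S b => [|s T sT IH] b.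
  by rewrite !wedge1l /shift_op interior1 linear0 wedge0l add0r.
rewrite -emul_min// emul_wedge !shift_op_emul IH.
by rewrite wedgeDl wedgeZl !emul_wedge linearD/= addrA.
Qed.

Lemma covector_emul (c : 'rV[F]_m) a :
  wedge (covector c) a = \sum_(s < m) c 0 s *: emul s a.
Proof. by rewrite wedge_suml; apply: eq_bigr => s _; rewrite wedgeZl. Qed.

Lemma covector_emul_anticomm (c : 'rV[F]_m) s a :
  wedge (covector c) (emul s a) = - emul s (wedge (covector c) a).
Proof.
rewrite !covector_emul linear_sum/= -sumrN; apply: eq_bigr => r _.
by rewrite emul_anticomm linearZ/= scalerN.
Qed.

(** The Leibniz rule for the increasing product of covectors X_s that depend on a
    parameter, at a value where X_s is the multiple chi s of e_s: the s-th term
    replaces the factor X_s by its derivative dX s. The family D stands for the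
    derivatives, known only through their recursion. *)
Lemma first_variation (chi : 'I_m -> F) (dX : 'I_m -> 'rV[F]_m) (D : {set 'I_m} -> ext) :
  D set0 = 0 ->
  (forall s T, (forall t, t \in T -> (s < t)%N) ->
    D (s |: T)%SET = wedge (covector (dX s))
        (wedge_seq [seq chi t *: ebase [set t]%SET | t <- enum T])
      + wedge (chi s *: ebase [set s]%SET) (D T)) ->
  forall S, D S = \sum_(s in S) (\prod_(r in (S :\ s)%SET) chi r) *:
     wedge (covector (dX s)) (Defs.interior s (ebase S)).
Proof.
move=> D0 DU S.
have G S' : wedge_seq [seq chi t *: ebase [set t]%SET | t <- enum S'] =
    (\prod_(r in S') chi r) *: ebase S'.
  elim/set_min_ind: S' => [|s T sT IH]; first by rewrite wedge_seq_enum0 big_set0 scale1r.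
  have nsT : s \notin T by apply/negP => /sT; rewrite ltnn.
  rewrite wedge_seq_enumU1// IH wedgeZl linearZ/= -/(emul _ _) emul_min//.
  by rewrite scalerA big_setU1.
elim/set_min_ind: S => [|s T sT IH]; first by rewrite D0 big_set0.
have nsT : s \notin T by apply/negP => /sT; rewrite ltnn.
rewrite DU// G IH big_setU1//= finset.setU1K//; congr (_ + _).
  rewrite linearZ/= interior_base !inE eqxx/= finset.setU1K// below_setU1.
  rewrite (_ : (\sum_(j in T) (j < s))%N = 0%N) ?expr0 ?scale1r//.
  by apply: big1 => t /sT st; rewrite ltnNge (ltnW st).
rewrite wedgeZl -/(emul _ _) linear_sum/= scaler_sumr; apply: eq_bigr => r rT.
have sr : s != r by apply: contraNneq nsT => ->.
rewrite linearZ/= scalerA; congr (_ *: _).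
  rewrite [RHS](big_setD1 s)/=; last by rewrite !inE sr eqxx.
  congr (_ * _); apply: eq_bigl => x; rewrite !inE.
  by have [->|_] := eqVneq x s; rewrite ?(negbTE nsT) ?andbF.
rewrite -emul_min// interior_emul eq_sym (negbTE sr) scale0r sub0r linearN/=.
by rewrite covector_emul_anticomm opprK.
Qed.
End ExteriorAlgebra.

(** * Conjugation and contractions of complex forms *)

Section ComplexForms.
Variables (R : realType) (n : nat).
Local Notation C := R[i].
Local Notation cext := (ext C (n + n)).
Local Notation ebase := (@ebase C (n + n)).
Local Notation set0 := finset.set0.
Local Notation emul := (@emul C (n + n)).
Local Notation interior := (@Defs.interior C (n + n)).
Local Notation shift_op := (@shift_op C (n + n)).
Implicit Types (a b : cext) (f : 'M[C]_n) (S T : {set 'I_(n + n)}) (s r q : 'I_(n + n)).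

Definition swap s : 'I_(n + n) :=
  match fintype.split s with inl i => rshift n i | inr i => lshift n i end.

Lemma split_lshift (i : 'I_n) : fintype.split (lshift n i) = inl i.
Proof. exact: (unsplitK (inl i : 'I_n + 'I_n)). Qed.
Lemma split_rshift (i : 'I_n) : fintype.split (rshift n i) = inr i.
Proof. exact: (unsplitK (inr i : 'I_n + 'I_n)). Qed.
Lemma swap_lshift (i : 'I_n) : swap (lshift n i) = rshift n i.
Proof. by rewrite /swap split_lshift. Qed.
Lemma swap_rshift (i : 'I_n) : swap (rshift n i) = lshift n i.
Proof. by rewrite /swap split_rshift. Qed.

Lemma shiftP (P : 'I_(n + n) -> Prop) :
  (forall i, P (lshift n i)) -> (forall i, P (rshift n i)) -> forall s, P s.
Proof. by move=> Pl Pr s; rewrite -(splitK s); case: (fintype.split s). Qed.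

Lemma swapK : involutive swap.
Proof. by elim/shiftP => i; rewrite ?(swap_lshift, swap_rshift). Qed.

Lemma contrE f a :
  contr f a = \sum_(l < n) \sum_(k < n) f l k *: shift_op (rshift n k) (lshift n l) a.
Proof. by []. Qed.
Lemma contr_barE f a :
  contr_bar f a = \sum_(l < n) \sum_(k < n) (f l k)^* *: shift_op (lshift n k) (rshift n l) a.
Proof. by []. Qed.

Lemma contr_is_linear f : linear (@contr R n f).
Proof.
move=> k a b; rewrite !contrE scaler_sumr -big_split; apply: eq_bigr => l _ /=.
rewrite scaler_sumr -big_split; apply: eq_bigr => j _ /=.
by rewrite linearP/= scalerDr !scalerA mulrC.
Qed.
HB.instance Definition _ f := GRing.isLinear.Build C cext cext _ (@contr R n f)
  (contr_is_linear f).

Lemma contr_bar_is_linear f : linear (@contr_bar R n f).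
Proof.
move=> k a b; rewrite !contr_barE scaler_sumr -big_split; apply: eq_bigr => l _ /=.
rewrite scaler_sumr -big_split; apply: eq_bigr => j _ /=.
by rewrite linearP/= scalerDr !scalerA mulrC.
Qed.
HB.instance Definition _ f := GRing.isLinear.Build C cext cext _ (@contr_bar R n f)
  (contr_bar_is_linear f).

Lemma contr_wedge f a b : contr f (wedge a b) = wedge (contr f a) b + wedge a (contr f b).
Proof.
rewrite !contrE wedge_suml linear_sum -big_split; apply: eq_bigr => l _ /=.
rewrite wedge_suml linear_sum -big_split; apply: eq_bigr => k _ /=.
by rewrite shift_op_wedge scalerDr wedgeZl linearZ.
Qed.

Lemma contr_bar_wedge f a b :
  contr_bar f (wedge a b) = wedge (contr_bar f a) b + wedge a (contr_bar f b).
Proof.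
rewrite !contr_barE wedge_suml linear_sum -big_split; apply: eq_bigr => l _ /=.
rewrite wedge_suml linear_sum -big_split; apply: eq_bigr => k _ /=.
by rewrite shift_op_wedge scalerDr wedgeZl linearZ.
Qed.

(** The real derivation attached to f; it is the infinitesimal change of the type
    decomposition, and also that of the extension map. *)
Definition theta f a : cext := contr f a + contr_bar f a.
Lemma theta_is_linear f : linear (theta f).
Proof. by move=> k a b; rewrite /theta !linearP/= scalerDr addrACA. Qed.
HB.instance Definition _ f := GRing.isLinear.Build C cext cext _ (theta f) (theta_is_linear f).
Lemma theta_wedge f a b : theta f (wedge a b) = wedge (theta f a) b + wedge a (theta f b).
Proof. by rewrite /theta contr_wedge contr_bar_wedge wedgeDl linearD/= addrACA. Qed.

Lemma conj_extE a : conj_ext a =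
  \sum_S (a S)^* *: wedge_seq [seq ebase [set swap s]%SET | s <- enum S].
Proof.
rewrite /conj_ext; apply: eq_bigr => S _; congr (_ *: wedge_seq _); apply: eq_map => s.
by rewrite /swap; case: fintype.split.
Qed.

Lemma conj_extD a b : conj_ext (a + b) = conj_ext a + conj_ext b.
Proof.
by rewrite !conj_extE -big_split; apply: eq_bigr => S _; rewrite ffunE rmorphD scalerDl.
Qed.

Lemma conj_extZ k a : conj_ext (k *: a) = k^* *: conj_ext a.
Proof.
by rewrite !conj_extE scaler_sumr; apply: eq_bigr => S _; rewrite ffunE rmorphM scalerA.
Qed.

Lemma conj_ext0 : conj_ext (0 : cext) = 0.
Proof. by have := conj_extZ 0 0; rewrite rmorph0 !scale0r. Qed.

Lemma conj_extN a : conj_ext (- a) = - conj_ext a.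
Proof. by rewrite -scaleN1r conj_extZ rmorphN1 scaleN1r. Qed.

Lemma conj_ext_sum I (r : seq I) (P : pred I) (F : I -> cext) :
  conj_ext (\sum_(i <- r | P i) F i) = \sum_(i <- r | P i) conj_ext (F i).
Proof. exact: (big_morph _ conj_extD conj_ext0). Qed.

Lemma conj_ext_base S :
  conj_ext (ebase S) = wedge_seq [seq ebase [set swap s]%SET | s <- enum S].
Proof.
rewrite conj_extE (bigD1 S)//= ffunE eqxx rmorph1 scale1r big1 ?addr0// => T TS.
by rewrite ffunE (negbTE TS) rmorph0 scale0r.
Qed.

Lemma conj_ext_baseU1 s T : (forall t, t \in T -> (s < t)%N) ->
  conj_ext (ebase (s |: T)%SET) = emul (swap s) (conj_ext (ebase T)).
Proof. by move=> sT; rewrite !conj_ext_base wedge_seq_enumU1. Qed.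

(** By induction on the least element of the basis set, because conjugation is
    defined through increasing products, whose order it does not respect. *)
Lemma conj_emul s a : conj_ext (emul s a) = emul (swap s) (conj_ext a).
Proof.
elim/ext_ind: a => [S|a b IH IH'|k a IH]; last 2 first.
- by rewrite linearD/= !conj_extD IH IH' linearD.
- by rewrite linearZ/= !conj_extZ IH linearZ.
elim/set_min_ind: S s => [|s T sT IH] r.
  have r0 (t : 'I_(n + n)) : t \in set0 -> (r < t)%N by rewrite inE.
  by rewrite emul_min// conj_ext_baseU1.
have [rs|sr|/val_inj rs] := ltngtP r s.
- have rsT (t : 'I_(n + n)) : t \in (s |: T)%SET -> (r < t)%N.
    by rewrite !inE => /orP[/eqP->//|/sT]; exact: ltn_trans.
  by rewrite emul_min// conj_ext_baseU1.
- rewrite conj_ext_baseU1// [RHS]emul_anticomm -IH -emul_min// emul_anticomm conj_extN;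
  congr (- _).
  rewrite emul_base; case: ifPn => rT; first by rewrite linear0 !conj_ext0 linear0.
  rewrite emulZ conj_extZ [in RHS]conj_extZ emulZ; apply: (congr1 ( *:%R _)).
  have srT (t : 'I_(n + n)) : t \in (r |: T)%SET -> (s < t)%N.
    by rewrite !inE => /orP[/eqP->//|/sT].
  by rewrite emul_min// conj_ext_baseU1.
- by rewrite rs conj_ext_baseU1// emul_sqr -emul_min// emul_sqr conj_ext0.
Qed.

Lemma conj_interior s a : conj_ext (interior s a) = interior (swap s) (conj_ext a).
Proof.
elim/ext_ind: a => [S|a b IH IH'|k a IH]; last 2 first.
- by rewrite linearD/= !conj_extD IH IH' linearD.
- by rewrite linearZ/= !conj_extZ IH linearZ.
elim/set_min_ind: S => [|r T rT IH].
  by rewrite interior1 conj_ext0 conj_ext_base wedge_seq_enum0 interior1.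
rewrite -(emul_min _ rT) interior_emul conj_extD conj_extN conj_extZ !conj_emul IH interior_emul.
by rewrite (inj_eq (inv_inj swapK)) rmorph_nat.
Qed.

Lemma conj_extK a : conj_ext (conj_ext a) = a.
Proof.
elim/ext_ind: a => [S|a b IH IH'|k a IH]; last 2 first.
- by rewrite !conj_extD IH IH'.
- by rewrite !conj_extZ IH; congr (_ *: _); exact: conjcK.
elim/set_min_ind: S => [|r T rT IH].
  by rewrite !(conj_ext_base, wedge_seq_enum0).
by rewrite -(emul_min _ rT) !conj_emul swapK IH.
Qed.

Lemma conj_contr f a : conj_ext (contr f a) = contr_bar f (conj_ext a).
Proof.
rewrite contrE contr_barE conj_ext_sum; apply: eq_bigr => l _.
rewrite conj_ext_sum; apply: eq_bigr => k _.
by rewrite conj_extZ /shift_op conj_emul conj_interior swap_lshift swap_rshift.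
Qed.
End ComplexForms.

(** * Bidegrees, and the first variation of the type projections *)

Section Types.
Variables (R : realType) (n : nat).
Local Notation C := R[i].
Local Notation cext := (ext C (n + n)).
Local Notation ebase := (@ebase C (n + n)).
Local Notation set0 := finset.set0.
Local Notation emul := (@emul C (n + n)).
Local Notation interior := (@Defs.interior C (n + n)).
Local Notation shift_op := (@shift_op C (n + n)).
Implicit Types (a b : cext) (f : 'M[C]_n) (S T A : {set 'I_(n + n)}) (s r : 'I_(n + n)).

(** The basis element e_S has type (hdeg S, adeg S). *)
Definition hdeg S : nat := \sum_(s in S) (s < n)%N.
Definition adeg S : nat := \sum_(s in S) (n <= s)%N.

Lemma hdegU1 s S : s \notin S -> hdeg (s |: S)%SET = ((s < n)%N + hdeg S)%N.
Proof. by move=> sS; rewrite /hdeg big_setU1. Qed.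
Lemma adegU1 s S : s \notin S -> adeg (s |: S)%SET = ((n <= s)%N + adeg S)%N.
Proof. by move=> sS; rewrite /adeg big_setU1. Qed.
Lemma hdegD1 s S : s \in S -> hdeg S = ((s < n)%N + hdeg (S :\ s)%SET)%N.
Proof. by move=> sS; rewrite /hdeg (big_setD1 s). Qed.
Lemma adegD1 s S : s \in S -> adeg S = ((n <= s)%N + adeg (S :\ s)%SET)%N.
Proof. by move=> sS; rewrite /adeg (big_setD1 s). Qed.

Lemma hdeg_le S : (hdeg S <= n)%N.
Proof.
apply: (@leq_trans (\sum_(s < n + n) (s < n))%N).
  by rewrite [leqRHS](bigID (mem S))/= leq_addr.
rewrite big_split_ord/= [X in (_ + X)%N]big1 ?addn0.
  by rewrite (eq_bigr (fun=> 1%N)) ?sum1_card ?card_ord// => i _; rewrite ltn_ord.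
by move=> i _; rewrite ltnNge leq_addr.
Qed.
Lemma adeg_le S : (adeg S <= n)%N.
Proof.
apply: (@leq_trans (\sum_(s < n + n) (n <= s))%N).
  by rewrite [leqRHS](bigID (mem S))/= leq_addr.
rewrite big_split_ord/= [X in (X + _)%N]big1 ?add0n.
  by rewrite (eq_bigr (fun=> 1%N)) ?sum1_card ?card_ord// => i _; rewrite leq_addr.
by move=> i _; rewrite leqNgt ltn_ord.
Qed.

Definition tproj (p q : nat) a : cext :=
  [ffun S => if (hdeg S == p) && (adeg S == q) then a S else 0].

Lemma tproj_is_linear p q : linear (tproj p q).
Proof.
move=> k a b; apply/ffunP => S; rewrite !ffunE /GRing.scale/=.
by case: ifP; rewrite ?mulr0 ?addr0.
Qed.
HB.instance Definition _ p q :=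
  GRing.isLinear.Build C cext cext _ (tproj p q) (tproj_is_linear p q).

Lemma tproj_base p q S :
  tproj p q (ebase S) = ((hdeg S == p) && (adeg S == q))%:R *: ebase S.
Proof.
apply/ffunP => T; rewrite !ffunE /GRing.scale/=.
have [->|_] := eqVneq T S; first by case: ifP; rewrite ?mulr1.
by rewrite mulr0 if_same.
Qed.

(** X raises the bidegree by (i, j); the shifts may be negative. *)
Definition bidegree (i j : int) (X : cext -> cext) := forall S T, X (ebase S) T != 0 ->
  (hdeg T)%:Z = (hdeg S)%:Z + i /\ (adeg T)%:Z = (adeg S)%:Z + j.

Lemma bidegree_emul s : bidegree (s < n)%N (n <= s)%N (emul s).
Proof.
move=> S T; rewrite emul_base; case: ifPn => sS; first by rewrite ffunE eqxx.
rewrite !ffunE; have [->|_] := eqVneq T (s |: S)%SET; last by rewrite scaler0 eqxx.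
by rewrite hdegU1// adegU1// => _; split; rewrite addrC -PoszD.
Qed.

Lemma bidegree_interior s : bidegree (- (s < n)%N%:Z) (- (n <= s)%N%:Z) (interior s).
Proof.
move=> S T; rewrite interior_base; case: ifPn => sS; last by rewrite ffunE eqxx.
rewrite !ffunE; have [->|_] := eqVneq T (S :\ s)%SET; last by rewrite scaler0 eqxx.
by rewrite (hdegD1 sS) (adegD1 sS) => _; split; lia.
Qed.

Lemma bidegree_comp i j i' j' (X Y : {linear cext -> cext}) :
  bidegree i j X -> bidegree i' j' Y -> bidegree (i + i') (j + j') (fun a => X (Y a)).
Proof.
move=> dX dY S T; rewrite [Y _]extE linear_sum sum_ffunE => XY.
have [U /andP[YU XU]] : exists U, (Y (ebase S) U != 0) && (X (ebase U) T != 0).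
  apply/existsP; apply: contraNT XY => /existsPn H; apply/eqP; apply: big1 => U _.
  rewrite linearZ ffunE/=; have := H U; rewrite negb_and !negbK => /orP[] /eqP ->.
    by rewrite scale0r.
  by rewrite scaler0.
by have [-> ->] := dX _ _ XU; have [-> ->] := dY _ _ YU; split; rewrite addrAC addrA.
Qed.

(** An operator of pure bidegree (i, j) meets the projections on both sides for
    exactly one (p, q) on each basis element, or for none: this sorts the terms of
    the derivative of the Dolbeault operators. *)
Lemma sum_tproj (i j : int) (u v : nat) (X : {linear cext -> cext}) a :
  bidegree i j X ->
  \sum_(p < n.+1) \sum_(q < n.+1) tproj (p + u) (q + v) (X (tproj p q a)) =
  if (i == u) && (j == v) then X a else 0.
Proof.
move=> dX; elim/ext_ind: a => [S|a b IH IH'|k a IH]; last 2 first.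
- transitivity (\sum_(p < n.+1) \sum_(q < n.+1) tproj (p + u) (q + v) (X (tproj p q a)) +
    \sum_(p < n.+1) \sum_(q < n.+1) tproj (p + u) (q + v) (X (tproj p q b))).
    rewrite -big_split; apply: eq_bigr => p _; rewrite -big_split; apply: eq_bigr => q _.
    by rewrite !linearD.
  by rewrite IH IH'; case: ifP => _; rewrite ?linearD ?addr0.
- transitivity (k *: \sum_(p < n.+1) \sum_(q < n.+1) tproj (p + u) (q + v) (X (tproj p q a))).
    rewrite scaler_sumr; apply: eq_bigr => p _; rewrite scaler_sumr; apply: eq_bigr => q _.
    by rewrite !linearZ.
  by rewrite IH; case: ifP => _; rewrite ?linearZ ?scaler0.
have hS : (hdeg S < n.+1)%N by rewrite ltnS hdeg_le.
have aS : (adeg S < n.+1)%N by rewrite ltnS adeg_le.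
rewrite (bigD1 (Ordinal hS))//= [X in _ + X]big1 ?addr0; last first.
  move=> p hp; apply: big1 => q _; rewrite tproj_base (_ : (_ == _) = false) ?scale0r ?linear0//.
  by apply: contraNF hp => /eqP E; apply/eqP/val_inj; rewrite /= E.
rewrite (bigD1 (Ordinal aS))//= [X in _ + X]big1 ?addr0; last first.
  move=> q hq; rewrite tproj_base (_ : (adeg S == _) = false) ?andbF ?scale0r ?linear0//.
  by apply: contraNF hq => /eqP E; apply/eqP/val_inj; rewrite /= E.
rewrite tproj_base !eqxx scale1r; apply/ffunP => T; rewrite !ffunE.
have [E|nz] := eqVneq (X (ebase S) T) 0.
  by rewrite E if_same; case: ifP => _; rewrite ?E ?ffunE.
have [hT aT] := dX _ _ nz.
have -> : (hdeg T == (hdeg S + u)%N) = (i == u) by lia.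
have -> : (adeg T == (adeg S + v)%N) = (j == v) by lia.
by case: ifP => _; rewrite ?ffunE.
Qed.

Definition holo (s : 'I_(n + n)) : bool := (s < n)%N.

Lemma hdeg_holo_part S : #|holo_part S| = hdeg S.
Proof.
rewrite /hdeg -sum1_card big_mkcond [RHS]big_mkcond; apply: eq_bigr => s _.
by rewrite inE; case: (s \in S) => //=; case: ltnP.
Qed.
Lemma adeg_holo_part S : #|(S :\: holo_part S)%SET| = adeg S.
Proof.
rewrite /adeg -sum1_card big_mkcond [RHS]big_mkcond; apply: eq_bigr => s _.
by rewrite !inE; case: (s \in S) => //=; case: ltnP.
Qed.

(** Only the set A of holomorphic indices of S gives a nonzero product. *)
Lemma type_proj_std (J : 'M[R]_(n + n)) p q a :
  (forall s, cov10 J s = (holo s)%:R *: ebase [set s]%SET) ->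
  (forall s, cov01 J s = (~~ holo s)%:R *: ebase [set s]%SET) ->
  type_proj J p q a = tproj p q a.
Proof.
move=> c10 c01; rewrite [a in RHS]extE linear_sum /type_proj; apply: eq_bigr => S _.
rewrite linearZ/=; congr (_ *: _).
have E A : wedge_seq [seq (if s \in A then cov10 J s else cov01 J s) | s <- enum S] =
   (\prod_(s in S) ((s \in A) == holo s)%:R) *: ebase S.
  elim/set_min_ind: S => [|s T sT IH]; first by rewrite wedge_seq_enum0 big_set0 scale1r.
  have nsT : s \notin T by apply/negP => /sT; rewrite ltnn.
  rewrite (wedge_seq_enumU1 _ sT) IH big_setU1//= linearZ/=.
  rewrite (_ : (if s \in A then cov10 J s else cov01 J s) =
    ((s \in A) == holo s)%:R *: ebase [set s]%SET).
    by rewrite wedgeZl -/(emul _ _) (emul_min _ sT) scalerA mulrC.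
  by rewrite c10 c01; case: (s \in A); case: (holo s); rewrite ?scale0r.
under eq_bigr do rewrite E.
rewrite -scaler_suml tproj_base; congr (_ *: _).
rewrite big_mkcond (bigD1 (holo_part S))//= [X in _ + X]big1 ?addr0.
  rewrite inE hdeg_holo_part adeg_holo_part.
  have -> : holo_part S \subset S by apply/fintype.subsetP => s; rewrite inE => /andP[].
  rewrite /= big1; first by case: (_ && _).
  by move=> s sS; rewrite inE sS /= eqxx.
move=> A AH; case: ifP => // /andP[]; rewrite inE => AS _.
have [s sA] : exists s, (s \in S) && ((s \in A) != holo s).
  apply/existsP; apply: contraNT AH => /existsPn H; apply/eqP/finset.setP => s.
  rewrite inE; have := H s; case sS: (s \in S) => /=; first by rewrite negbK => /eqP.
  by move=> _; apply/negP => /(fintype.subsetP AS); rewrite sS.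
case/andP: sA => sS /negbTE sA; rewrite (bigD1 s)//= sA mul0r//.
Qed.

Lemma bidegree_shift_op r s : bidegree ((r < n)%N%:Z - (s < n)%N%:Z)
  ((n <= r)%N%:Z - (n <= s)%N%:Z) (shift_op r s).
Proof. exact: (bidegree_comp (@bidegree_emul r) (@bidegree_interior s)). Qed.

Lemma tproj_bidegree i j X p q S : bidegree i j X ->
  tproj p q (X (ebase S)) =
  (((hdeg S)%:Z + i == p) && ((adeg S)%:Z + j == q))%:R *: X (ebase S).
Proof.
move=> dX; apply/ffunP => T; rewrite !ffunE /GRing.scale/=.
have [E|nz] := eqVneq (X (ebase S) T) 0; first by rewrite E mulr0 if_same.
have [hT aT] := dX _ _ nz; rewrite -hT -aT !eqz_nat.
by case: ifP; rewrite ?mul1r ?mul0r.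
Qed.

(** The sign by which dz^l and its conjugate differ in the variation of the (1, 0)-part
    of a covector; it also records how the type changes when the generator e_s is
    replaced by its variation. *)
Definition hsign s : int := if holo s then 1 else -1.

(** Once the factor s is replaced by its derivative, the only splittings A of S that
    contribute agree with the holomorphic indices outside s. There are two of them,
    according to whether s belongs to A, and they carry opposite signs; exactly one
    of them has the type of e_S, the other has the type of the varied monomial. *)
Lemma type_variation_coef p q S s : s \in S ->
  \sum_(A in powerset S | (#|A| == p) && (#|(S :\: A)%SET| == q))
    (\prod_(r in (S :\ s)%SET) ((r \in A) == holo r)%:R) * (if s \in A then 1 else -1) =
  (hsign s)%:~R * (((hdeg S == p) && (adeg S == q))%:R
     - (((hdeg S)%:Z - hsign s == p) && ((adeg S)%:Z + hsign s == q))%:R) :> C.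
Proof.
move=> sS; rewrite big_mkcond; set H := holo_part S.
set G := (X in \sum_i X i).
have HS : H \subset S by apply/fintype.subsetP => r; rewrite inE => /andP[].
have inH r : r \in S -> (r \in H) = holo r by move=> rS; rewrite inE rS.
pose H0 := (H :\ s)%SET; pose H1 := (s |: H)%SET.
have H01 : H0 != H1.
  by apply/eqP => /finset.setP/(_ s); rewrite !inE eqxx.
have Gother A : A != H1 -> A != H0 -> G A = 0.
  rewrite /G => A1 A0; case: ifP => // /andP[]; rewrite inE => AS _.
  have [r /andP[rS rA]] : exists r, (r \in (S :\ s)%SET) && ((r \in A) != holo r).
    apply/existsP; apply: contraT => /existsPn K.
    have Ar r : r != s -> (r \in A) = (r \in H).
      move=> rs; have [rS|rS] := boolP (r \in S).
        by have := K r; rewrite !inE rs rS/= negbK => /eqP.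
      by rewrite !inE (negbTE rS)/=; apply/negP => /(fintype.subsetP AS); apply/negP.
    have [sA|sA] := boolP (s \in A).
      case/eqP: A1; apply/finset.setP => r; rewrite in_setU1.
      by have [->//|rs] := eqVneq r s; rewrite Ar.
    case/eqP: A0; apply/finset.setP => r; rewrite in_setD1.
    by have [->|rs] := eqVneq r s; [exact: negbTE|rewrite Ar].
  by rewrite (bigD1 r)//= (negbTE rA) !mul0r.
have -> : \sum_i G i = G H1 + G H0.
  rewrite (bigD1 H1)//= (bigD1 H0)//= big1 ?addr0// => A /andP[]; exact: Gother.
have p1 : \prod_(r in (S :\ s)%SET) ((r \in H1) == holo r)%:R = 1 :> C.
  apply: big1 => r; rewrite in_setD1 => /andP[rs rS].
  by rewrite in_setU1 (negbTE rs) inH// eqxx.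
have p0 : \prod_(r in (S :\ s)%SET) ((r \in H0) == holo r)%:R = 1 :> C.
  apply: big1 => r; rewrite in_setD1 => /andP[rs rS].
  by rewrite in_setD1 rs inH// eqxx.
have H1S : H1 \subset S by rewrite finset.subUset finset.sub1set sS.
have H0S : H0 \subset S by apply: fintype.subset_trans HS; exact: finset.subsetDl.
have cardS A : A \subset S -> (#|A| + #|(S :\: A)%SET| = hdeg S + adeg S)%N.
  move=> AS; rewrite -hdeg_holo_part -adeg_holo_part -/H.
  have := finset.cardsID A S; rewrite (finset.setIidPr AS) => ->.
  by have := finset.cardsID H S; rewrite (finset.setIidPr HS) => ->.
have cS1 := cardS _ H1S; have cS0 := cardS _ H0S.
have c1 : #|H1| = ((~~ holo s) + hdeg S)%N.
  by rewrite cardsU1 -/H hdeg_holo_part inH.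
have c0 : hdeg S = (holo s + #|H0|)%N by rewrite -hdeg_holo_part (cardsD1 s) -/H inH.
rewrite /G p1 p0 !inE H1S H0S eqxx/=.
move: c1 c0 cS1 cS0; rewrite /hsign.
move: (#|H1|) (#|H0|) (#|(S :\: H1)%SET|) (#|(S :\: H0)%SET|) => h1 h0 k1 k0.
move: (hdeg S) (adeg S) => h k; case: (holo s) => /= c1 c0 cS1 cS0.
  have -> : h1 = h by lia.
  have -> : k1 = k by lia.
  have -> : (h%:Z - 1 = h0%:Z) by lia.
  have -> : (k%:Z + 1 = k0%:Z) by lia.
  rewrite !eqz_nat mul1r; case: (_ && _); case: (_ && _); rewrite /= ?mulr1; ring.
have -> : h0 = h by lia.
have -> : k0 = k by lia.
have -> : (h%:Z - -1 = h1%:Z) by lia.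
have -> : (k%:Z + -1 = k1%:Z) by lia.
rewrite !eqz_nat mulN1r; case: (_ && _); case: (_ && _); rewrite /= ?mulr1; ring.
Qed.

Lemma covectorN (c : 'rV[C]_(n + n)) : covector (- c) = - covector c.
Proof.
by rewrite /covector -sumrN; apply: eq_bigr => s _; rewrite !mxE scaleNr.
Qed.

Section Variation.
Variables (f : 'M[C]_n) (drow : 'I_(n + n) -> 'rV[C]_(n + n)).
Hypothesis drowl : forall l, covector (drow (lshift n l)) =
  \sum_(k < n) f l k *: ebase [set rshift n k]%SET.
Hypothesis drowr : forall l, covector (drow (rshift n l)) =
  - \sum_(k < n) (f l k)^* *: ebase [set lshift n k]%SET.

Let Y s S := wedge (covector (drow s)) (interior s (ebase S)).

Let Yl l S : Y (lshift n l) S =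
  \sum_(k < n) f l k *: shift_op (rshift n k) (lshift n l) (ebase S).
Proof. by rewrite /Y drowl wedge_suml; apply: eq_bigr => k _; rewrite wedgeZl. Qed.
Let Yr l S : Y (rshift n l) S =
  - \sum_(k < n) (f l k)^* *: shift_op (lshift n k) (rshift n l) (ebase S).
Proof. by rewrite /Y drowr wedgeNl wedge_suml; congr (- _); apply: eq_bigr => k _;
  rewrite wedgeZl. Qed.

Lemma theta_base S : theta f (ebase S) = \sum_(s in S) (hsign s)%:~R *: Y s S.
Proof.
have -> : \sum_(s in S) (hsign s)%:~R *: Y s S = \sum_s (hsign s)%:~R *: Y s S.
  rewrite big_mkcond; apply: eq_bigr => s _; case: ifPn => // sS.
  by rewrite /Y interior_base (negbTE sS) linear0 scaler0.
rewrite big_split_ord/= /theta contrE contr_barE; congr (_ + _); apply: eq_bigr => l _.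
  by rewrite Yl /hsign /holo /= ltn_ord scale1r.
by rewrite Yr /hsign /holo /= ltnNge leq_addr /= scaleN1r opprK.
Qed.

Lemma tproj_Y p q s S : tproj p q (Y s S) =
  (((hdeg S)%:Z - hsign s == p) && ((adeg S)%:Z + hsign s == q))%:R *: Y s S.
Proof.
move: s; apply: shiftP => l.
  rewrite Yl linear_sum scaler_sumr; apply: eq_bigr => k _.
  rewrite linearZ/= (tproj_bidegree _ _ _ (@bidegree_shift_op _ _)) !scalerA mulrC.
  by rewrite /hsign /holo /= ltn_ord !ltnNge !leq_addr/= leqNgt ltn_ord.
rewrite Yr linearN scalerN linear_sum scaler_sumr; congr (- _); apply: eq_bigr => k _.
rewrite linearZ/= (tproj_bidegree _ _ _ (@bidegree_shift_op _ _)) !scalerA mulrC.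
by rewrite /hsign /holo /= ltn_ord !ltnNge !leq_addr/= leqNgt ltn_ord.
Qed.

(** The (1, 0)- and (0, 1)-parts of e_s have opposite derivatives since their sum is
    e_s; [type_variation_coef] then collects the terms of [first_variation] into
    the commutator of theta with the projection. Here D A S is the derivative of the
    monomial in which the factors in A are replaced by their (1, 0)-parts and the
    others by their (0, 1)-parts. *)
Lemma type_variation p q (D : {set 'I_(n + n)} -> {set 'I_(n + n)} -> cext) :
  (forall A, D A set0 = 0) ->
  (forall A s T, (forall t, t \in T -> (s < t)%N) ->
    D A (s |: T)%SET =
      wedge (covector (if s \in A then drow s else - drow s))
        (wedge_seq [seq ((t \in A) == holo t)%:R *: ebase [set t]%SET | t <- enum T])
      + wedge (((s \in A) == holo s)%:R *: ebase [set s]%SET) (D A T)) ->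
  forall S, \sum_(A in powerset S | (#|A| == p) && (#|(S :\: A)%SET| == q)) D A S =
    theta f (tproj p q (ebase S)) - tproj p q (theta f (ebase S)).
Proof.
move=> D0 DU S.
transitivity (\sum_(A in powerset S | (#|A| == p) && (#|(S :\: A)%SET| == q))
   \sum_(s in S) ((\prod_(r in (S :\ s)%SET) ((r \in A) == holo r)%:R)
     * (if s \in A then 1 else -1)) *: Y s S).
  apply: eq_bigr => A _; rewrite (first_variation (D0 A) (DU A)); apply: eq_bigr => s _.
  rewrite -scalerA; apply: (congr1 ( *:%R _)); rewrite /Y; case: ifP => _;
    first by rewrite scale1r.
  by rewrite covectorN wedgeNl scaleN1r.
rewrite exchange_big/= tproj_base linearZ/= theta_base scaler_sumr [tproj p q _]linear_sum -sumrB.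
apply: eq_bigr => s sS; rewrite -scaler_suml type_variation_coef//.
rewrite /= [tproj p q _]linearZ /= tproj_Y !scalerA -scalerBl.
by apply: (congr1 (fun c => c *: _)); ring.
Qed.
End Variation.
End Types.

Local Open Scope classical_set_scope.
Local Open Scope ring_scope.
Local Open Scope complex_scope.

(** * Calculus of C^k and smooth functions *)

Section Calculus.
Variables (R : realType) (V : normedModType R).
Implicit Types (f g : V -> R) (U : set V) (v w x : V).

Lemma Ck_eq k U f g : open U -> (forall x, U x -> f x = g x) ->
  Ck k U f -> Ck k U g.
Proof.
move=> oU; elim: k f g => [|k IH] f g fg /= [fc fd]; split=> //.
- move=> x Ux; move/(_ x Ux): fc; have nU : \forall y \near x, U y by apply: open_nbhs_nbhs.
  move=> fc; rewrite /prop_for /continuous_at -(fg x Ux); apply: cvg_trans fc.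
  by apply: near_eq_cvg; near=> y; rewrite fg//; near: y.
- move=> x Ux; move/(_ x Ux): fc; have nU : \forall y \near x, U y by apply: open_nbhs_nbhs.
  move=> fc; rewrite /prop_for /continuous_at -(fg x Ux); apply: cvg_trans fc.
  by apply: near_eq_cvg; near=> y; rewrite fg//; near: y.
move=> v; have [fdv fk] := fd v.
have nU x : U x -> \forall y \near x, f y = g y.
  move=> Ux; have : \forall y \near x, U y by apply: open_nbhs_nbhs.
  by apply: filterS => y; exact: fg.
split=> [x Ux|]; first exact: near_eq_derivable (nU x Ux) (fdv x Ux).
by apply: IH fk => x Ux; exact: near_eq_derive (nU x Ux).
Unshelve. all: by end_near. Qed.

Lemma Ck_sub k U U' f : U `<=` U' -> Ck k U' f -> Ck k U f.
Proof.
move=> UU'; elim: k f => [|k IH] f /= [fc fd].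
  by split=> // x /UU'; exact: fc.
split=> [x /UU'|v]; first exact: fc.
by have [fdv fk] := fd v; split=> [x /UU'|]; [exact: fdv|exact: IH].
Qed.

Lemma CkW k U f : Ck k.+1 U f -> Ck k U f.
Proof.
elim: k f => [|k IH] f [fc fd]; split=> // v.
by have [fdv fk] := fd v; split=> //; exact: IH.
Qed.

Lemma Ck_cst k U (c : R) : Ck k U (fun=> c).
Proof.
elim: k c => [|k IH] c; split=> //; try by move=> x _; exact: cvg_cst.
move=> v.
split=> [x _|]; first exact: derivable_cst.
suff -> : 'D_v (fun=> c) = (fun=> 0) :> (V -> R) by [].
by apply/funext => x; rewrite derive_cst.
Qed.

Lemma CkD k U f g : open U -> Ck k U f -> Ck k U g -> Ck k U (f + g).
Proof.
move=> oU; elim: k f g => [|k IH] f g [fc fd] [gc gd]; split=> //.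
- by move=> x Ux; apply: cvgD; [exact: fc|exact: gc].
- by move=> x Ux; apply: cvgD; [exact: fc|exact: gc].
move=> v; have [fdv fk] := fd v; have [gdv gk] := gd v.
split=> [x Ux|]; first by apply: derivableD; [exact: fdv|exact: gdv].
apply: Ck_eq (IH _ _ fk gk) => // x Ux.
by rewrite deriveD//; [exact: fdv|exact: gdv].
Qed.

Lemma CkM k U f g : open U -> Ck k U f -> Ck k U g -> Ck k U (f * g).
Proof.
move=> oU; elim: k f g => [|k IH] f g fk gk.
  split=> // x Ux; apply: cvgM; [exact: fk.1|exact: gk.1].
split; first by move=> x Ux; apply: cvgM; [exact: fk.1|exact: gk.1].
move=> v; have [fdv fk1] := fk.2 v; have [gdv gk1] := gk.2 v.
split=> [x Ux|]; first by apply: derivableM; [exact: fdv|exact: gdv].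
apply: (@Ck_eq _ _ (f * 'D_v g + g * 'D_v f)) => // [x Ux|].
  by rewrite deriveM//; [exact: fdv|exact: gdv].
by apply: CkD => //; apply: IH => //; exact: CkW.
Qed.

Lemma CkN k U f : open U -> Ck k U f -> Ck k U (- f).
Proof.
move=> oU fk; apply: (@Ck_eq _ _ ((fun=> -1) * f)) => // [x _|].
  by rewrite /GRing.mul/= mulN1r.
by apply: CkM => //; exact: Ck_cst.
Qed.

(** The derivative of 1/f is - f'/f^2, which involves 1/f only to order k, so
    induction on k applies. *)
Lemma CkV k U f : open U -> (forall x, U x -> f x != 0) ->
  Ck k U f -> Ck k U (fun x => (f x)^-1).
Proof.
move=> oU f0; elim: k => [|k IH] fk.
  by split=> // x Ux; apply: cvgV; [exact: f0|exact: fk.1].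
split; first by move=> x Ux; apply: cvgV; [exact: f0|exact: fk.1].
move=> v; have [fdv fk1] := fk.2 v.
split=> [x Ux|]; first by apply: derivableV; [exact: f0|exact: fdv].
have Vk := IH (CkW fk).
pose h x := (f x)^-1.
apply: (@Ck_eq _ _ (- (h * h * 'D_v f))) => // [x Ux|].
  rewrite deriveV//; [|exact: f0|exact: fdv].
  change (- (h x * h x * 'D_v f x) = - (f x) ^- 2 * 'D_v f x).
  by rewrite /h expr2 invfM mulNr.
by apply: CkN => //; apply: CkM => //; apply: CkM.
Qed.

Lemma smooth_derivable U f x v : smooth_on U f -> U x -> derivable f x v.
Proof. by move=> /(_ 1%N)[_ /(_ v)[+ _]]; exact. Qed.

Lemma smooth_derive U f v : smooth_on U f -> smooth_on U ('D_v f).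
Proof. by move=> fs k; have [_ /(_ v)[_]] := fs k.+1. Qed.

(** Homogeneity of the directional derivative in the direction, for a single
    direction and without differentiability. *)
Lemma is_deriveZv f x v (c : R) : derivable f x v ->
  is_derive x (c *: v) f (c * 'D_v f x).
Proof.
have [->|c0] := eqVneq c 0.
  by rewrite scale0r mul0r => _; exact: is_derive0.
move=> fv.
have E : (fun h => (h *: c)^-1 *: ((f \o shift x) ((h *: c) *: v) - f x)) @ 0^' --> 'D_v f x.
  have := @cvg_comp _ _ _ (fun h : R => h *: c) (fun h : R =>
    h^-1 *: ((f \o shift x) (h *: v) - f x)).
  move=> /(_ (0^') (0^') (nbhs ('D_v f x))); apply; last exact: fv.
  have cc : (fun h : R => h *: c) @ 0 --> (0 : R).
    by rewrite -[X in _ --> X](mul0r c); apply: cvgM; [exact: cvg_id|exact: cvg_cst].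
  move=> A /=; rewrite /nbhs /= /dnbhs /within /= => A0.
  have := cc _ A0; rewrite /= nbhs_filterE /=; apply: filterS => h hA h0.
  by apply: hA; rewrite scaler_eq0 negb_or h0.
have {}E : (fun h : R => h^-1 *: ((f \o shift x) (h *: (c *: v)) - f x)) @ 0^' -->
    c * 'D_v f x.
  suff <- : (fun h : R => c * ((h *: c)^-1 *: ((f \o shift x) ((h *: c) *: v) - f x)))
    = (fun h : R => h^-1 *: ((f \o shift x) (h *: (c *: v)) - f x)).
    by apply: cvgM => //; exact: cvg_cst.
  apply/funext => h; rewrite scalerA /GRing.scale/= invfM mulrA (mulrC h^-1) mulrA.
  by rewrite mulfV// mul1r.
split; last exact: cvg_lim E.
by apply/cvg_ex; eexists; exact: E.
Qed.

Lemma derive_line f x w (h s : R) : derivable f (x + (s * h) *: w) w ->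
  is_derive s 1 (fun s => f (x + (s * h) *: w)) (h * 'D_w f (x + (s * h) *: w)).
Proof.
move=> /(is_deriveZv h)[dfhw dfE].
have E : (fun k : R => k^-1 *: (((fun s =>
  f (x + (s * h) *: w)) \o shift s) (k *: 1) - f (x + (s * h) *: w)))
  = (fun k : R => k^-1 *: ((f \o shift (x + (s * h) *: w)) (k *: (h *: w)) - f (x +
    (s * h) *: w))).
  apply/funext => k /=; congr (_ *: (f _ - _)).
  by rewrite addrCA scalerA -scalerDl /GRing.scale/= mulr1 mulrDl.
split; first by rewrite /derivable E.
by rewrite /derive E -/(derive f _ _).
Qed.

Lemma mvt_dir f x w (h : R) :
  (forall s : R, 0 <= s <= 1 -> derivable f (x + (s * h) *: w) w) ->
  exists2 s : R, 0 <= s <= 1 &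
    f (x + h *: w) - f x = h * 'D_w f (x + (s * h) *: w).
Proof.
move=> fd; pose g s := f (x + (s * h) *: w).
have gd (s : R) : 0 <= s <= 1 -> is_derive s 1 g (h * 'D_w f (x + (s * h) *: w)).
  by move=> s01; apply: derive_line; exact: fd.
have [|||s] := @MVT_segment R g (fun s => h * 'D_w f (x + (s * h) *: w)) 0 1 => //.
- by move=> s; rewrite in_itv/= => /andP[/ltW s0 /ltW s1]; apply: gd; rewrite s0.
- apply: derivable_within_continuous => s; rewrite in_itv/= => s01.
  by have [] := gd s s01.
rewrite in_itv/= => s01 gE; exists s => //.
by move: gE; rewrite /g mul1r mul0r scale0r addr0 subr0 mulr1.
Qed.

Lemma near_box x v w (P : set V) : nbhs x P ->
  exists2 h : R, 0 < h & forall a b : R, `|a| <= h -> `|b| <= h -> P (x + a *: v + b *: w).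
Proof.
move=> /nbhs_normP[e /= e0 eP].
have d0 : 0 < `|v| + `|w| + 1 by rewrite ltr_wpDl// addr_ge0.
exists (e / (`|v| + `|w| + 1)); first exact: divr_gt0.
move=> a b ah bh; apply: eP; rewrite /ball_/= -addrA opprD addrA subrr sub0r normrN.
apply: le_lt_trans (ler_normD _ _) _; rewrite !normrZ.
have : `|a| * `|v| + `|b| * `|w| <= (e / (`|v| + `|w| + 1)) * (`|v| + `|w|).
  by rewrite mulrDr lerD// ler_wpM2r.
move/le_lt_trans; apply.
by rewrite -mulrA gtr_pMr// mulrC ltr_pdivrMr// mul1r ltrDl.
Qed.

(** The mean value theorem, once in each direction, for the second difference of f
    on a small parallelogram. *)
Lemma second_difference U f x v w (h : R) : smooth_on U f ->
  (forall a b : R, 0 <= a <= 1 -> 0 <= b <= 1 -> U (x + (a * h) *: v + (b * h) *: w)) ->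
  exists s t : R, [/\ 0 <= s <= 1, 0 <= t <= 1 &
    f (x + h *: v + h *: w) - f (x + h *: v) - (f (x + h *: w) - f x)
    = h * (h * 'D_w ('D_v f) (x + (s * h) *: v + (t * h) *: w))].
Proof.
move=> fs Uvw.
have one : 0 <= (1 : R) <= 1 by rewrite ler01 lexx.
have zero : 0 <= (0 : R) <= 1 by rewrite ler01 lexx.
have Uv (a : R) : 0 <= a <= 1 -> U (x + (a * h) *: v).
  by move=> a01; have := Uvw a 0 a01 zero; rewrite mul0r scale0r addr0.
have Uvh (a : R) : 0 <= a <= 1 -> U (x + h *: w + (a * h) *: v).
  by move=> a01; have := Uvw a 1 a01 one; rewrite mul1r addrAC.
pose g (s : R) := f (x + h *: w + (s * h) *: v) - f (x + (s * h) *: v).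
pose dg (s : R) := h * 'D_v f (x + h *: w + (s * h) *: v) - h * 'D_v f (x + (s * h) *: v).
have gd (s : R) : 0 <= s <= 1 -> is_derive s 1 g (dg s).
  move=> s01; apply: is_deriveB; apply: derive_line;
  by apply: smooth_derivable fs _; (exact: Uvh || exact: Uv).
have [|||s] := @MVT_segment R g dg 0 1 => //.
- by move=> s; rewrite in_itv/= => /andP[/ltW s0 /ltW s1]; apply: gd; rewrite s0.
- apply: derivable_within_continuous => s; rewrite in_itv/= => s01.
  by have [] := gd s s01.
rewrite in_itv/= => s01 gE.
have [|t t01 E] := @mvt_dir ('D_v f) (x + (s * h) *: v) w h.
  move=> t t01; apply: smooth_derivable (smooth_derive v fs) _; exact: Uvw.
exists s, t; split => //; rewrite -E mulrBr [in RHS]addrAC.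
move: gE; rewrite /g /dg !mul1r !mul0r !scale0r !addr0 subr0 mulr1 => <-.
by rewrite (addrAC x).
Qed.

(** The second difference is symmetric in v and w; it equals h^2 times either mixed
    derivative at some point of the parallelogram, and both are continuous. *)
Lemma derive_schwarz U f x v w : open U -> smooth_on U f -> U x ->
  'D_v ('D_w f) x = 'D_w ('D_v f) x.
Proof.
move=> oU fs Ux.
have nU : nbhs x U by apply: open_nbhs_nbhs.
have c1 : {for x, continuous ('D_v ('D_w f))}.
  by have [+ _] := smooth_derive v (smooth_derive w fs) 0%N; apply.
have c2 : {for x, continuous ('D_w ('D_v f))}.
  by have [+ _] := smooth_derive w (smooth_derive v fs) 0%N; apply.
apply/eqP; rewrite -subr_eq0 -normr_le0; apply/ler_addgt0Pl => e e0; rewrite addr0.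
have e20 : 0 < e / 2 by rewrite divr_gt0.
have /cvgrPdist_lt /(_ _ e20) n1 := c1.
have /cvgrPdist_lt /(_ _ e20) n2 := c2.
have [h h0 hP] := near_box v w (filterI nU (filterI n1 n2)).
have {}hP (a b : R) : 0 <= a <= 1 -> 0 <= b <= 1 -> [/\ U (x + (a * h) *: v + (b * h) *: w),
   `|'D_v ('D_w f) x - 'D_v ('D_w f) (x + (a * h) *: v + (b * h) *: w)| < e / 2 &
   `|'D_w ('D_v f) x - 'D_w ('D_v f) (x + (a * h) *: v + (b * h) *: w)| < e / 2].
  move=> /andP[a0 a1] /andP[b0 b1].
  have bd (c : R) : 0 <= c -> c <= 1 -> `|c * h| <= h.
    by move=> c0 c1'; rewrite normrM (ger0_norm (ltW h0)) ger0_norm// ler_piMl// ltW.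
  case: (hP (a * h) (b * h) (bd a a0 a1) (bd b b0 b1)) => A [B C].
  by split; [exact: A|exact: B|exact: C].
have Uvw (a b : R) : 0 <= a <= 1 -> 0 <= b <= 1 -> U (x + (a * h) *: v + (b * h) *: w).
  by move=> a01 b01; have [] := hP a b a01 b01.
have [s [t [s01 t01 E1]]] := second_difference fs Uvw.
have [s' [t' [s'01 t'01 E2]]] := second_difference fs (fun a b a01 b01 =>
  eq_ind _ U (Uvw b a b01 a01) _ (addrAC _ _ _)).
rewrite (addrAC x (h *: w)) (addrAC x ((s' * h) *: w)) in E2.
have E : 'D_w ('D_v f) (x + (s * h) *: v + (t * h) *: w) =
   'D_v ('D_w f) (x + (t' * h) *: v + (s' * h) *: w).
  apply: (mulfI (lt0r_neq0 h0)); apply: (mulfI (lt0r_neq0 h0)).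
  by apply: etrans (esym E1) (etrans _ E2); ring.
have [_ _ B1] := hP _ _ s01 t01; have [_ B2 _] := hP _ _ t'01 s'01.
rewrite E in B1; set y := 'D_v ('D_w f) (x + _ + _) in B1 B2.
apply: le_trans (ler_distD y _ _) _.
rewrite [leRHS]splitr; apply: lerD; first exact: (ltW B2).
by rewrite distrC; exact: (ltW B1).
Qed.

(** Smoothness gives only the directional derivatives, so additivity in the direction
    follows from the mean value theorem along the two sides of a path from x to
    x + k (v + w), and from continuity of the derivatives. *)
Lemma derive_addv U f x v w : open U -> smooth_on U f -> U x ->
  'D_(v + w) f x = 'D_v f x + 'D_w f x.
Proof.
move=> oU fs Ux.
have nU : nbhs x U by apply: open_nbhs_nbhs.
have c1 : {for x, continuous ('D_v f)}.
  by have [+ _] := smooth_derive v fs 0%N; apply.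
have c2 : {for x, continuous ('D_w f)}.
  by have [+ _] := smooth_derive w fs 0%N; apply.
apply: cvg_lim => //; apply/cvgrPdist_le => e e0.
have e20 : 0 < e / 2 by rewrite divr_gt0.
have /cvgrPdist_lt /(_ _ e20) n1 := c1.
have /cvgrPdist_lt /(_ _ e20) n2 := c2.
have [h h0 hP] := near_box v w (filterI nU (filterI n1 n2)).
near=> k.
have k0 : k != 0 by near: k; exact: nbhs_dnbhs_neq.
have kh : `|k| <= h.
  near: k; apply: dnbhs0_le => //.
have n0 : `|0 : R| <= h by rewrite normr0 ltW.
have bound (s : R) : 0 <= s <= 1 -> `|s * k| <= h.
  move=> /andP[s0 s1]; rewrite normrM (ger0_norm s0); apply: le_trans kh.
  by rewrite ler_piMl.
have [s s01 E1] : exists2 s : R, 0 <= s <= 1 & f (x + k *: v) - f x =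
  k * 'D_v f (x + (s * k) *: v).
  apply: mvt_dir => s s01; apply: smooth_derivable fs _.
  by have [+ _] := hP (s * k) 0 (bound s s01) n0; rewrite scale0r addr0.
have [t t01 E2] : exists2 t : R, 0 <= t <= 1 &
   f (x + k *: v + k *: w) - f (x + k *: v) = k * 'D_w f (x + k *: v + (t * k) *: w).
  apply: mvt_dir => t t01; apply: smooth_derivable fs _.
  by have [+ _] := hP k (t * k) kh (bound t t01).
have [_ [B1 _]] := hP (s * k) 0 (bound s s01) n0.
have [_ [_ B2]] := hP k (t * k) kh (bound t t01).
rewrite scale0r addr0 /= in B1; rewrite /= in B2.
rewrite (_ : (f \o shift x) (k *: (v + w)) - f x =
  k * ('D_v f (x + (s * k) *: v) + 'D_w f (x + k *: v + (t * k) *: w))).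
  rewrite /GRing.scale/= mulrA mulVf// mul1r.
  move: B1 B2; rewrite !ltr_norml ler_norml => /andP[? ?] /andP[? ?]; apply/andP; split; lra.
rewrite mulrDr -E1 -E2 /= scalerDr [k *: v + _ + x]addrC addrA.
by ring.
Unshelve. all: by end_near. Qed.
End Calculus.

Section ComplexCalculus.
Variables (R : realType) (V : normedModType R).
Local Notation C := R[i].
Implicit Types (f g : V -> C) (U : set V) (v w x : V).

Lemma csmooth_eq U f g : open U -> (forall x, U x -> f x = g x) ->
  csmooth_on U f -> csmooth_on U g.
Proof.
move=> oU fg [fr fi].
by split=> k; [apply: Ck_eq (fr k)|apply: Ck_eq (fi k)] => // x Ux; rewrite fg.
Qed.

Lemma csmooth_sub U U' f : U `<=` U' -> csmooth_on U' f -> csmooth_on U f.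
Proof. by move=> UU' [fr fi]; split=> k; apply: Ck_sub UU' _. Qed.

Lemma csmooth_cst U (c : C) : csmooth_on U (fun=> c).
Proof. by split=> k; exact: Ck_cst. Qed.

Lemma csmoothD U f g : open U -> csmooth_on U f -> csmooth_on U g ->
  csmooth_on U (fun x => f x + g x).
Proof.
move=> oU [fr fi] [gr gi]; split=> k.
  have -> : (fun x => complex.Re (f x + g x)) =
    (fun x => complex.Re (f x)) + (fun x => complex.Re (g x)).
    by apply/funext => x; rewrite raddfD.
  exact: CkD.
have -> : (fun x => complex.Im (f x + g x)) =
  (fun x => complex.Im (f x)) + (fun x => complex.Im (g x)).
  by apply/funext => x; rewrite raddfD.
exact: CkD.
Qed.

Lemma ReM (a b : C) : complex.Re (a * b) =
  complex.Re a * complex.Re b - complex.Im a * complex.Im b.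
Proof. by case: a => a1 a2; case: b. Qed.
Lemma ImM (a b : C) : complex.Im (a * b) =
  complex.Re a * complex.Im b + complex.Im a * complex.Re b.
Proof. by case: a => a1 a2; case: b. Qed.

Lemma csmoothM U f g : open U -> csmooth_on U f -> csmooth_on U g ->
  csmooth_on U (fun x => f x * g x).
Proof.
move=> oU [fr fi] [gr gi]; split=> k.
  have -> : (fun x => complex.Re (f x * g x)) =
    (fun x => complex.Re (f x)) * (fun x => complex.Re (g x)) +
    - ((fun x => complex.Im (f x)) * (fun x => complex.Im (g x))).
    by apply/funext => x; rewrite ReM.
  by apply: CkD => //; [exact: CkM|apply: CkN => //; exact: CkM].
have -> : (fun x => complex.Im (f x * g x)) =
  (fun x => complex.Re (f x)) * (fun x => complex.Im (g x)) +
  ((fun x => complex.Im (f x)) * (fun x => complex.Re (g x))).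
  by apply/funext => x; rewrite ImM.
by apply: CkD => //; exact: CkM.
Qed.

Lemma csmooth_conj U f : open U -> csmooth_on U f ->
  csmooth_on U (fun x => (f x)^*).
Proof.
move=> oU [fr fi]; split=> k.
  have -> : (fun x => complex.Re (f x)^*) = (fun x => complex.Re (f x)).
    by apply/funext => x; case: (f x).
  exact: fr.
have -> : (fun x => complex.Im (f x)^*) = - (fun x => complex.Im (f x)).
  by apply/funext => x; change (complex.Im (f x)^* = - complex.Im (f x)); case: (f x).
exact: CkN.
Qed.

(** Over the complex numbers 1/f is the conjugate of f divided by the real
    function |f|^2. *)
Lemma csmoothV U f : open U -> (forall x, U x -> f x != 0) ->
  csmooth_on U f -> csmooth_on U (fun x => (f x)^-1).
Proof.
move=> oU f0 fs; have [fr fi] := fs.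
pose N x : R := complex.Re (f x) ^+ 2 + complex.Im (f x) ^+ 2.
have N0 x : U x -> N x != 0.
  move=> /f0; apply: contraNneq; rewrite /N => /eqP.
  by rewrite paddr_eq0 ?sqr_ge0// !sqrf_eq0 eq_complex.
have NV : csmooth_on U (fun x => ((N x)^-1)%:C).
  split=> k /=; last exact: Ck_cst.
  apply: CkV => //.
  have -> : N = (fun x => complex.Re (f x)) * (fun x => complex.Re (f x)) +
    ((fun x => complex.Im (f x)) * (fun x => complex.Im (f x))) by [].
  by apply: CkD => //; exact: CkM.
apply: csmooth_eq (csmoothM oU (csmooth_conj oU fs) NV) => // x /N0.
rewrite /N; case: (f x) => a b /= ab0.
apply: (@mulfI _ (a +i* b)).
  apply: contraNneq ab0 => -[-> ->]; by rewrite expr0n/= addr0.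
rewrite mulfV; last by apply: contraNneq ab0 => -[-> ->]; by rewrite expr0n/= addr0.
apply/eqP; rewrite eq_complex/=; apply/andP; split; apply/eqP; last by ring.
by field; exact: ab0.
Qed.

Lemma csmooth_sum U (I : Type) (r : seq I) (P : pred I) (F : I -> V -> C) :
  open U -> (forall i, P i -> csmooth_on U (F i)) ->
  csmooth_on U (fun x => \sum_(i <- r | P i) F i x).
Proof.
move=> oU Fs; elim: r => [|i r IH].
  by apply: (@csmooth_eq _ (fun=> 0)) => [//|x _|]; rewrite ?big_nil//; exact: csmooth_cst.
case Pi: (P i); last first.
  by apply: csmooth_eq IH => // x _; rewrite big_cons Pi.
by apply: csmooth_eq (csmoothD oU (Fs i Pi) IH) => // x _; rewrite big_cons Pi.
Qed.

Lemma csmooth_prod U (I : Type) (r : seq I) (P : pred I) (F : I -> V -> C) :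
  open U -> (forall i, P i -> csmooth_on U (F i)) ->
  csmooth_on U (fun x => \prod_(i <- r | P i) F i x).
Proof.
move=> oU Fs; elim: r => [|i r IH].
  by apply: (@csmooth_eq _ (fun=> 1)) => [//|x _|]; rewrite ?big_nil//; exact: csmooth_cst.
case Pi: (P i); last first.
  by apply: csmooth_eq IH => // x _; rewrite big_cons Pi.
by apply: csmooth_eq (csmoothM oU (Fs i Pi) IH) => // x _; rewrite big_cons Pi.
Qed.

Lemma csmooth_det U n (A : V -> 'M[C]_n) : open U ->
  (forall i j, csmooth_on U (fun x => A x i j)) -> csmooth_on U (fun x => \det (A x)).
Proof.
move=> oU As; apply: csmooth_sum => // s _; apply: csmoothM => //.
  exact: csmooth_cst.
by apply: csmooth_prod.
Qed.

(** Cramer's rule. *)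
Lemma csmooth_invmx U n (A : V -> 'M[C]_n) : open U ->
  (forall x, U x -> A x \in unitmx) ->
  (forall i j, csmooth_on U (fun x => A x i j)) ->
  forall i j, csmooth_on U (fun x => invmx (A x) i j).
Proof.
move=> oU Au As i j.
apply: (@csmooth_eq _ (fun x => (\det (A x))^-1 * ((-1) ^+ (j +
  i) * \det (row' j (col' i (A x)))))).
- by [].
- by move=> x Ux; rewrite /invmx Au// !mxE.
apply: csmoothM => //.
  by apply: csmoothV => //; exact: csmooth_det.
apply: csmoothM => //; first exact: csmooth_cst.
apply: csmooth_det => // a b.
by apply: csmooth_eq (As (lift j a) (lift i b)) => // x _; rewrite !mxE.
Qed.

Lemma csmooth_cderive U f v : csmooth_on U f -> csmooth_on U (fun x => cderive f x v).
Proof. by move=> [fr fi]; split; exact: smooth_derive. Qed.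

Lemma cderive_near f g x v : (\forall y \near x, f y = g y) ->
  cderive f x v = cderive g x v.
Proof.
by move=> fg; rewrite /cderive; congr (_ +i* _); apply: near_eq_derive;
  apply: filterS fg => y ->.
Qed.

Lemma cderive_eq U f g x v : open U -> U x -> (forall y, U y -> f y = g y) ->
  cderive f x v = cderive g x v.
Proof.
move=> oU Ux fg; apply: cderive_near.
have nU : \forall y \near x, U y by apply: open_nbhs_nbhs.
exact: filterS nU.
Qed.

Lemma cderive_cst (c : C) x v : cderive (fun=> c) x v = 0.
Proof. by rewrite /cderive !derive_cst. Qed.

Section Rules.
Variables (U : set V) (oU : open U).

Lemma cderiveD f g x v : csmooth_on U f -> csmooth_on U g -> U x ->
  cderive (fun y => f y + g y) x v = cderive f x v + cderive g x v.
Proof.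
move=> [fr fi] [gr gi] Ux; rewrite /cderive.
have -> : (fun x => complex.Re (f x + g x)) =
    (fun x => complex.Re (f x)) + (fun x => complex.Re (g x)).
  by apply/funext => y; rewrite raddfD.
have -> : (fun x => complex.Im (f x + g x)) =
  (fun x => complex.Im (f x)) + (fun x => complex.Im (g x)).
  by apply/funext => y; rewrite raddfD.
by rewrite !deriveD//; apply: smooth_derivable Ux.
Qed.

Lemma cderiveM f g x v : csmooth_on U f -> csmooth_on U g -> U x ->
  cderive (fun y => f y * g y) x v = cderive f x v * g x + f x * cderive g x v.
Proof.
move=> [fr fi] [gr gi] Ux; rewrite /cderive.
have -> : (fun x => complex.Re (f x * g x)) =
    (fun x => complex.Re (f x)) * (fun x => complex.Re (g x)) -
    ((fun x => complex.Im (f x)) * (fun x => complex.Im (g x))).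
  by apply/funext => y; rewrite ReM.
have -> : (fun x => complex.Im (f x * g x)) =
  (fun x => complex.Re (f x)) * (fun x => complex.Im (g x)) +
  ((fun x => complex.Im (f x)) * (fun x => complex.Re (g x))).
  by apply/funext => y; rewrite ImM.
have fr1 := smooth_derivable (v:=v) fr Ux; have fi1 := smooth_derivable (v:=v) fi Ux.
have gr1 := smooth_derivable (v:=v) gr Ux; have gi1 := smooth_derivable (v:=v) gi Ux.
rewrite (deriveB (derivableM fr1 gr1) (derivableM fi1 gi1)).
rewrite (deriveD (derivableM fr1 gi1) (derivableM fi1 gr1)).
rewrite (deriveM fr1 gr1) (deriveM fi1 gi1) (deriveM fr1 gi1) (deriveM fi1 gr1).
case: (f x) => a b; case: (g x) => c d /=; rewrite /GRing.scale/=.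
apply/eqP; rewrite eq_complex/=; apply/andP; split; apply/eqP; ring.
Qed.

Lemma cderive_conj f x v : csmooth_on U f -> U x ->
  cderive (fun y => (f y)^*) x v = (cderive f x v)^*.
Proof.
move=> [fr fi] Ux; rewrite /cderive /=; congr (_ +i* _).
  by congr (derive _ x v); apply/funext => y; case: (f y).
rewrite -deriveN; last exact: smooth_derivable Ux.
by congr (derive _ x v); apply/funext => y; change (complex.Im (f y)^* = - complex.Im (f y));
  case: (f y).
Qed.

Lemma cderive_sum (I : Type) (r : seq I) (P : pred I) (F : I -> V -> C) x v :
  (forall i, P i -> csmooth_on U (F i)) -> U x ->
  cderive (fun y => \sum_(i <- r | P i) F i y) x v = \sum_(i <- r | P i) cderive (F i) x v.
Proof.
move=> Fs Ux; elim: r => [|i r IH].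
  rewrite big_nil -[RHS](cderive_cst 0 x v); congr (cderive _ x v).
  by apply/funext => y; rewrite big_nil.
rewrite big_cons; case: ifPn => [Pi|nPi]; last first.
  rewrite -IH; congr (cderive _ x v).
  by apply/funext => y; rewrite big_cons (negbTE nPi).
rewrite -IH -cderiveD//; [|exact: Fs|exact: csmooth_sum].
by congr (cderive _ x v); apply/funext => y; rewrite big_cons Pi.
Qed.

Lemma cderive_schwarz f x v w : csmooth_on U f -> U x ->
  cderive (fun y => cderive f y v) x w = cderive (fun y => cderive f y w) x v.
Proof.
move=> [fr fi] Ux.
have E1 := @derive_schwarz R V U _ x w v oU fr Ux.
have E2 := @derive_schwarz R V U _ x w v oU fi Ux.
exact (f_equal2 (@Complex R) E1 E2).
Qed.

Lemma cderive_addv f x v w : csmooth_on U f -> U x ->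
  cderive f x (v + w) = cderive f x v + cderive f x w.
Proof.
move=> [fr fi] Ux; rewrite /cderive (derive_addv v w oU fr Ux) (derive_addv v w oU fi Ux).
by [].
Qed.

Lemma cderive_scalev f x v (c : R) : csmooth_on U f -> U x ->
  cderive f x (c *: v) = c%:C * cderive f x v.
Proof.
move=> [fr fi] Ux; rewrite /cderive.
have [_ ->] := is_deriveZv c (smooth_derivable (v:=v) fr Ux).
have [_ ->] := is_deriveZv c (smooth_derivable (v:=v) fi Ux).
by apply/eqP; rewrite eq_complex/= !mul0r subr0 addr0 !eqxx.
Qed.

End Rules.
End ComplexCalculus.

(** * Smooth families of exterior elements *)

Section ExtCalculus.
Variables (R : realType) (W : normedModType R) (m : nat).
Local Notation C := R[i].
Local Notation ext := (ext C m).
Implicit Types (A B : W -> ext) (U : set W) (z v w : W).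

Definition esmooth U B := forall S, csmooth_on U (fun z => B z S).
Definition eder B z v : ext := [ffun S => cderive (fun y => B y S) z v].

Lemma eder_near A B z v : (\forall y \near z, A y = B y) -> eder A z v = eder B z v.
Proof.
move=> AB; apply/ffunP => S; rewrite !ffunE; apply: cderive_near.
by apply: filterS AB => y ->.
Qed.

Variables (U : set W) (oU : open U).

Lemma esmooth_eq A B : (forall z, U z -> A z = B z) -> esmooth U A -> esmooth U B.
Proof. by move=> AB As S; apply: csmooth_eq (As S) => // z Uz; rewrite AB. Qed.

Lemma esmooth_cst a : esmooth U (fun=> a).
Proof. by move=> S; exact: csmooth_cst. Qed.

Lemma esmoothD A B : esmooth U A -> esmooth U B -> esmooth U (fun z => A z + B z).
Proof.
move=> As Bs S; apply: csmooth_eq (csmoothD oU (As S) (Bs S)) => // z _.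
by rewrite ffunE.
Qed.

Lemma esmoothZ (k : W -> C) B : csmooth_on U k -> esmooth U B ->
  esmooth U (fun z => k z *: B z).
Proof.
move=> ks Bs S; apply: csmooth_eq (csmoothM oU ks (Bs S)) => // z _.
by rewrite ffunE.
Qed.

Lemma esmooth_sum I (r : seq I) (P : pred I) (F : I -> W -> ext) :
  (forall i, P i -> esmooth U (F i)) -> esmooth U (fun z => \sum_(i <- r | P i) F i z).
Proof.
move=> Fs S; apply: csmooth_eq (csmooth_sum r oU (fun i Pi => Fs i Pi S)) => // z _.
by rewrite sum_ffunE.
Qed.

Lemma esmooth_wedge A B : esmooth U A -> esmooth U B ->
  esmooth U (fun z => wedge (A z) (B z)).
Proof.
move=> As Bs S.
apply: (@csmooth_eq _ _ _ (fun z => \sum_(T in powerset S)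
     (-1) ^+ inversions T (S :\: T)%SET * A z T * B z (S :\: T)%SET)) => //.
  by move=> z _; rewrite ffunE.
apply: csmooth_sum => // T _; apply: csmoothM => //; apply: csmoothM => //.
exact: csmooth_cst.
Qed.

Lemma esmooth_wedge_seq (X : 'I_m -> W -> ext) (l : seq 'I_m) :
  (forall s, esmooth U (X s)) -> esmooth U (fun z => wedge_seq [seq X s z | s <- l]).
Proof.
move=> Xs; elim: l => [|s l IH] /=; first exact: esmooth_cst.
exact: esmooth_wedge.
Qed.

Lemma esmooth_lin (L : {linear ext -> ext}) B : esmooth U B -> esmooth U (fun z => L (B z)).
Proof.
move=> Bs; apply: (@esmooth_eq (fun z => \sum_S B z S *: L (ebase C S))).
  move=> z _; rewrite [in RHS](extE (B z)) linear_sum.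
  by apply: eq_bigr => S _; rewrite linearZ.
by apply: esmooth_sum => S _; apply: esmoothZ => //; exact: esmooth_cst.
Qed.

Lemma esmooth_eder B v : esmooth U B -> esmooth U (fun z => eder B z v).
Proof.
move=> Bs S; apply: csmooth_eq (csmooth_cderive v (Bs S)) => // z _.
by rewrite ffunE.
Qed.

Lemma eder_eq A B z v : U z -> (forall y, U y -> A y = B y) -> eder A z v = eder B z v.
Proof.
move=> Uz AB; apply/ffunP => S; rewrite !ffunE; apply: (cderive_eq _ oU Uz) => y Uy.
by rewrite AB.
Qed.

Lemma eder_cst a z v : eder (fun=> a) z v = 0.
Proof. by apply/ffunP => S; rewrite !ffunE cderive_cst. Qed.

Lemma ederD A B z v : esmooth U A -> esmooth U B -> U z ->
  eder (fun y => A y + B y) z v = eder A z v + eder B z v.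
Proof.
move=> As Bs Uz; apply/ffunP => S; rewrite !ffunE -(cderiveD v (As S) (Bs S) Uz).
by congr (cderive _ z v); apply/funext => y; rewrite ffunE.
Qed.

Lemma ederZ (k : W -> C) B z v : csmooth_on U k -> esmooth U B -> U z ->
  eder (fun y => k y *: B y) z v = cderive k z v *: B z + k z *: eder B z v.
Proof.
move=> ks Bs Uz; apply/ffunP => S; rewrite !ffunE -(cderiveM v ks (Bs S) Uz).
by congr (cderive _ z v); apply/funext => y; rewrite ffunE.
Qed.

Lemma eder_sum I (r : seq I) (P : pred I) (F : I -> W -> ext) z v :
  (forall i, P i -> esmooth U (F i)) -> U z ->
  eder (fun y => \sum_(i <- r | P i) F i y) z v = \sum_(i <- r | P i) eder (F i) z v.
Proof.
move=> Fs Uz; apply/ffunP => S; rewrite sum_ffunE ffunE.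
under [RHS]eq_bigr do rewrite ffunE.
rewrite -(cderive_sum oU r v (fun i Pi => Fs i Pi S) Uz).
by congr (cderive _ z v); apply/funext => y; rewrite sum_ffunE.
Qed.

Lemma eder_wedge A B z v : esmooth U A -> esmooth U B -> U z ->
  eder (fun y => wedge (A y) (B y)) z v = wedge (eder A z v) (B z) + wedge (A z) (eder B z v).
Proof.
move=> As Bs Uz; apply/ffunP => S; rewrite !ffunE -big_split/=.
transitivity (cderive (fun y => \sum_(T in powerset S)
     ((-1) ^+ inversions T (S :\: T)%SET * A y T) * B y (S :\: T)%SET) z v).
  by congr (cderive _ z v); apply/funext => y; rewrite ffunE.
have cs T : csmooth_on U (fun y => (-1) ^+ inversions T (S :\: T)%SET * A y T).
  by apply: csmoothM => //; exact: csmooth_cst.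
rewrite (cderive_sum oU); last 2 first.
- by move=> T _; apply: csmoothM.
- by [].
apply: eq_bigr => T _; rewrite (cderiveM _ (cs T) (Bs _) Uz).
rewrite (cderiveM _ (csmooth_cst _ _) (As _) Uz) cderive_cst mul0r add0r !ffunE.
by [].
Qed.

Lemma eder_lin (L : {linear ext -> ext}) B z v : esmooth U B -> U z ->
  eder (fun y => L (B y)) z v = L (eder B z v).
Proof.
move=> Bs Uz.
have LE a : L a = \sum_S a S *: L (ebase C S).
  by rewrite {1}(extE a) linear_sum; apply: eq_bigr => S _; rewrite linearZ.
transitivity (eder (fun y => \sum_S B y S *: L (ebase C S)) z v).
  by apply: eder_near; near=> y; rewrite LE.
rewrite eder_sum//; last first.
  by move=> S _; apply: esmoothZ => //; exact: esmooth_cst.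
rewrite [RHS]LE; apply: eq_bigr => S _; rewrite ederZ//; last exact: esmooth_cst.
by rewrite eder_cst scaler0 addr0 ffunE.
Unshelve. all: by end_near. Qed.

Lemma eder_schwarz B z v w : esmooth U B -> U z ->
  eder (fun y => eder B y v) z w = eder (fun y => eder B y w) z v.
Proof.
move=> Bs Uz; apply/ffunP => S; rewrite [LHS]ffunE [RHS]ffunE.
transitivity (cderive (fun y => cderive (fun x => B x S) y v) z w).
  by congr (cderive _ z w); apply/funext => y; rewrite ffunE.
rewrite (@cderive_schwarz R W U oU _ z v w (Bs S) Uz).
by congr (cderive _ z v); apply/funext => y; rewrite ffunE.
Qed.
End ExtCalculus.

(** * Derivatives on the product of a chart and the time axis *)

Section Families.
Variables (R : realType) (n : nat).
Local Notation C := R[i].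
Local Notation V := 'rV[R]_(n + n).
Local Notation W := (V * R)%type.
Local Notation cext := (ext C (n + n)).
Local Notation ebase := (@ebase C (n + n)).
Local Notation set0 := finset.set0.
Local Notation emul := (@emul C (n + n)).
Local Notation interior := (@Defs.interior C (n + n)).
Local Notation shift_op := (@shift_op C (n + n)).
Implicit Types (A B : W -> cext) (x : V) (z : W) (t : R) (s r : 'I_(n + n)).

Definition hdir (v : V) : W := (v, 0).
Definition tdir : W := (0, 1).

Lemma derive_hslice (F : W -> R) x t v :
  'D_v (fun y => F (y, t)) x = 'D_(hdir v) F (x, t).
Proof.
have E : (fun h : R => h^-1 *: (((fun y => F (y, t)) \o shift x) (h *: v) - F (x, t)))
  = (fun h : R => h^-1 *: ((F \o shift (x, t)) (h *: hdir v) - F (x, t))).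
  apply/funext => h /=; have -> : h *: hdir v + (x, t) = (h *: v + x, t); last by [].
  by apply: injective_projections; rewrite //= scaler0 add0r.
by rewrite /derive E.
Qed.

Lemma derive_tslice (F : W -> R) x t :
  'D_1 (fun u => F (x, u)) t = 'D_tdir F (x, t).
Proof.
have E : (fun h : R => h^-1 *: (((fun u => F (x, u)) \o shift t) (h *: 1) - F (x, t)))
  = (fun h : R => h^-1 *: ((F \o shift (x, t)) (h *: tdir) - F (x, t))).
  apply/funext => h /=; have -> : h *: tdir + (x, t) = (x, h *: 1 + t); last by [].
  by apply: injective_projections; rewrite //= scaler0 add0r.
by rewrite /derive E.
Qed.

Lemma cderive_hslice (F : W -> C) x t v :
  cderive (fun y => F (y, t)) x v = cderive F (x, t) (hdir v).
Proof.
exact: (f_equal2 (@Complex R) (derive_hslice (fun z => complex.Re (F z)) x t v)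
  (derive_hslice (fun z => complex.Im (F z)) x t v)).
Qed.

Lemma eder_hslice B x t v S :
  eder B (x, t) (hdir v) S = cderive (fun y => B (y, t) S) x v.
Proof. by rewrite ffunE (cderive_hslice (fun z => B z S)). Qed.

Lemma cderive1_slice (F : W -> C) x t :
  cderive1 (fun u => F (x, u)) t = cderive F (x, t) tdir.
Proof.
rewrite /cderive1 !derive1E.
exact: (f_equal2 (@Complex R) (derive_tslice (fun z => complex.Re (F z)) x t)
  (derive_tslice (fun z => complex.Im (F z)) x t)).
Qed.

Definition base_index s : 'I_n := match fintype.split s with inl i => i | inr i => i end.
Definition frame_coef s : C := if holo s then - 'i else 'i.

Definition dirx s : V := delta_mx 0 (lshift n (base_index s)).
Definition diry s : V := delta_mx 0 (rshift n (base_index s)).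

(** The derivative of B along d/dz^i or d/dzbar^i, for s the corresponding index.
    Both cases are of the form (d/dx + c d/dy)/2 with c = -i or c = i. *)
Definition frame_der s B z : cext :=
  2^-1 *: (eder B z (hdir (dirx s)) + frame_coef s *: eder B z (hdir (diry s))).

(** Identities on an open set of V x R restrict to neighbourhoods in the slice t,
    which suffices to differentiate in the space directions. *)
Lemma near_hslice (N : set W) x t : open N -> N (x, t) -> \forall y \near x, N (y, t).
Proof.
move=> oN Nxt; have nN : nbhs (x, t) N by apply: open_nbhs_nbhs.
case: nN => -[P Q] /= [Px Qt] PQ; apply: filterS Px => y Py.
by apply: PQ; split => //=; exact: nbhs_singleton.
Qed.

Lemma frame_der_slice s A B x t : (\forall y \near x, A (y, t) = B (y, t)) ->
  frame_der s A (x, t) = frame_der s B (x, t).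
Proof.
move=> AB; suff E v : eder A (x, t) (hdir v) = eder B (x, t) (hdir v) by rewrite /frame_der !E.
apply/ffunP => S; rewrite !eder_hslice.
by apply: cderive_near; apply: filterS AB => y ->.
Qed.

Lemma frame_derE s B x t S : frame_der s B (x, t) S =
  match fintype.split s with
  | inl i => wirt i (fun y => B (y, t) S) x
  | inr i => wirt_bar i (fun y => B (y, t) S) x end.
Proof.
have E k (a b : cext) : (2^-1 *: (a + k *: b)) S = 2^-1 * (a S + k * b S).
  by rewrite !ffunE.
rewrite /frame_der E 2!eder_hslice /dirx /diry; move: s; apply: shiftP => i.
  by rewrite /frame_coef /base_index split_lshift /holo /= ltn_ord mulNr.
by rewrite /frame_coef /base_index split_rshift /holo /= ltnNge leq_addr.
Qed.

Local Opaque eder cderive dirx diry hdir.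

Section Rules.
Variables (N : set W) (oN : open N).

Lemma esmooth_frame_der s B : esmooth N B -> esmooth N (frame_der s B).
Proof.
move=> Bs; apply: esmoothZ => //; first exact: csmooth_cst.
apply: esmoothD => //; first exact: esmooth_eder.
by apply: esmoothZ => //; [exact: csmooth_cst|exact: esmooth_eder].
Qed.

Lemma frame_derD s A B z : esmooth N A -> esmooth N B -> N z ->
  frame_der s (fun y => A y + B y) z = frame_der s A z + frame_der s B z.
Proof.
move=> As Bs Nz; rewrite /frame_der !(@ederD _ _ _ N)// -scalerDr; apply: (congr1 ( *:%R _)).
by rewrite scalerDr addrACA.
Qed.

Lemma frame_der_lin s (L : {linear cext -> cext}) B z : esmooth N B -> N z ->
  frame_der s (fun y => L (B y)) z = L (frame_der s B z).
Proof.
move=> Bs Nz; rewrite /frame_der !(@eder_lin _ _ _ N)// [RHS]linearZ.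
apply: (congr1 ( *:%R _)); rewrite [RHS]linearD; apply: (congr1 (+%R _)).
by rewrite [RHS]linearZ.
Qed.

Lemma frame_derN s B z : esmooth N B -> N z -> frame_der s (fun y => - B y) z = - frame_der s B z.
Proof. by move=> Bs Nz; exact: (frame_der_lin s -%R). Qed.

Lemma frame_der_sum s I (r : seq I) (P : pred I) (F : I -> W -> cext) z :
  (forall i, P i -> esmooth N (F i)) -> N z ->
  frame_der s (fun y => \sum_(i <- r | P i) F i y) z = \sum_(i <- r | P i) frame_der s (F i) z.
Proof.
move=> Fs Nz; rewrite /frame_der !(@eder_sum _ _ _ N)// scaler_sumr -big_split/= scaler_sumr.
by [].
Qed.

Lemma eder_linc (k : C) B z v : esmooth N B -> N z ->
  eder (fun y => k *: B y) z v = k *: eder B z v.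
Proof. by move=> Bs Nz; exact: (eder_lin oN ( *:%R k)). Qed.

(** Equality of mixed partial derivatives: the time derivative commutes with those
    of the space. *)
Lemma eder_frame_der s B z v : esmooth N B -> N z ->
  eder (frame_der s B) z v = frame_der s (fun y => eder B y v) z.
Proof.
move=> Bs Nz; rewrite /frame_der.
have es w : esmooth N (fun y => eder B y w) by exact: esmooth_eder.
have ks (k : C) A : esmooth N A -> esmooth N (fun y => k *: A y).
  by move=> As; apply: esmoothZ => //; exact: csmooth_cst.
have sv w := eder_schwarz oN w v Bs Nz.
have dl k A (As : esmooth N A) := @eder_linc k A z v As Nz.
rewrite dl; last by apply: esmoothD => //; exact: ks.
apply: (congr1 ( *:%R _)); rewrite (ederD v (es _) (ks _ _ (es _)) Nz) (dl _ _ (es _)).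
exact: (f_equal2 +%R (sv _) (congr1 ( *:%R _) (sv _))).
Qed.

Lemma frame_der_schwarz s r B z : esmooth N B -> N z ->
  frame_der s (frame_der r B) z = frame_der r (frame_der s B) z.
Proof.
move=> Bs Nz.
have es w : esmooth N (fun y => eder B y w) by exact: esmooth_eder.
have ks (k : C) A : esmooth N A -> esmooth N (fun y => k *: A y).
  by move=> As; apply: esmoothZ => //; exact: csmooth_cst.
have H w := @eder_frame_der r B z w Bs Nz.
pose A1 y := eder B y (hdir (dirx s)); pose A2 y := eder B y (hdir (diry s)).
have A1s : esmooth N A1 by exact: es.
have A2s : esmooth N A2 by exact: es.
have E2 := frame_der_lin r ( *:%R (frame_coef s)) A2s Nz.
have E1 := frame_derD r A1s (ks (frame_coef s) _ A2s) Nz.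
have E0 := frame_der_lin r ( *:%R 2^-1) (esmoothD oN A1s (ks (frame_coef s) _ A2s)) Nz.
rewrite [LHS]/frame_der.
transitivity (2^-1 *: (frame_der r A1 z + frame_coef s *: frame_der r A2 z)).
  exact: (congr1 ( *:%R _) (f_equal2 +%R (H _) (congr1 ( *:%R _) (H _)))).
apply: etrans _ (esym E0); apply: (congr1 ( *:%R _)).
apply: etrans _ (esym E1); apply: (congr1 (+%R _)).
exact: (esym E2).
Qed.
End Rules.
End Families.

(** * The Dolbeault operators of a family and their first variation *)

Section Core.
Variables (R : realType) (n : nat).
Local Notation C := R[i].
Local Notation V := 'rV[R]_(n + n).
Local Notation W := (V * R)%type.
Local Notation cext := (ext C (n + n)).
Local Notation ebase := (@ebase C (n + n)).
Local Notation set0 := finset.set0.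
Local Notation emul := (@emul C (n + n)).
Local Notation shift_op := (@shift_op C (n + n)).
Local Notation holo := (@holo n).
Local Notation tdir := (tdir R n).
Implicit Types (B : W -> cext) (x : V) (z : W) (t : R) (s r : 'I_(n + n)).

(** The operator del for b = true and delbar for b = false, in the standard complex
    structure of the chart. *)
Definition std_del (b : bool) B z : cext :=
  \sum_s if holo s == b then emul s (frame_der s B z) else 0.
(** The exterior derivative in the space directions. *)
Definition slice_d B z : cext := \sum_s emul s (frame_der s B z).

Definition contr_coef (c : bool) (f : 'M[C]_n) l k : C := if c then (f l k)^* else f l k.
Definition contr_gen (c : bool) (l k : 'I_n) : cext -> cext :=
  shift_op (if c then lshift n k else rshift n k) (if c then rshift n l else lshift n l).
Lemma contr_gen_is_linear c l k : linear (contr_gen c l k).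
Proof. by move=> a u v; rewrite /contr_gen linearP. Qed.
HB.instance Definition _ c l k :=
  GRing.isLinear.Build C cext cext _ (contr_gen c l k) (contr_gen_is_linear c l k).

(** The contraction by f for c = false, by its conjugate for c = true. The boolean
    lets both Dolbeault operators be treated at once; [contr_of true] has bidegree
    (1, -1), and it is the one that meets [std_del false] in the variation of
    del_t. *)
Definition contr_of (c : bool) (f : 'M[C]_n) (a : cext) : cext :=
  if c then contr_bar f a else contr f a.

Lemma contr_ofE c f a : contr_of c f a =
  \sum_(l < n) \sum_(k < n) contr_coef c f l k *: contr_gen c l k a.
Proof. by case: c. Qed.

Lemma thetaE f a : theta f a = \sum_(c : bool) contr_of c f a.
Proof. rewrite big_bool; exact: addrC. Qed.

Lemma contr_of_is_linear c f : linear (contr_of c f).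
Proof. by case: c => a u v; rewrite /contr_of linearP. Qed.
HB.instance Definition _ c f :=
  GRing.isLinear.Build C cext cext _ (contr_of c f) (contr_of_is_linear c f).

(** The combination of projections by which [del] (for b = true) and [delbar] are
    assembled from operators that depend on the type. *)
Definition type_sum (b : bool) (G : nat -> nat -> cext) : cext :=
  \sum_(p < n.+1) \sum_(q < n.+1) tproj (p + b) (q + ~~ b) (G p q).

Lemma type_sum_sum b (I : Type) (r : seq I) (P : pred I) (G : I -> nat -> nat -> cext) :
  type_sum b (fun p q => \sum_(i <- r | P i) G i p q) = \sum_(i <- r | P i) type_sum b (G i).
Proof.
rewrite /type_sum [RHS]exchange_big; apply: eq_bigr => p _ /=; rewrite [RHS]exchange_big.
by apply: eq_bigr => q _; rewrite linear_sum.
Qed.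

Lemma type_sumDB b (G H K : nat -> nat -> cext) :
  type_sum b (fun p q => G p q + H p q - K p q) = type_sum b G + type_sum b H - type_sum b K.
Proof.
rewrite /type_sum -big_split -sumrB; apply: eq_bigr => p _; rewrite -big_split -sumrB.
by apply: eq_bigr => q _; rewrite /= linearB linearD.
Qed.

Lemma type_sum_eq b (G H : nat -> nat -> cext) : (forall p q, G p q =
  H p q) -> type_sum b G = type_sum b H.
Proof.
by move=> GH; apply: eq_bigr => p _; apply: eq_bigr => q _; rewrite GH.
Qed.

Lemma type_sum_emul b s a :
  type_sum b (fun p q => emul s (tproj p q a)) = if holo s == b then emul s a else 0.
Proof.
rewrite /type_sum (sum_tproj _ _ _ (@bidegree_emul R n s)) /holo.
by rewrite (leqNgt n s); case: (s < n)%N; case: b.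
Qed.

Lemma bidegree_contr_gen c l k : bidegree (if c then 1 else -1) (if c then -1 else 1)
  (contr_gen c l k).
Proof.
have hl (i : 'I_n) : (lshift n i < n)%N = true by exact: (ltn_ord i).
have hr (i : 'I_n) : (rshift n i < n)%N = false by apply/negbTE; rewrite -leqNgt leq_addr.
have al (i : 'I_n) : (n <= lshift n i)%N = false by rewrite leqNgt hl.
have ar (i : 'I_n) : (n <= rshift n i)%N = true by rewrite leqNgt hr.
have E i j i' j' (X : cext -> cext) : i = i' -> j = j' -> bidegree i j X -> bidegree i' j' X.
  by move=> -> ->.
case: c; apply: E (@bidegree_shift_op R n _ _); rewrite ?hl ?hr ?al ?ar; lia.
Qed.

Lemma type_sum_contr_emul b c l k s a : type_sum b (fun p q =>
  contr_gen c l k (emul s (tproj p q a))) =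
  if (c == b) && (holo s == ~~ b) then contr_gen c l k (emul s a) else 0.
Proof.
have := @sum_tproj R n _ _ b (~~ b) (contr_gen c l k \o emul s) a
   (bidegree_comp (@bidegree_contr_gen c l k) (@bidegree_emul R n s)).
rewrite /type_sum /= => ->; rewrite /holo (leqNgt n s).
by case: (s < n)%N; case: b; case: c.
Qed.

Lemma type_sum_emul_contr b c l k s a : type_sum b (fun p q =>
  emul s (contr_gen c l k (tproj p q a))) =
  if (c == b) && (holo s == ~~ b) then emul s (contr_gen c l k a) else 0.
Proof.
have := @sum_tproj R n _ _ b (~~ b) (emul s \o contr_gen c l k) a
   (bidegree_comp (@bidegree_emul R n s) (@bidegree_contr_gen c l k)).
rewrite /type_sum /= => ->; rewrite /holo (leqNgt n s).
by case: (s < n)%N; case: b; case: c.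
Qed.

Lemma std_del_slice b (A B : W -> cext) x t : (\forall y \near x, A (y, t) = B (y, t)) ->
  std_del b A (x, t) = std_del b B (x, t).
Proof.
move=> AB; apply: eq_bigr => s _; case: (holo s == b); last by [].
by apply: (congr1 (emul s)); exact: frame_der_slice.
Qed.

Lemma std_delD (N : set W) b (A B : W -> cext) z : esmooth N A -> esmooth N B -> N z ->
  std_del b (fun y => A y + B y) z = std_del b A z + std_del b B z.
Proof.
move=> As Bs Nz; rewrite /std_del -big_split; apply: eq_bigr => s _ /=.
by rewrite (frame_derD s As Bs Nz) linearD; case: (holo s == b); [|rewrite addr0].
Qed.

Lemma std_delN (N : set W) (oN : open N) b (A : W -> cext) z : esmooth N A -> N z ->
  std_del b (fun y => - A y) z = - std_del b A z.
Proof.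
move=> As Nz; rewrite /std_del -sumrN; apply: eq_bigr => s _ /=.
by rewrite (frame_derN oN s As Nz) linearN; case: (holo s == b); [|rewrite oppr0].
Qed.

Lemma std_del_smooth (N : set W) (oN : open N) b B : esmooth N B -> esmooth N (std_del b B).
Proof.
move=> Bs; apply: esmooth_sum => // s _; case: (holo s == b).
  by apply: (esmooth_lin oN (emul s)); exact: esmooth_frame_der.
exact: esmooth_cst.
Qed.

(** Second derivatives are symmetric and left multiplications by generators
    anticommute. *)
Lemma std_del_sqr (N : set W) (oN : open N) b B z : esmooth N B -> N z ->
  std_del b (std_del b B) z = 0.
Proof.
move=> Bs Nz.
pose T s r := if (holo s == b) && (holo r == b) then emul s (emul r (frame_der s (frame_der r
  B) z)) else 0.
have TE : std_del b (std_del b B) z = \sum_s \sum_r T s r.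
  apply: eq_bigr => s _; rewrite /T; case: ifP => _; last by rewrite big1.
  rewrite [in LHS]/std_del (frame_der_sum oN); last 2 first.
  - move=> r _; case: (holo r == b); last exact: esmooth_cst.
    by apply: (esmooth_lin oN (emul r)); exact: esmooth_frame_der.
  - exact: Nz.
  rewrite linear_sum; apply: eq_bigr => r _ /=; case: (holo r == b).
    by apply: (congr1 (emul s)); exact: (frame_der_lin oN s (emul r) (esmooth_frame_der oN r
      Bs) Nz).
  rewrite -[RHS](linear0 (emul s)); apply: (congr1 (emul s)).
  by rewrite /frame_der !eder_cst scaler0 addr0 scaler0.
have TN s r : T r s = - T s r.
  rewrite /T; case: (holo r == b); case: (holo s == b); rewrite /= ?oppr0; try by [].
  rewrite emul_anticomm; apply: (congr1 -%R); do 2 apply: (congr1 (emul _)).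
  exact: (frame_der_schwarz oN r s Bs Nz).
have E : std_del b (std_del b B) z = - std_del b (std_del b B) z.
  rewrite {1}TE exchange_big TE -sumrN; apply: eq_bigr => s _ /=.
  by rewrite -sumrN; apply: eq_bigr => r _; exact: TN.
move: (std_del b _ z) E => a E; apply/ffunP => S; rewrite [RHS]ffunE.
have /eqP := congr1 (fun u : cext => u S) E.
by rewrite [(- _ : cext) S]ffunE -addr_eq0 -mulr2n mulrn_eq0 /= => /eqP.
Qed.

Section TypeProj.
Variables (N : set W) (oN : open N) (J : W -> 'M[R]_(n + n)) (F : W -> 'M[C]_n)
  (drow : W -> 'I_(n + n) -> 'rV[C]_(n + n)).
Hypothesis cov10_smooth : forall s, esmooth N (fun z => cov10 (J z) s).
Hypothesis cov01_smooth : forall s, esmooth N (fun z => cov01 (J z) s).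
Hypothesis cov10_0 : forall x s, N (x, 0) -> cov10 (J (x, 0)) s =
  (holo s)%:R *: ebase [set s]%SET.
Hypothesis cov01_0 : forall x s, N (x, 0) -> cov01 (J (x, 0)) s =
  (~~ holo s)%:R *: ebase [set s]%SET.
Hypothesis cov10_t : forall x s, N (x, 0) ->
  eder (fun z => cov10 (J z) s) (x, 0) tdir = covector (drow (x, 0) s).
Hypothesis cov01_t : forall x s, N (x, 0) ->
  eder (fun z => cov01 (J z) s) (x, 0) tdir = covector (- drow (x, 0) s).
Hypothesis drowl : forall x l, N (x, 0) -> covector (drow (x, 0) (lshift n l)) =
  \sum_(k < n) F (x, 0) l k *: ebase [set rshift n k]%SET.
Hypothesis drowr : forall x l, N (x, 0) -> covector (drow (x, 0) (rshift n l)) =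
  - \sum_(k < n) (F (x, 0) l k)^* *: ebase [set lshift n k]%SET.
Hypothesis F_smooth : forall l k, csmooth_on N (fun z => F z l k).

Definition type_part (p q : nat) B z : cext := type_proj (J z) p q (B z).

Definition type_mono (A S : {set 'I_(n + n)}) z : cext :=
  wedge_seq [seq (if s \in A then cov10 (J z) s else cov01 (J z) s) | s <- enum S].

Lemma type_mono_smooth A S : esmooth N (type_mono A S).
Proof.
apply: (esmooth_wedge_seq oN (X := fun s z => if s \in A then cov10 (J z) s else cov01 (J z) s)).
by move=> s; case: (s \in A); [exact: cov10_smooth|exact: cov01_smooth].
Qed.

Definition type_monos p q S z : cext :=
  \sum_(A in powerset S | (#|A| == p) && (#|(S :\: A)%SET| == q)) type_mono A S z.

Lemma type_monos_smooth p q S : esmooth N (type_monos p q S).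
Proof. by apply: esmooth_sum => // A _; exact: type_mono_smooth. Qed.

Lemma type_partE p q B z : type_part p q B z = \sum_S B z S *: type_monos p q S z.
Proof. by []. Qed.

Lemma type_part_smooth p q B : esmooth N B -> esmooth N (type_part p q B).
Proof.
move=> Bs; apply: esmooth_sum => // S _; apply: esmoothZ => //; exact: type_monos_smooth.
Qed.

Lemma type_part_0 p q B x : N (x, 0) -> type_part p q B (x, 0) = tproj p q (B (x, 0)).
Proof.
by move=> Nx; apply: type_proj_std => s; [exact: cov10_0|exact: cov01_0].
Qed.

Lemma type_monos_t p q S x : N (x, 0) -> eder (type_monos p q S) (x, 0) tdir =
  theta (F (x, 0)) (tproj p q (ebase S)) - tproj p q (theta (F (x, 0)) (ebase S)).
Proof.
move=> Nx.
pose D A S := eder (type_mono A S) (x, 0) tdir.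
rewrite -(@type_variation R n (F (x, 0)) (drow (x, 0)) (fun l => drowl l Nx) (fun l =>
  drowr l Nx) p q D).
- exact: (eder_sum oN _ _ (fun A _ => @type_mono_smooth A S) Nx).
- move=> A; rewrite /D -[RHS](eder_cst (ebase set0) (x, 0) tdir).
  apply: eder_near; near=> y; exact: wedge_seq_enum0.
move=> A s T sT; rewrite /D.
pose X s z := if s \in A then cov10 (J z) s else cov01 (J z) s.
transitivity (eder (fun z => wedge (X s z) (type_mono A T z)) (x, 0) tdir).
  apply: eder_near; near=> y; exact: wedge_seq_enumU1.
have Xs r : esmooth N (X r) by rewrite /X; case: (r \in A);
  [exact: cov10_smooth|exact: cov01_smooth].
rewrite (eder_wedge oN _ (Xs s) (@type_mono_smooth A T) Nx).
have X0 r : X r (x, 0) = ((r \in A) == holo r)%:R *: ebase [set r]%SET.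
  rewrite /X; case: (r \in A); first by rewrite (cov10_0 _ Nx); case: (holo r).
  by rewrite (cov01_0 _ Nx); case: (holo r).
have Xt : eder (X s) (x, 0) tdir = covector (if s \in A then drow (x, 0) s else - drow (x, 0) s).
  by rewrite /X; case: (s \in A); [exact: cov10_t|exact: cov01_t].
have M0 : type_mono A T (x, 0) =
  wedge_seq [seq ((r \in A) == holo r)%:R *: ebase [set r]%SET | r <- enum T].
  by congr wedge_seq; apply: eq_map => r; rewrite -X0.
by rewrite Xt M0 X0.
Unshelve. all: by end_near. Qed.

(** The product rule, with the variation of the projection at t = 0 given by
    [type_monos_t]. *)
Lemma type_part_t p q B x : esmooth N B -> N (x, 0) -> eder (type_part p q B) (x, 0) tdir =
  tproj p q (eder B (x, 0) tdir) + theta (F (x, 0)) (tproj p q (B (x, 0)))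
  - tproj p q (theta (F (x, 0)) (B (x, 0))).
Proof.
move=> Bs Nx.
have ms S := esmoothZ oN (Bs S) (@type_monos_smooth p q S).
have -> : eder (type_part p q B) (x, 0) tdir =
    \sum_S (eder B (x, 0) tdir S *: type_monos p q S (x, 0) +
      B (x, 0) S *: eder (type_monos p q S) (x, 0) tdir).
  have := @eder_sum _ _ _ N oN _ (index_enum _) xpredT _ (x, 0) tdir (fun S _ => ms S) Nx.
  rewrite [X in X = _ -> _](_ : _ = eder (type_part p q B) (x, 0) tdir)// => ->.
  apply: eq_bigr => S _; rewrite (ederZ _ (Bs S) (@type_monos_smooth p q S) Nx).
  by rewrite [eder B _ _ _]ffunE.
rewrite big_split/= -addrA; congr (_ + _).
  exact: (type_part_0 p q (fun=> eder B (x, 0) tdir) Nx).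
have LE (L : {linear cext -> cext}) a : L a = \sum_S a S *: L (ebase S).
  by rewrite {1}(extE a) linear_sum; apply: eq_bigr => S _; rewrite linearZ.
have E1 := LE (theta (F (x, 0)) \o tproj p q) (B (x, 0)).
have E2 := LE (tproj p q \o theta (F (x, 0))) (B (x, 0)).
rewrite /= in E1 E2; rewrite E1 E2 -sumrB; apply: eq_bigr => S _.
by rewrite (type_monos_t _ _ _ Nx) scalerBr.
Qed.

(** The operator del_t (b = true) or delbar_t (b = false) of the family J, applied on
    each slice t of B. *)
Definition fam_del (b : bool) B z : cext :=
  \sum_(p < n.+1) \sum_(q < n.+1) type_part (p + b) (q + ~~ b) (slice_d (type_part p q B)) z.

Lemma slice_d_smooth B : esmooth N B -> esmooth N (slice_d B).
Proof.
move=> Bs; apply: esmooth_sum => // s _; apply: (esmooth_lin oN (emul s)).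
exact: esmooth_frame_der.
Qed.

Lemma fam_del_smooth b B : esmooth N B -> esmooth N (fam_del b B).
Proof.
move=> Bs; apply: esmooth_sum => // p _; apply: esmooth_sum => // q _.
by apply: type_part_smooth; apply: slice_d_smooth; exact: type_part_smooth.
Qed.

Lemma contr_coef_smooth c l k : csmooth_on N (fun z => contr_coef c (F z) l k).
Proof.
case: c; last exact: F_smooth.
by apply: csmooth_conj => //; exact: F_smooth.
Qed.

Lemma contr_coefZ_smooth c l k B : esmooth N B -> esmooth N (fun z =>
  contr_coef c (F z) l k *: B z).
Proof. by move=> Bs; apply: esmoothZ => //; exact: contr_coef_smooth. Qed.

Lemma contr_ofB c z a : contr_of c (F z) a =
  \sum_(l < n) \sum_(k < n) contr_gen c l k (contr_coef c (F z) l k *: a).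
Proof.
by rewrite contr_ofE; apply: eq_bigr => l _; apply: eq_bigr => k _; rewrite linearZ.
Qed.

Lemma contr_of_smooth c B : esmooth N B -> esmooth N (fun z => contr_of c (F z) (B z)).
Proof.
move=> Bs; apply: (@esmooth_eq _ _ _ _ oN (fun z =>
  \sum_(l < n) \sum_(k < n) contr_gen c l k (contr_coef c (F z) l k *: B z))).
  by move=> z _; rewrite contr_ofB.
apply: esmooth_sum => // l _; apply: esmooth_sum => // k _.
by apply: (esmooth_lin oN (contr_gen c l k)); exact: contr_coefZ_smooth.
Qed.

Lemma theta_smooth B : esmooth N B -> esmooth N (fun z => theta (F z) (B z)).
Proof.
move=> Bs; apply: (@esmooth_eq _ _ _ _ oN (fun z => \sum_(c : bool) contr_of c (F z) (B z))).
  by move=> z _; rewrite thetaE.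
by apply: esmooth_sum => // c _; exact: contr_of_smooth.
Qed.

(** The coefficients of f depend on the point, so they are kept together with B
    under the derivative, and only the constant operators are moved out. *)
Lemma frame_der_contr_of s c B z (L : {linear cext -> cext}) : esmooth N B -> N z ->
  frame_der s (fun y => contr_of c (F y) (L (B y))) z =
  \sum_(l < n) \sum_(k < n) contr_gen c l k (L (frame_der s (fun y =>
    contr_coef c (F y) l k *: B y) z)).
Proof.
move=> Bs Nz.
have E y : contr_of c (F y) (L (B y)) =
    \sum_(l < n) \sum_(k < n) (contr_gen c l k \o L) (contr_coef c (F y) l k *: B y).
  by rewrite contr_ofB; apply: eq_bigr => l _; apply: eq_bigr => k _ /=;
    rewrite [L (_ *: _)]linearZ.
have -> : frame_der s (fun y => contr_of c (F y) (L (B y))) z =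
    frame_der s (fun y => \sum_(l < n) \sum_(k < n) (contr_gen c l k \o L) (contr_coef c (F
      y) l k *: B y)) z.
  by case: z Nz => x u Nz; apply: frame_der_slice; near=> y; exact: E.
have Gs l k : esmooth N (fun y => (contr_gen c l k \o L) (contr_coef c (F y) l k *: B y)).
  by apply: esmooth_lin => //; exact: contr_coefZ_smooth.
rewrite (frame_der_sum oN); [|by move=> l _; apply: esmooth_sum => // k _; exact: Gs|by []].
apply: eq_bigr => l _; rewrite (frame_der_sum oN); [|by move=> k _; exact: Gs|by []].
apply: eq_bigr => k _.
exact: (frame_der_lin oN s (contr_gen c l k \o L) (contr_coefZ_smooth c l k Bs) Nz).
Unshelve. all: by end_near. Qed.

Lemma frame_der_type_part s p q B x : esmooth N B -> N (x, 0) ->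
  frame_der s (type_part p q B) (x, 0) = tproj p q (frame_der s B (x, 0)).
Proof.
move=> Bs Nx; rewrite -(frame_der_lin oN s (tproj p q) Bs Nx); apply: frame_der_slice.
by apply: filterS (near_hslice oN Nx) => y Ny; exact: type_part_0.
Qed.

Lemma fam_del_0 b B x : esmooth N B -> N (x, 0) -> fam_del b B (x, 0) = std_del b B (x, 0).
Proof.
move=> Bs Nx; transitivity (type_sum b (fun p q =>
  \sum_s emul s (tproj p q (frame_der s B (x, 0))))).
  apply: eq_bigr => p _; apply: eq_bigr => q _; rewrite type_part_0//;
    apply: (congr1 (tproj _ _)).
  by apply: eq_bigr => s _; rewrite frame_der_type_part.
by rewrite type_sum_sum; apply: eq_bigr => s _; exact: type_sum_emul.
Qed.

(** The time derivative commutes with d and falls on the inner projection, whose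
    variation is known on a whole neighbourhood in the slice t = 0 and can thus be
    differentiated in the space directions. *)
Lemma slice_d_type_part_t p q B x : esmooth N B -> N (x, 0) ->
  eder (slice_d (type_part p q B)) (x, 0) tdir = \sum_s emul s
    (tproj p q (frame_der s (fun y => eder B y tdir) (x, 0)) +
     \sum_(c : bool) \sum_(l < n) \sum_(k < n)
        contr_gen c l k (tproj p q (frame_der s (fun y => contr_coef c (F y) l k *: B y) (x, 0)))
     - tproj p q (frame_der s (fun y => theta (F y) (B y)) (x, 0))).
Proof.
move=> Bs Nx.
have tps := type_part_smooth p q Bs.
have TBs : esmooth N (fun y => eder B y tdir) by exact: esmooth_eder.
have ThBs := theta_smooth Bs.
rewrite /slice_d (eder_sum oN); last 2 first.
- by move=> s _; apply: (esmooth_lin oN (emul s)); exact: esmooth_frame_der.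
- exact: Nx.
apply: eq_bigr => s _.
rewrite (eder_lin oN (emul s) tdir (esmooth_frame_der oN s tps) Nx); apply: (congr1 (emul s)).
rewrite (eder_frame_der oN s tdir tps Nx).
pose H1 y := tproj p q (eder B y tdir).
pose H2 y := \sum_(c : bool) contr_of c (F y) (tproj p q (B y)).
pose H3 y := (-%R \o tproj p q) (theta (F y) (B y)).
have H1s : esmooth N H1 by exact: (esmooth_lin oN (tproj p q)).
have H2s : esmooth N H2.
  by apply: esmooth_sum => // c _; apply: contr_of_smooth; exact: (esmooth_lin oN (tproj p q)).
have H3s : esmooth N H3 by exact: (esmooth_lin oN (-%R \o tproj p q)).
transitivity (frame_der s (fun y => H1 y + H2 y + H3 y) (x, 0)).
  apply: frame_der_slice; apply: filterS (near_hslice oN Nx) => y Ny.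
  by rewrite (type_part_t _ _ Bs Ny) [theta _ (tproj _ _ _)]thetaE.
rewrite (frame_derD s (esmoothD oN H1s H2s) H3s Nx) (frame_derD s H1s H2s Nx).
apply: (f_equal2 +%R); last exact: (frame_der_lin oN s (-%R \o tproj p q) ThBs Nx).
apply: (f_equal2 +%R); first exact: (frame_der_lin oN s (tproj p q) TBs Nx).
rewrite /H2 (frame_der_sum oN); last 2 first.
- by move=> c _; apply: contr_of_smooth; exact: (esmooth_lin oN (tproj p q)).
- exact: Nx.
by apply: eq_bigr => c _; exact: (frame_der_contr_of s c (tproj p q) Bs Nx).
Qed.

Lemma sum_bool_at (b P : bool) (X : bool -> cext) :
  \sum_(c : bool) (if (c == b) && P then X c else 0) = if P then X b else 0.
Proof. by rewrite big_bool; case: b; case: P; rewrite /= ?addr0 ?add0r. Qed.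

Lemma linZ (L : {linear cext -> cext}) k a : L (k *: a) = k *: L a.
Proof. exact: linearZ. Qed.

(** Between the two projections survives the part of theta o d that has the bidegree of
    [std_del b]. *)
Lemma type_sum_theta b (f : 'M[C]_n) (a : 'I_(n + n) -> cext) :
  type_sum b (fun p q => theta f (\sum_s emul s (tproj p q (a s)))) =
  contr_of b f (\sum_s if holo s == ~~ b then emul s (a s) else 0).
Proof.
transitivity (type_sum b (fun p q => \sum_s \sum_(c : bool) \sum_(l < n) \sum_(k < n)
    contr_gen c l k (emul s (tproj p q (contr_coef c f l k *: a s))))).
  apply: type_sum_eq => p q; rewrite linear_sum; apply: eq_bigr => s _ /=.
  rewrite thetaE; apply: eq_bigr => c _; rewrite contr_ofE; apply: eq_bigr => l _.
  apply: eq_bigr => k _; exact: (esym (linZ (contr_gen c l k \o emul s \o tproj p q)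
    (contr_coef c f l k) (a s))).
rewrite type_sum_sum linear_sum; apply: eq_bigr => s _ /=.
rewrite type_sum_sum; transitivity (\sum_(c : bool)
    if (c == b) && (holo s == ~~ b) then contr_of c f (emul s (a s)) else 0).
  apply: eq_bigr => c _; rewrite type_sum_sum.
  transitivity (\sum_(l < n) \sum_(k < n)
     if (c == b) && (holo s == ~~ b) then contr_gen c l k (emul s (contr_coef c f l k *: a
       s)) else 0).
    apply: eq_bigr => l _; rewrite type_sum_sum; apply: eq_bigr => k _;
      exact: type_sum_contr_emul.
  case: ifP => _; last by apply: big1 => l _; exact: big1.
  rewrite contr_ofE; apply: eq_bigr => l _; apply: eq_bigr => k _.
  exact: (linZ (contr_gen c l k \o emul s) (contr_coef c f l k) (a s)).
rewrite sum_bool_at; case: ifP => // _; exact: (esym (linear0 (contr_of b f))).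
Qed.

Lemma type_sum_emul_sum b s (g : bool -> 'I_n -> 'I_n -> cext) :
  type_sum b (fun p q => emul s (\sum_(c : bool) \sum_(l < n) \sum_(k < n)
    contr_gen c l k (tproj p q (g c l k)))) =
  if holo s == ~~ b then emul s (\sum_(l < n) \sum_(k < n) contr_gen b l k (g b l k)) else 0.
Proof.
transitivity (type_sum b (fun p q => \sum_(c : bool) \sum_(l < n) \sum_(k < n)
    emul s (contr_gen c l k (tproj p q (g c l k))))).
  apply: type_sum_eq => p q; rewrite linear_sum; apply: eq_bigr => c _ /=.
  by rewrite linear_sum; apply: eq_bigr => l _ /=; rewrite linear_sum.
rewrite type_sum_sum; transitivity (\sum_(c : bool) if (c == b) && (holo s == ~~ b) then
    emul s (\sum_(l < n) \sum_(k < n) contr_gen c l k (g c l k)) else 0).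
  apply: eq_bigr => c _; rewrite type_sum_sum.
  transitivity (\sum_(l < n) \sum_(k < n)
     if (c == b) && (holo s == ~~ b) then emul s (contr_gen c l k (g c l k)) else 0).
    apply: eq_bigr => l _; rewrite type_sum_sum; apply: eq_bigr => k _;
      exact: type_sum_emul_contr.
  case: ifP => _; last by apply: big1 => l _; exact: big1.
  by rewrite linear_sum; apply: eq_bigr => l _ /=; rewrite linear_sum.
exact: sum_bool_at.
Qed.

(** Both projections of the Dolbeault operator contribute a commutator with theta. The
    terms in which theta stands outermost give the commutator of theta with
    [std_del b]. In the other ones theta and d stand between two projections whose
    types differ by the bidegree of [std_del b], and only the compositions of
    [std_del (~~ b)] with [contr_of b] have that bidegree. *)
Lemma fam_del_t b B x : esmooth N B -> N (x, 0) ->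
  eder (fam_del b B) (x, 0) tdir =
  std_del b (fun y => eder B y tdir) (x, 0) - std_del b (fun y => theta (F y) (B y)) (x, 0)
  + theta (F (x, 0)) (std_del b B (x, 0))
  + (std_del (~~ b) (fun y => contr_of b (F y) (B y)) (x, 0)
  - contr_of b (F (x, 0)) (std_del (~~ b) B (x, 0))).
Proof.
move=> Bs Nx.
have ds p q : esmooth N (slice_d (type_part p q B)) by apply: slice_d_smooth;
  exact: type_part_smooth.
have tds p q : esmooth N (type_part (p + b) (q +
  ~~ b) (slice_d (type_part p q B))) by exact: type_part_smooth.
pose D p q := \sum_s emul s (tproj p q (frame_der s B (x, 0))).
have dD p q : slice_d (type_part p q B) (x, 0) = D p q.
  by apply: eq_bigr => s _; rewrite frame_der_type_part.
pose E p q := eder (slice_d (type_part p q B)) (x, 0) tdir.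
have -> : eder (fam_del b B) (x, 0) tdir =
    type_sum b E + theta (F (x, 0)) (type_sum b D) - type_sum b (fun p q =>
      theta (F (x, 0)) (D p q)).
  transitivity (\sum_(p < n.+1) \sum_(q < n.+1)
     (tproj (p + b) (q + ~~ b) (E p q) + theta (F (x, 0)) (tproj (p + b) (q + ~~ b) (D p q))
     - tproj (p + b) (q + ~~ b) (theta (F (x, 0)) (D p q)))).
    rewrite /fam_del (eder_sum oN); last 2 first.
    - by move=> p _; apply: esmooth_sum => // q _; exact: tds.
    - exact: Nx.
    apply: eq_bigr => p _; rewrite (eder_sum oN); last 2 first.
    - by move=> q _; exact: tds.
    - exact: Nx.
    by apply: eq_bigr => q _; rewrite (type_part_t _ _ (ds p q) Nx) dD.
  rewrite /type_sum [theta _ _]linear_sum -big_split -sumrB; apply: eq_bigr => p _ /=.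
  by rewrite [theta _ _]linear_sum -big_split -sumrB.
have -> : type_sum b D = std_del b B (x, 0).
  by rewrite type_sum_sum; apply: eq_bigr => s _; exact: type_sum_emul.
rewrite type_sum_theta -/(std_del (~~ b) B (x, 0)).
have -> : type_sum b E = std_del b (fun y => eder B y tdir) (x, 0) +
    std_del (~~ b) (fun y => contr_of b (F y) (B y)) (x, 0) -
    std_del b (fun y => theta (F y) (B y)) (x, 0).
  transitivity (type_sum b (fun p q => \sum_s
   (emul s (tproj p q (frame_der s (fun y => eder B y tdir) (x, 0))) +
     emul s (\sum_(c : bool) \sum_(l < n) \sum_(k < n)
        contr_gen c l k (tproj p q (frame_der s (fun y => contr_coef c (F y) l k *: B y) (x, 0))))
     - emul s (tproj p q (frame_der s (fun y => theta (F y) (B y)) (x, 0)))))).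
    apply: type_sum_eq => p q; rewrite /E (slice_d_type_part_t _ _ Bs Nx); apply: eq_bigr => s _.
    by rewrite linearB linearD.
  rewrite type_sum_sum /std_del -big_split -sumrB; apply: eq_bigr => s _ /=.
  pose G1 p q := emul s (tproj p q (frame_der s (fun y => eder B y tdir) (x, 0))).
  pose G2 p q := emul s (\sum_(c : bool) \sum_(l < n) \sum_(k < n)
        contr_gen c l k (tproj p q (frame_der s (fun y =>
          contr_coef c (F y) l k *: B y) (x, 0)))).
  pose G3 p q := emul s (tproj p q (frame_der s (fun y => theta (F y) (B y)) (x, 0))).
  apply: (etrans (type_sumDB b G1 G2 G3)).
  apply: (f_equal2 +%R); last exact: (congr1 -%R (type_sum_emul _ _ _)).
  apply: (f_equal2 +%R); first exact: type_sum_emul.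
  apply: (etrans (type_sum_emul_sum b s (fun c l k => frame_der s (fun y =>
    contr_coef c (F y) l k *: B y) (x, 0)))).
  by rewrite -(frame_der_contr_of s b idfun Bs Nx).
rewrite [RHS]addrA; apply: (f_equal2 +%R); last by [].
by rewrite [RHS]addrAC; apply: (f_equal2 +%R); last by []; exact: addrAC.
Qed.

(** Differentiating del_t (delbar_t B) = 0 at t = 0. The terms with theta cancel in
    pairs, except for one that contains del (delbar B) at t = 0 and vanishes as do
    those with del^2 or delbar^2. Here B' plays the part of the powers of omega(t),
    and B that of the powers of omega_t. *)
Lemma variation_identity B B' x : esmooth N B -> esmooth N B' ->
  (forall y, N (y, 0) ->
    eder B (y, 0) tdir = eder B' (y, 0) tdir + theta (F (y, 0)) (B (y, 0))) ->
  (forall z, N z -> fam_del true (fam_del false B) z = 0) -> N (x, 0) ->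
  std_del true (fun y => contr_of false (F y) (std_del true B y)) (x, 0)
  - std_del false (fun y => contr_of true (F y) (std_del false B y)) (x, 0)
  = std_del true (std_del false (fun y => eder B' y tdir)) (x, 0).
Proof.
move=> Bs B's TB closed Nx.
have Gs := fam_del_smooth false Bs.
have TBs : esmooth N (fun y => eder B y tdir) by exact: esmooth_eder.
have TB's : esmooth N (fun y => eder B' y tdir) by exact: esmooth_eder.
have ThBs := theta_smooth Bs.
have G0s := std_del_smooth oN false Bs.
have nearN := near_hslice oN Nx.
have GG0 : \forall y \near x, fam_del false B (y, 0) = std_del false B (y, 0).
  by apply: filterS nearN => y; exact: fam_del_0.
have E0 : eder (fam_del true (fam_del false B)) (x, 0) tdir = 0.
  exact: (etrans (eder_eq oN tdir Nx closed) (eder_cst (0 : cext) (x, 0) tdir)).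
have E2 : std_del true (fun y => theta (F y) (fam_del false B y)) (x, 0) =
    std_del true (fun y => theta (F y) (std_del false B y)) (x, 0).
  by apply: std_del_slice; apply: filterS GG0 => y ->.
have E3 : theta (F (x, 0)) (std_del true (fam_del false B) (x, 0)) = 0.
  rewrite -(linear0 (theta (F (x, 0)))); apply: (congr1 (theta _)).
  exact: (etrans (esym (fam_del_0 true Gs Nx)) (closed _ Nx)).
have E4 : std_del false (fun y => contr_of true (F y) (fam_del false B y)) (x, 0) =
    std_del false (fun y => contr_of true (F y) (std_del false B y)) (x, 0).
  by apply: std_del_slice; apply: filterS GG0 => y ->.
have E5 : contr_of true (F (x, 0)) (std_del false (fam_del false B) (x, 0)) = 0.
  rewrite -(linear0 (contr_of true (F (x, 0)))); apply: (congr1 (contr_of true _)).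
  exact: (etrans (std_del_slice false GG0) (std_del_sqr oN false Bs Nx)).
pose H1 := std_del false (fun y => eder B' y tdir).
pose H2 y := theta (F y) (std_del false B y).
pose H3 := std_del true (fun y => contr_of false (F y) (B y)).
pose H4 y := contr_of false (F y) (std_del true B y).
have H1s : esmooth N H1 by exact: std_del_smooth.
have H2s : esmooth N H2 by exact: theta_smooth.
have H3s : esmooth N H3 by exact: (std_del_smooth oN true (contr_of_smooth false Bs)).
have H4s : esmooth N H4 by exact: (contr_of_smooth false (std_del_smooth oN true Bs)).
have NH4s : esmooth N (fun y => - H4 y) by exact: (esmooth_lin oN -%R).
(* The terms delbar (theta B) have cancelled in the derivative of delbar_t B. *)
have E1 : std_del true (fun y => eder (fam_del false B) y tdir) (x, 0) =
    std_del true H1 (x, 0) + std_del true H2 (x, 0) - std_del true H4 (x, 0).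
  transitivity (std_del true (fun y => H1 y + H2 y + (H3 y + - H4 y)) (x, 0)).
    apply: std_del_slice; apply: filterS nearN => y Ny.
    have D1 : std_del false (fun w => eder B w tdir) (y, 0) =
        H1 (y, 0) + std_del false (fun w => theta (F w) (B w)) (y, 0).
      transitivity (std_del false (fun w => eder B' w tdir + theta (F w) (B w)) (y, 0)).
        by apply: std_del_slice; apply: filterS (near_hslice oN Ny) => w; exact: TB.
      exact: (std_delD _ TB's ThBs Ny).
    have D2 := etrans (f_equal2 +%R D1 (erefl (- std_del false (fun w =>
      theta (F w) (B w)) (y, 0)))) (addrK _ _).
    exact: (etrans (fam_del_t false Bs Ny)
      (f_equal2 +%R (f_equal2 +%R D2 (erefl (H2 (y, 0)))) (erefl (H3 (y, 0) + - H4 (y, 0))))).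
  apply: (etrans (std_delD _ (esmoothD oN H1s H2s) (esmoothD oN H3s NH4s) Nx)).
  apply: (f_equal2 +%R (std_delD _ H1s H2s Nx)); apply: (etrans (std_delD _ H3s NH4s Nx)).
  apply: (etrans (f_equal2 +%R (std_del_sqr oN true (contr_of_smooth false Bs) Nx) (std_delN
    oN _ H4s Nx))).
  exact: add0r.
have := etrans (esym E0) (etrans (fam_del_t true Gs Nx)
  (f_equal2 +%R (f_equal2 +%R (f_equal2 +%R E1 (congr1 -%R E2)) E3)
     (f_equal2 +%R E4 (congr1 -%R E5)))).
rewrite -/H1 -/H2 -/H4.
move: (std_del true H1 _) (std_del true H2 _) (std_del true H4 _) (std_del false _ _) => a c d e.
rewrite oppr0 !addr0 (addrAC (a + c)) addrK => /esym/eqP.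
by rewrite addrAC subr_eq0 => /eqP <-; rewrite addrK.
Qed.
End TypeProj.
End Core.

(** * The operators on forms in a chart, and conjugation *)

Section Forms.
Variables (R : realType) (n : nat).
Local Notation C := R[i].
Local Notation V := 'rV[R]_(n + n).
Local Notation W := (V * R)%type.
Local Notation cext := (ext C (n + n)).
Local Notation ebase := (@ebase C (n + n)).
Local Notation emul := (@emul C (n + n)).
Local Notation tdir := (tdir R n).
Implicit Types (B : W -> cext) (x : V) (z : W) (t : R) (s r : 'I_(n + n)).

Lemma slice_dE B x t : slice_d B (x, t) =
  \sum_S wedge (dfun (fun y => B (y, t) S) x) (ebase S).
Proof.
transitivity (\sum_S \sum_s frame_der s B (x, t) S *: emul s (ebase S)).
  rewrite /slice_d exchange_big; apply: eq_bigr => s _ /=.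
  rewrite {1}(extE (frame_der s B (x, t))) linear_sum; apply: eq_bigr => S _.
  by rewrite linearZ.
apply: eq_bigr => S _; rewrite /dfun wedge_suml big_split_ord/= -big_split.
apply: eq_bigr => i _ /=.
have el : frame_der (lshift n i) B (x, t) S = wirt i (fun y => B (y, t) S) x.
  by rewrite frame_derE split_lshift.
have er : frame_der (rshift n i) B (x, t) S = wirt_bar i (fun y => B (y, t) S) x.
  by rewrite frame_derE split_rshift.
apply: (etrans (f_equal2 +%R (congr1 (fun k => k *: emul _ (ebase S)) el)
  (congr1 (fun k => k *: emul _ (ebase S)) er))).
exact: (esym (etrans (wedgeDl _ _ _) (f_equal2 +%R (wedgeZl _ _ _) (wedgeZl _ _ _)))).
Qed.

Lemma d_formE (M : complexManifold R n) (alpha : cform M) a B x t :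
  (forall y, alpha a y = B (y, t)) -> d_form alpha a x = slice_d B (x, t).
Proof.
move=> aB; rewrite /d_form (_ : alpha a = fun y => B (y, t)); last exact/funext.
exact: (esym (slice_dE B x t)).
Qed.

Lemma delE (M : complexManifold R n) (J : tensor M) (alpha : cform M) a
    (J' : W -> 'M[R]_(n + n)) B x t :
  (forall y, J a y = J' (y, t)) -> (forall y, alpha a y = B (y, t)) ->
  del J alpha a x = fam_del J' true B (x, t).
Proof.
move=> aJ aB; apply: eq_bigr => p _; apply: eq_bigr => q _.
rewrite addn1 addn0; rewrite /proj_form aJ; apply: (congr1 (type_proj _ _ _)).
by apply: d_formE => y; rewrite aJ aB.
Qed.

Lemma delbarE (M : complexManifold R n) (J : tensor M) (alpha : cform M) a
    (J' : W -> 'M[R]_(n + n)) B x t :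
  (forall y, J a y = J' (y, t)) -> (forall y, alpha a y = B (y, t)) ->
  delbar J alpha a x = fam_del J' false B (x, t).
Proof.
move=> aJ aB; apply: eq_bigr => p _; apply: eq_bigr => q _.
rewrite addn1 addn0; rewrite /proj_form aJ; apply: (congr1 (type_proj _ _ _)).
by apply: d_formE => y; rewrite aJ aB.
Qed.

Lemma eder_tproj p q B z v : eder (fun y => tproj p q (B y)) z v = tproj p q (eder B z v).
Proof.
apply/ffunP => S; rewrite [LHS]ffunE [RHS]ffunE [eder B z v S]ffunE.
case: ifP => h; last rewrite -[RHS](cderive_cst (0 : C) z v);
  by congr (cderive _ z v); apply/funext => y; rewrite ffunE h.
Qed.

(** For the constant standard structure the projections commute with derivatives
    because they act on coefficients, so no smoothness of B is needed. *)
Lemma fam_del_std (J' : W -> 'M[R]_(n + n)) b B z :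
  (forall z s, cov10 (J' z) s = (holo s)%:R *: ebase [set s]%SET) ->
  (forall z s, cov01 (J' z) s = (~~ holo s)%:R *: ebase [set s]%SET) ->
  fam_del J' b B z = std_del b B z.
Proof.
move=> c10 c01.
have type_partE p q A y : type_part J' p q A y = tproj p q (A y).
  by exact: (type_proj_std p q (A y) (c10 y) (c01 y)).
transitivity (type_sum b (fun p q => \sum_s emul s (tproj p q (frame_der s B z)))).
  apply: eq_bigr => p _; apply: eq_bigr => q _; rewrite type_partE; apply: (congr1 (tproj _ _)).
  apply: eq_bigr => s _; apply: (congr1 (emul s)).
  rewrite (_ : type_part J' p q B = fun y => tproj p q (B y)); last by apply/funext => y;
    exact: type_partE.
  rewrite /frame_der !eder_tproj; apply/esym.
  apply: (etrans (linearZ _ _)); apply: (congr1 ( *:%R _)).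
  apply: (etrans (linearD _ _ _)); apply: (congr1 (+%R _)); exact: linearZ.
by rewrite type_sum_sum; apply: eq_bigr => s _; exact: type_sum_emul.
Qed.

Lemma esmooth_conj (N : set W) (oN : open N) B : esmooth N B ->
  esmooth N (fun y => conj_ext (B y)).
Proof.
move=> Bs; apply: esmooth_sum => // S _; apply: esmoothZ => //; last exact: esmooth_cst.
exact: csmooth_conj.
Qed.

Lemma eder_conj (N : set W) (oN : open N) B z v : esmooth N B -> N z ->
  eder (fun y => conj_ext (B y)) z v = conj_ext (eder B z v).
Proof.
move=> Bs Nz; rewrite [in RHS]/conj_ext.
have cs S := csmooth_conj oN (Bs S).
apply: (etrans (eder_sum oN _ v (fun S _ => esmoothZ oN (cs S) (esmooth_cst N _)) Nz)).
apply: eq_bigr => S _; rewrite (ederZ v (cs S) (esmooth_cst N _) Nz) eder_cst scaler0 addr0.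
by rewrite (cderive_conj v (Bs S) Nz) [eder B z v S]ffunE.
Qed.

Lemma base_index_swap s : base_index (swap s) = base_index s.
Proof.
by move: s; apply: shiftP => i; rewrite ?swap_lshift ?swap_rshift /base_index ?split_lshift
  ?split_rshift.
Qed.

Lemma frame_coef_swap s : frame_coef R (swap s) = (frame_coef R s)^*.
Proof.
move: s; apply: shiftP => i; rewrite ?swap_lshift ?swap_rshift /frame_coef /holo /=.
  by rewrite ltn_ord ltnNge leq_addr; apply/eqP; rewrite eq_complex/= ?oppr0 ?opprK !eqxx.
by rewrite ltn_ord ltnNge leq_addr; apply/eqP; rewrite eq_complex/= ?oppr0 ?opprK !eqxx.
Qed.

Lemma frame_der_conj (N : set W) (oN : open N) s B z : esmooth N B -> N z ->
  frame_der (swap s) (fun y => conj_ext (B y)) z = conj_ext (frame_der s B z).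
Proof.
move=> Bs Nz; rewrite /frame_der !(eder_conj oN _ Bs Nz) conj_extZ conj_extD conj_extZ.
rewrite fmorphV rmorph_nat frame_coef_swap.
have -> : dirx R (swap s) = dirx R s by rewrite /dirx base_index_swap.
by have -> : diry R (swap s) = diry R s by rewrite /diry base_index_swap.
Qed.

(** Conjugation exchanges d/dz with d/dzbar and dz with its conjugate. *)
Lemma std_del_conj (N : set W) (oN : open N) b B z : esmooth N B -> N z ->
  std_del b (fun y => conj_ext (B y)) z = conj_ext (std_del (~~ b) B z).
Proof.
move=> Bs Nz; rewrite /std_del conj_ext_sum (reindex_inj (inv_inj (@swapK n))).
apply: eq_bigr => s _ /=.
have -> : (holo (swap s) == b) = (holo s == ~~ b).
  by move: s; apply: shiftP => i; rewrite ?swap_lshift ?swap_rshift /holo /= ltn_ord ltnNge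
    leq_addr; case: b.
case: (holo s == ~~ b); last by rewrite conj_ext0.
by rewrite (frame_der_conj oN s Bs Nz) conj_emul.
Qed.
End Forms.

(** * Smooth families of complex matrices *)

(** The conditions of invertibility below are conditions on determinants; they hold
    at t = 0 and thus on an open set that contains the slice t = 0. *)
Lemma csmooth_neq0_open (R : realType) (W : normedModType R) (U : set W) (f : W -> R[i]) :
  open U -> csmooth_on U f -> open [set z | U z /\ f z != 0].
Proof.
move=> oU [fr fi]; rewrite openE => z [/= Uz fz].
have [cr _] := fr 0%N; have [ci _] := fi 0%N.
pose g y := complex.Re (f y) * complex.Re (f y) + complex.Im (f y) * complex.Im (f y).
have gc : g @ z --> g z.
  by apply: cvgD; apply: cvgM; [exact: cr|exact: cr|exact: ci|exact: ci].
have gz : g z != 0.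
  apply: contraNneq fz; rewrite /g -!expr2 => /eqP.
  by rewrite paddr_eq0 ?sqr_ge0// !sqrf_eq0 eq_complex.
have nU : nbhs z U by apply: open_nbhs_nbhs.
have ng : nbhs z [set y | g y != 0] by exact: (cvgr_neq0 (g z) gc gz).
change (nbhs z [set z | U z /\ f z != 0]).
have H := @filterI _ _ (nbhs_filter z) _ _ nU ng.
apply: (@filterS _ _ (nbhs_filter z) _ _ _ H) => y [Uy gy]; split => //.
by apply: contraNneq gy => fy; rewrite /g fy /= mul0r addr0.
Qed.

Section MatrixCalculus.
Variables (R : realType) (W : normedModType R) (N : set W) (oN : open N).
Local Notation C := R[i].

Definition msmooth (p q : nat) (A : W -> 'M[C]_(p, q)) :=
  forall i j, csmooth_on N (fun z => A z i j).
Definition mder (p q : nat) (A : W -> 'M[C]_(p, q)) z v : 'M[C]_(p, q) :=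
  \matrix_(i, j) cderive (fun y => A y i j) z v.

Lemma msmooth_mul p q r (A : W -> 'M[C]_(p, q)) (B : W -> 'M[C]_(q, r)) :
  msmooth A -> msmooth B -> msmooth (fun z => A z *m B z).
Proof.
move=> As Bs i j; apply: (@csmooth_eq _ _ _ (fun z => \sum_k A z i k * B z k j)) => //.
  by move=> z _; rewrite mxE.
by apply: csmooth_sum => // k _; apply: csmoothM.
Qed.

Lemma mder_mul p q r (A : W -> 'M[C]_(p, q)) (B : W -> 'M[C]_(q, r)) z v :
  msmooth A -> msmooth B -> N z ->
  mder (fun z => A z *m B z) z v = mder A z v *m B z + A z *m mder B z v.
Proof.
move=> As Bs Nz; apply/matrixP => i j; rewrite !mxE -big_split/=.
transitivity (cderive (fun y => \sum_k A y i k * B y k j) z v).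
  by congr (cderive _ z v); apply/funext => y; rewrite mxE.
rewrite (cderive_sum oN _ _ (fun k _ => csmoothM oN (As i k) (Bs k j)) Nz).
by apply: eq_bigr => k _; rewrite (cderiveM v (As i k) (Bs k j) Nz) !mxE.
Qed.

Lemma msmooth_cst p q (A : 'M[C]_(p, q)) : msmooth (fun=> A).
Proof. by move=> i j; exact: csmooth_cst. Qed.

Lemma mder_cst p q (A : 'M[C]_(p, q)) z v : mder (fun=> A) z v = 0.
Proof. by apply/matrixP => i j; rewrite !mxE cderive_cst. Qed.

Lemma mder_eq p q (A B : W -> 'M[C]_(p, q)) z v : N z -> (forall y, N y -> A y = B y) ->
  mder A z v = mder B z v.
Proof.
move=> Nz AB; apply/matrixP => i j; rewrite !mxE; apply: (cderive_eq _ oN Nz) => y Ny.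
by rewrite AB.
Qed.

Lemma msmooth_block p q p' q' (A : W -> 'M[C]_(p, q)) (B : W -> 'M[C]_(p, q'))
    (A' : W -> 'M[C]_(p', q)) (B' : W -> 'M[C]_(p', q')) :
  msmooth A -> msmooth B -> msmooth A' -> msmooth B' ->
  msmooth (fun z => block_mx (A z) (B z) (A' z) (B' z)).
Proof.
move=> As Bs A's B's i j; case: (split_ordP i) => i' ->; case: (split_ordP j) => j' ->.
- by apply: csmooth_eq (As i' j') => // z _; rewrite block_mxEul.
- by apply: csmooth_eq (Bs i' j') => // z _; rewrite block_mxEur.
- by apply: csmooth_eq (A's i' j') => // z _; rewrite block_mxEdl.
- by apply: csmooth_eq (B's i' j') => // z _; rewrite block_mxEdr.
Qed.

Lemma mder_block p q p' q' (A : W -> 'M[C]_(p, q)) (B : W -> 'M[C]_(p, q'))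
    (A' : W -> 'M[C]_(p', q)) (B' : W -> 'M[C]_(p', q')) z v :
  mder (fun z => block_mx (A z) (B z) (A' z) (B' z)) z v =
  block_mx (mder A z v) (mder B z v) (mder A' z v) (mder B' z v).
Proof.
apply/matrixP => i j; rewrite mxE.
case: (split_ordP i) => i' ->; case: (split_ordP j) => j' ->.
- by rewrite block_mxEul mxE; congr (cderive _ z v); apply/funext => y; rewrite block_mxEul.
- by rewrite block_mxEur mxE; congr (cderive _ z v); apply/funext => y; rewrite block_mxEur.
- by rewrite block_mxEdl mxE; congr (cderive _ z v); apply/funext => y; rewrite block_mxEdl.
- by rewrite block_mxEdr mxE; congr (cderive _ z v); apply/funext => y; rewrite block_mxEdr.
Qed.

Lemma msmooth_conj p q (A : W -> 'M[C]_(p, q)) : msmooth A ->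
  msmooth (fun z => map_mx (@conjc R) (A z)).
Proof.
move=> As i j; apply: csmooth_eq (csmooth_conj oN (As i j)) => // z _.
by rewrite mxE.
Qed.

Lemma mder_conj p q (A : W -> 'M[C]_(p, q)) z v : msmooth A -> N z ->
  mder (fun z => map_mx (@conjc R) (A z)) z v = map_mx (@conjc R) (mder A z v).
Proof.
move=> As Nz; apply/matrixP => i j; rewrite !mxE -(cderive_conj v (As i j) Nz).
by congr (cderive _ z v); apply/funext => y; rewrite mxE.
Qed.

Lemma esmooth_covector m (c : W -> 'rV[C]_m) : msmooth c -> esmooth N (fun z => covector (c z)).
Proof.
by move=> cs; apply: esmooth_sum => // s _; apply: esmoothZ => //; exact: esmooth_cst.
Qed.

Lemma eder_covector m (c : W -> 'rV[C]_m) z v : msmooth c -> N z ->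
  eder (fun z => covector (c z)) z v = covector (mder c z v).
Proof.
move=> cs Nz.
apply: (etrans (eder_sum oN _ v (fun s _ => esmoothZ oN (cs 0 s) (esmooth_cst N _)) Nz)).
apply: eq_bigr => s _; rewrite (ederZ v (cs 0 s) (esmooth_cst N _) Nz) eder_cst scaler0 addr0.
by rewrite mxE.
Qed.
End MatrixCalculus.

(** * The type decomposition determined by a Beltrami differential *)

Section Beltrami.
Variables (R : realType) (n : nat).
Local Notation C := R[i].
Local Notation V := 'rV[R]_(n + n).
Local Notation W := (V * R)%type.
Local Notation cext := (ext C (n + n)).
Local Notation ebase := (@ebase C (n + n)).
Local Notation tdir := (tdir R n).
Implicit Types (x : V) (z : W) (s r : 'I_(n + n)).

(** Its rows are the coordinates of dz^l + phi(dz^l) and of their conjugates, a basis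
    of covectors of pure type for J_t. The hypothesis [phi_J] below expresses this:
    J_t acts on them by i and -i, which is the matrix [type_mx]. *)
Definition beltrami_mx (f : 'M[C]_n) : 'M[C]_(n + n) :=
  block_mx 1%:M f (map_mx (@conjc R) f) 1%:M.
Definition type_mx : 'M[C]_(n + n) := block_mx 'i%:M 0 0 (- 'i)%:M.

Variables (N0 : set W) (oN0 : open N0) (J : W -> 'M[R]_(n + n)) (phi : W -> 'M[C]_n).
Hypothesis phi_smooth : msmooth N0 phi.
Hypothesis phi_J : forall z, N0 z ->
  beltrami_mx (phi z) *m (complexify_mx (J z))^T = type_mx *m beltrami_mx (phi z).
Hypothesis phi_0 : forall x, N0 (x, 0) -> phi (x, 0) = 0.

Let P z := beltrami_mx (phi z).
Definition beltrami_dom : set W := [set z | N0 z /\ \det (beltrami_mx (phi z)) != 0].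
Let N := beltrami_dom.
Let K z := (complexify_mx (J z))^T.
Let F z := mder phi z tdir.

Lemma beltrami_mx0 : beltrami_mx 0 = 1%:M.
Proof. by rewrite /beltrami_mx map_mx0 -scalar_mx_block. Qed.

Let Ps : msmooth N0 P.
Proof.
apply: (msmooth_block oN0 (msmooth_cst _ _) phi_smooth _ (msmooth_cst _ _)).
exact: (msmooth_conj oN0).
Qed.

Lemma beltrami_dom_open : open N.
Proof. by apply: csmooth_neq0_open => //; exact: csmooth_det. Qed.

Lemma beltrami_dom0 x : N0 (x, 0) -> N (x, 0).
Proof. by move=> Nx; split => //; rewrite (phi_0 Nx) beltrami_mx0 det1 oner_neq0. Qed.

Let NN0 : N `<=` N0. Proof. by move=> z []. Qed.

Let PNs : msmooth N P.
Proof. by move=> i j; exact: csmooth_sub NN0 (Ps i j). Qed.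

Let Ks : msmooth N K.
Proof.
have oN := beltrami_dom_open.
have Pu z : N z -> P z \in unitmx by move=> [_ d]; rewrite unitmxE unitfE.
have Ks' : msmooth N (fun z => invmx (P z) *m (type_mx *m P z)).
  apply: (msmooth_mul oN); first by move=> i j; apply: csmooth_invmx.
  by apply: (msmooth_mul oN); [exact: msmooth_cst|exact: PNs].
move=> i j; apply: csmooth_eq oN _ (Ks' i j) => z Nz.
by rewrite -(phi_J (NN0 Nz)) mulKmx//; exact: Pu.
Qed.

Let K0 x : N (x, 0) -> K (x, 0) = type_mx.
Proof.
move=> /NN0 Nx; have := phi_J Nx.
by rewrite (phi_0 Nx) beltrami_mx0 mul1mx mulmx1.
Qed.

Let dK x : N (x, 0) -> mder K (x, 0) tdir =
  block_mx 0 ((2 * 'i) *: F (x, 0)) (- (2 * 'i) *: map_mx (@conjc R) (F (x, 0))) 0.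
Proof.
move=> Nx; have oN := beltrami_dom_open; have N0x := NN0 Nx.
have dP : mder P (x, 0) tdir = block_mx 0 (F (x, 0)) (map_mx (@conjc R) (F (x, 0))) 0.
  apply: (etrans (mder_block _ _ _ _ _ _)).
  by rewrite !mder_cst (mder_conj _ phi_smooth N0x).
have P0 : P (x, 0) = 1%:M by rewrite /P (phi_0 N0x) beltrami_mx0.
have := etrans (esym (mder_mul oN tdir PNs Ks Nx))
  (etrans (mder_eq oN tdir Nx (fun z Nz => phi_J (NN0 Nz)))
          (mder_mul oN tdir (msmooth_cst _ _) PNs Nx)).
rewrite mder_cst mul0mx add0r P0 (K0 Nx) mul1mx dP.
rewrite /type_mx !mulmx_block !mul0mx !mulmx0 !add0r !addr0 !mul_scalar_mx !mul_mx_scalar.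
move/(canRL (addKr _)) ->; rewrite opp_block_mx add_block_mx !oppr0 !addr0.
by congr block_mx; rewrite -scaleNr -scalerDl; congr (_ *: _); ring.
Qed.

(** The time derivative of (e_s - i e_s o J_t)/2, the (1, 0)-part of e_s. *)
Definition type_drow z s : 'rV[C]_(n + n) :=
  \row_r (- (2^-1 * 'i) * cderive (fun y => (complexify_mx (J y))^T s r) z tdir).

Let c10 z s : 'rV[C]_(n + n) := \row_r (2^-1 * (r == s)%:R + - (2^-1 * 'i) * K z s r).
Let c01 z s : 'rV[C]_(n + n) := \row_r (2^-1 * (r == s)%:R + (2^-1 * 'i) * K z s r).

Let cov10E z s : cov10 (J z) s = covector (c10 z s).
Proof.
rewrite /cov10; congr covector; apply/rowP => r.
by rewrite -rowE !mxE eqxx /=; ring.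
Qed.
Let cov01E z s : cov01 (J z) s = covector (c01 z s).
Proof.
rewrite /cov01; congr covector; apply/rowP => r.
by rewrite -rowE !mxE eqxx /=; ring.
Qed.

Let affine_smooth k k' i j : csmooth_on N (fun z => k + k' * K z i j).
Proof.
have oN := beltrami_dom_open; apply: csmoothD => //; first exact: csmooth_cst.
by apply: csmoothM => //; exact: csmooth_cst.
Qed.

Let affine_der k k' i j z : N z ->
  cderive (fun y => k + k' * K y i j) z tdir = k' * cderive (fun y => K y i j) z tdir.
Proof.
move=> Nz; have oN := beltrami_dom_open.
have ks (c : C) := csmooth_cst N c.
rewrite (cderiveD tdir (ks k) (csmoothM oN (ks k') (Ks i j)) Nz) cderive_cst add0r.
by rewrite (cderiveM tdir (ks k') (Ks i j) Nz) cderive_cst mul0r add0r.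
Qed.

Let c10s s : msmooth N (fun z => c10 z s).
Proof.
move=> i r; apply: csmooth_eq beltrami_dom_open _ (affine_smooth _ _ s r) => z _.
by rewrite [RHS]mxE.
Qed.
Let c01s s : msmooth N (fun z => c01 z s).
Proof.
move=> i r; apply: csmooth_eq beltrami_dom_open _ (affine_smooth _ _ s r) => z _.
by rewrite [RHS]mxE.
Qed.

Lemma beltrami_cov10_smooth s : esmooth N (fun z => cov10 (J z) s).
Proof.
have oN := beltrami_dom_open.
by apply: (esmooth_eq oN _ (esmooth_covector oN (c10s s))) => z _; rewrite cov10E.
Qed.
Lemma beltrami_cov01_smooth s : esmooth N (fun z => cov01 (J z) s).
Proof.
have oN := beltrami_dom_open.
by apply: (esmooth_eq oN _ (esmooth_covector oN (c01s s))) => z _; rewrite cov01E.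
Qed.

Lemma covector_delta k s : covector (\row_r (k * (r == s)%:R)) = k *: ebase [set s]%SET.
Proof.
rewrite /covector (bigD1 s)//= mxE eqxx mulr1 big1 ?addr0// => r rs.
by rewrite mxE (negbTE rs) mulr0 scale0r.
Qed.

Lemma holo_lshift (i : 'I_n) : holo (lshift n i) = true.
Proof. exact: (ltn_ord i). Qed.
Lemma holo_rshift (i : 'I_n) : holo (rshift n i) = false.
Proof. by apply/negbTE; rewrite -leqNgt leq_addr. Qed.

Lemma type_mxE s r : type_mx s r = (if holo s then 'i else - 'i) * (r == s)%:R.
Proof.
rewrite /type_mx; case: (split_ordP s) => s' ->; case: (split_ordP r) => r' ->.
- by rewrite block_mxEul mxE holo_lshift eq_lshift eq_sym mulr_natr.
- by rewrite block_mxEur mxE eq_rlshift mulr0.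
- by rewrite block_mxEdl mxE eq_lrshift mulr0.
- by rewrite block_mxEdr mxE holo_rshift eq_rshift eq_sym mulr_natr.
Qed.

Lemma half_ii : 2^-1 * 'i * 'i = - 2^-1 :> C.
Proof. by rewrite -mulrA -expr2 sqr_i mulrN1. Qed.

Lemma half_half : 2^-1 + 2^-1 = 1 :> C.
Proof. by rewrite [RHS]splitr !mul1r. Qed.

Lemma beltrami_cov10_0 x s : N (x, 0) ->
  cov10 (J (x, 0)) s = (holo s)%:R *: ebase [set s]%SET.
Proof.
move=> Nx; rewrite cov10E -covector_delta; congr covector; apply/rowP => r.
rewrite [LHS]mxE [RHS]mxE (K0 Nx) type_mxE; case: (holo s); rewrite mulrA mulNr ?mulrN half_ii.
  by rewrite opprK -mulrDl half_half.
by rewrite opprK mulNr subrr mul0r.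
Qed.
Lemma beltrami_cov01_0 x s : N (x, 0) ->
  cov01 (J (x, 0)) s = (~~ holo s)%:R *: ebase [set s]%SET.
Proof.
move=> Nx; rewrite cov01E -covector_delta; congr covector; apply/rowP => r.
rewrite [LHS]mxE [RHS]mxE (K0 Nx) type_mxE; case: (holo s); rewrite mulrA ?mulrN half_ii.
  by rewrite mulNr subrr mul0r.
by rewrite opprK -mulrDl half_half.
Qed.

Lemma beltrami_cov10_t x s : N (x, 0) ->
  eder (fun z => cov10 (J z) s) (x, 0) tdir = covector (type_drow (x, 0) s).
Proof.
move=> Nx; have oN := beltrami_dom_open.
apply: (etrans (eder_eq oN tdir Nx (fun z _ => cov10E z s))).
apply: (etrans (eder_covector oN tdir (c10s s) Nx)); congr covector; apply/rowP => r.
have E : (fun y => c10 y s 0 r) = fun y => 2^-1 * (r == s)%:R + - (2^-1 * 'i) * K y s r.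
  by apply/funext => y; rewrite [LHS]mxE.
by rewrite [LHS]mxE [RHS]mxE E (affine_der _ _ _ _ Nx).
Qed.
Lemma beltrami_cov01_t x s : N (x, 0) ->
  eder (fun z => cov01 (J z) s) (x, 0) tdir = covector (- type_drow (x, 0) s).
Proof.
move=> Nx; have oN := beltrami_dom_open.
apply: (etrans (eder_eq oN tdir Nx (fun z _ => cov01E z s))).
apply: (etrans (eder_covector oN tdir (c01s s) Nx)); congr covector; apply/rowP => r.
have E : (fun y => c01 y s 0 r) = fun y => 2^-1 * (r == s)%:R + (2^-1 * 'i) * K y s r.
  by apply/funext => y; rewrite [LHS]mxE.
by rewrite [LHS]mxE [RHS]mxE [X in - X]mxE E (affine_der _ _ _ _ Nx) mulNr opprK.
Qed.

Let drowE x s r : N (x, 0) -> type_drow (x, 0) s 0 r = - (2^-1 * 'i) * mder K (x, 0) tdir s r.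
Proof. by rewrite !mxE. Qed.

Lemma half_coef (u : C) : - (2^-1 * 'i) * (2 * 'i * u) = u.
Proof.
rewrite mulrA (_ : - _ * (2 * 'i) = 1) ?mul1r//.
by rewrite mulNr mulrACA mulVf ?pnatr_eq0// mul1r -expr2 sqr_i opprK.
Qed.

(** Differentiating P K = T P at t = 0, where P = 1 and K = T = diag(i, -i), gives
    K' = [T, P'], whose blocks are 2i phi' and - 2i phi'bar. *)
Lemma beltrami_drowl x l : N (x, 0) -> covector (type_drow (x, 0) (lshift n l)) =
  \sum_(k < n) F (x, 0) l k *: ebase [set rshift n k]%SET.
Proof.
move=> Nx; rewrite /covector big_split_ord/= [X in X + _]big1 ?add0r.
  apply: eq_bigr => k _; congr (_ *: _).
  by rewrite (drowE _ _ Nx) (dK Nx) block_mxEur mxE half_coef.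
by move=> k _; rewrite (drowE _ _ Nx) (dK Nx) block_mxEul mxE mulr0 scale0r.
Qed.
Lemma beltrami_drowr x l : N (x, 0) -> covector (type_drow (x, 0) (rshift n l)) =
  - \sum_(k < n) (F (x, 0) l k)^* *: ebase [set lshift n k]%SET.
Proof.
move=> Nx; rewrite /covector big_split_ord/= [X in _ + X]big1 ?addr0.
  rewrite -sumrN; apply: eq_bigr => k _; rewrite -scaleNr; congr (_ *: _).
  by rewrite (drowE _ _ Nx) (dK Nx) block_mxEdl !mxE [- (2 * _) * _]mulNr mulrN half_coef.
by move=> k _; rewrite (drowE _ _ Nx) (dK Nx) block_mxEdr mxE mulr0 scale0r.
Qed.

Lemma beltrami_der_smooth l k : csmooth_on N (fun z => F z l k).
Proof.
apply: csmooth_sub NN0 _.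
apply: csmooth_eq oN0 _ (csmooth_cderive tdir (phi_smooth l k)) => z _.
by rewrite mxE.
Qed.
End Beltrami.

(** * The extension map to first order *)

Section Extension.
Variables (R : realType) (n : nat).
Local Notation C := R[i].
Local Notation V := 'rV[R]_(n + n).
Local Notation W := (V * R)%type.
Local Notation cext := (ext C (n + n)).
Local Notation ebase := (@ebase C (n + n)).
Local Notation emul := (@emul C (n + n)).
Local Notation tdir := (tdir R n).
Implicit Types (x : V) (z : W) (s r : 'I_(n + n)).

Lemma contr_of0 c (a : cext) : contr_of c 0 a = 0.
Proof.
rewrite contr_ofE big1// => l _; rewrite big1// => k _.
by rewrite /contr_coef; case: c; rewrite mxE ?rmorph0 scale0r.
Qed.

Lemma contr_bar_holo f S : contr_bar f (ebase (holo_part S)) = 0.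
Proof.
rewrite contr_barE big1// => l _; rewrite big1// => k _.
rewrite /shift_op interior_base ifF ?linear0 ?scaler0//.
by rewrite inE -/(holo (rshift n l)) holo_rshift andbF.
Qed.

Lemma contr_antiholo f S : contr f (ebase (antiholo_part S)) = 0.
Proof.
rewrite contrE big1// => l _; rewrite big1// => k _.
rewrite /shift_op interior_base ifF ?linear0 ?scaler0//.
by rewrite inE leqNgt -/(holo (lshift n l)) holo_lshift andbF.
Qed.

Lemma wedge_parts S : wedge (ebase (holo_part S)) (ebase (antiholo_part S)) = ebase S.
Proof.
rewrite wedge_base ifT; last first.
  rewrite -finset.setI_eq0; apply/eqP/finset.setP => s; rewrite !inE.
  by case: (s \in S) => //=; case: ltnP.
rewrite inversionsE big1 ?expr0 ?scale1r.
  congr Defs.ebase; apply/finset.setP => s; rewrite !inE.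
  by case: (s \in S) => //=; case: ltnP.
move=> i; rewrite inE => /andP[_ ni]; apply: big1 => j; rewrite inE => /andP[_ nj].
by rewrite ltnNge (ltnW (leq_trans ni nj)).
Qed.

Lemma exp_op0 c (a : cext) : exp_op (contr_of c 0) a = a.
Proof.
rewrite /exp_op big_ord_recl /= invr1 scale1r big1 ?addr0// => j _.
by rewrite contr_of0 scaler0.
Qed.

Lemma extension0 (a : cext) : extension 0 a = a.
Proof.
rewrite [RHS]extE; apply: eq_bigr => S _; apply: (congr1 ( *:%R _)).
rewrite -[RHS]wedge_parts.
exact: (f_equal2 (@wedge _ _) (exp_op0 false _) (exp_op0 true _)).
Qed.

Variables (N0 : set W) (oN0 : open N0) (phi : W -> 'M[C]_n).
Hypothesis phi_smooth : msmooth N0 phi.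

Lemma eder_contr_of c B z v : esmooth N0 B -> N0 z ->
  eder (fun y => contr_of c (phi y) (B y)) z v =
  contr_of c (mder phi z v) (B z) + contr_of c (phi z) (eder B z v).
Proof.
move=> Bs Nz.
have ks l k : csmooth_on N0 (fun y => contr_coef c (phi y) l k) by exact: contr_coef_smooth.
have Ls l k : esmooth N0 (fun y => contr_gen c l k (B y)) by exact: (esmooth_lin oN0
  (contr_gen c l k)).
have ts l k := esmoothZ oN0 (ks l k) (Ls l k).
have kd l k : cderive (fun y => contr_coef c (phi y) l k) z v = contr_coef c (mder phi z v) l k.
  rewrite /contr_coef; case: c ks Ls ts => _ _ _; rewrite mxE //.
  exact: (cderive_conj v (phi_smooth l k) Nz).
have E0 : eder (fun y => contr_of c (phi y) (B y)) z v =
    eder (fun y => \sum_(l < n) \sum_(k < n) contr_coef c (phi y) l k *: contr_gen c l k (B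
      y)) z v.
  exact: (eder_eq oN0 v Nz (fun y _ => contr_ofE c (phi y) (B y))).
apply: (etrans E0).
have rs l : esmooth N0 (fun y => \sum_(k < n) contr_coef c (phi y) l k *: contr_gen c l k (B y)).
  by apply: (esmooth_sum oN0) => k _; exact: ts.
apply: (etrans (eder_sum oN0 _ v (fun l _ => rs l) Nz)).
rewrite !contr_ofE -big_split; apply: eq_bigr => l _ /=.
apply: (etrans (eder_sum oN0 _ v (fun k _ => ts l k) Nz)).
rewrite -big_split; apply: eq_bigr => k _ /=.
by rewrite (ederZ v (ks l k) (Ls l k) Nz) kd (eder_lin oN0 (contr_gen c l k) v Bs Nz).
Qed.

Definition exp_contr c a z : cext := exp_op (contr_of c (phi z)) a.

Lemma iter_contr_of_smooth c j a : esmooth N0 (fun z => iter j (contr_of c (phi z)) a).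
Proof.
elim: j => [|j IH] /=; first exact: esmooth_cst.
exact: (contr_of_smooth oN0 phi_smooth c IH).
Qed.

Lemma exp_contr_smooth c a : esmooth N0 (exp_contr c a).
Proof.
apply: esmooth_sum => // j _; apply: esmoothZ => //; first exact: csmooth_cst.
exact: iter_contr_of_smooth.
Qed.

(** All the iterates but the first vanish to second order where phi vanishes. *)
Lemma eder_exp_contr c a z v : N0 z -> phi z = 0 ->
  eder (exp_contr c a) z v = contr_of c (mder phi z v) a.
Proof.
move=> Nz pz; have its j := iter_contr_of_smooth c j a.
have cs (k : C) := csmooth_cst N0 k.
have it_der j : eder (fun y => iter j.+1 (contr_of c (phi y)) a) z v =
    if j == 0%N then contr_of c (mder phi z v) a else 0.
  rewrite (eder_contr_of c v (its j) Nz) pz contr_of0 addr0; case: j => [//|j].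
  by rewrite /= contr_of0 linear0.
rewrite /exp_contr /exp_op.
apply: (etrans (eder_sum oN0 _ v (fun j _ => esmoothZ oN0 (cs _) (its (nat_of_ord j))) Nz)).
transitivity (\sum_(j < n.+1) ((j`!)%:R : C)^-1 *: eder (fun y =>
  iter j (contr_of c (phi y)) a) z v).
  by apply: eq_bigr => j _; rewrite (ederZ v (cs _) (its j) Nz) cderive_cst scale0r add0r.
rewrite big_ord_recl /= eder_cst scaler0 add0r.
under eq_bigr do rewrite it_der.
(* For n = 0 the series stops before its linear term, and there is no index to
   contract. *)
case: (posnP n) => [n0|n0].
  rewrite big1; last by move=> [j jn]; exfalso; rewrite n0 in jn.
  rewrite contr_ofE big1// => -[j jn]; exfalso; by rewrite n0 in jn.
rewrite (bigD1 (Ordinal n0))//= invr1 scale1r big1 ?addr0// => j j0.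
by rewrite ifF ?scaler0//; apply: contraNF j0 => /eqP j0; apply/eqP/val_inj.
Qed.

(** The image of e_S by the extension map of phi z. *)
Definition ext_mono S z : cext :=
  wedge (exp_contr false (ebase (holo_part S)) z) (exp_contr true (ebase (antiholo_part S)) z).

Lemma extensionE a z : extension (phi z) a = \sum_S a S *: ext_mono S z.
Proof. by []. Qed.

Lemma ext_mono_smooth S : esmooth N0 (ext_mono S).
Proof. by apply: (esmooth_wedge oN0); exact: exp_contr_smooth. Qed.

Lemma exp_contr0 c a z : phi z = 0 -> exp_contr c a z = a.
Proof. by move=> pz; rewrite /exp_contr pz; exact: exp_op0. Qed.

Lemma ext_mono0 S z : phi z = 0 -> ext_mono S z = ebase S.
Proof.
move=> pz; rewrite -[RHS]wedge_parts.
exact: (f_equal2 (@wedge _ _) (exp_contr0 false _ pz) (exp_contr0 true _ pz)).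
Qed.

(** The two exponentials act on different factors of e_S, and each contraction
    annihilates the factor on which the other acts, so that to first order they add
    up to the derivation theta. *)
Lemma eder_ext_mono S z v : N0 z -> phi z = 0 ->
  eder (ext_mono S) z v = theta (mder phi z v) (ebase S).
Proof.
move=> Nz pz.
apply: (etrans (eder_wedge oN0 v (exp_contr_smooth false _) (exp_contr_smooth true _) Nz)).
apply: (etrans (f_equal2 +%R
  (f_equal2 (@wedge _ _) (eder_exp_contr false _ v Nz pz) (exp_contr0 true _ pz))
  (f_equal2 (@wedge _ _) (exp_contr0 false _ pz) (eder_exp_contr true _ v Nz pz)))).
rewrite -[in RHS]wedge_parts.
rewrite /theta contr_wedge contr_bar_wedge contr_bar_holo contr_antiholo.
by rewrite wedge0l linear0 addr0 add0r.
Qed.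

Section Preimage.
Variables (u w : W -> cext).
Hypothesis w_smooth : esmooth N0 w.
Hypothesis w_ext : forall z, N0 z -> w z = extension (phi z) (u z).
Hypothesis phi_0 : forall x, N0 (x, 0) -> phi (x, 0) = 0.

Let I := {set 'I_(n + n)}.
Definition ext_mx z : 'M[C]_#|I| := \matrix_(i, j) ext_mono (enum_val i) z (enum_val j).
Definition ext_dom : set W := [set z | N0 z /\ \det (ext_mx z) != 0].

Let Ms : msmooth N0 ext_mx.
Proof.
move=> i j; apply: csmooth_eq oN0 _ (@ext_mono_smooth (enum_val i) (enum_val j)) => z _.
by rewrite mxE.
Qed.

Lemma ext_dom_open : open ext_dom.
Proof. by apply: csmooth_neq0_open => //; exact: csmooth_det. Qed.

Lemma ext_dom0 x : N0 (x, 0) -> ext_dom (x, 0).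
Proof.
move=> Nx; split => //; rewrite (_ : ext_mx _ = 1%:M) ?det1 ?oner_neq0//.
apply/matrixP => i j; rewrite !mxE (ext_mono0 _ (phi_0 Nx)) ffunE eq_sym.
by rewrite (inj_eq enum_val_inj).
Qed.

(** Where the matrix of the extension map is invertible, u is obtained from w by
    Cramer's rule. *)
Lemma preimage_smooth : esmooth ext_dom u.
Proof.
have oN1 := ext_dom_open.
have sub : ext_dom `<=` N0 by move=> z [].
pose rowof (a : cext) : 'rV[C]_#|I| := \row_i a (enum_val i).
have uM z : N0 z -> rowof (u z) *m ext_mx z = rowof (w z).
  move=> Nz; apply/rowP => j; rewrite !mxE (w_ext Nz) extensionE sum_ffunE.
  rewrite [RHS](reindex _ (onW_bij _ (enum_val_bij I))) /=.
  by apply: eq_bigr => i _; rewrite !mxE [RHS]ffunE.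
have Ks : msmooth ext_dom (fun z => rowof (w z) *m invmx (ext_mx z)).
  apply: (msmooth_mul oN1).
    move=> i j; apply: csmooth_sub sub _.
    by apply: csmooth_eq oN0 _ (w_smooth (enum_val j)) => z _; rewrite mxE.
  move=> i j; apply: csmooth_invmx => //.
    by move=> z [_ d]; rewrite unitmxE unitfE.
  by move=> i' j'; apply: csmooth_sub sub _; exact: Ms.
move=> S; apply: csmooth_eq oN1 _ (Ks 0 (enum_rank S)) => z [Nz d].
rewrite -(uM _ Nz) mulmxK ?unitmxE ?unitfE// mxE.
by congr (u z _); exact: enum_rankK.
Qed.

Lemma preimage_t x : N0 (x, 0) ->
  eder w (x, 0) tdir = eder u (x, 0) tdir + theta (mder phi (x, 0) tdir) (u (x, 0)).
Proof.
move=> Nx; have oN1 := ext_dom_open; have us := preimage_smooth.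
have N1x := ext_dom0 Nx; have sub : ext_dom `<=` N0 by move=> z [].
have Xs S : esmooth ext_dom (ext_mono S) by move=> T; apply: csmooth_sub sub _;
  exact: ext_mono_smooth.
apply: (etrans (eder_eq oN1 tdir N1x (fun z Nz => etrans (w_ext (sub _ Nz)) (extensionE _ _)))).
apply: (etrans (eder_sum oN1 _ tdir (fun S _ => esmoothZ oN1 (us S) (Xs S)) N1x)).
have LE (L : {linear cext -> cext}) a : L a = \sum_S a S *: L (ebase S).
  by rewrite {1}(extE a) linear_sum; apply: eq_bigr => S _; rewrite linearZ.
rewrite (LE (theta (mder phi (x, 0) tdir))) (extE (eder u (x, 0) tdir)) -big_split.
apply: eq_bigr => S _; rewrite (ederZ tdir (us S) (Xs S) N1x) /=.
by rewrite (eder_ext_mono _ _ Nx (phi_0 Nx)) (ext_mono0 _ (phi_0 Nx)) [eder u _ _ S]ffunE.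
Qed.

Lemma preimage_0 x : N0 (x, 0) -> w (x, 0) = u (x, 0).
Proof. by move=> Nx; rewrite (w_ext Nx) (phi_0 Nx) extension0. Qed.
End Preimage.
End Extension.

(** * The Beltrami differential of a family in a chart *)

Section Frame.
Variables (R : realType) (n : nat).
Local Notation C := R[i].
Local Notation fr := (frame_mx R n).

Lemma frame_mx_unit : fr \in unitmx.
Proof.
suff /mulmx1_unit[] : fr *m block_mx (2^-1)%:M (- (2^-1 * 'i))%:M (2^-1)%:M (2^-1 * 'i)%:M =
  1%:M by [].
have ii : 'i * (2^-1 * 'i) = - 2^-1 :> C by rewrite mulrC half_ii.
rewrite /frame_mx mulmx_block !mul1mx -!scalar_mxM -!raddfD /= [in RHS](scalar_mx_block n n 1).
congr block_mx.
- by rewrite half_half.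
- by rewrite addNr raddf0.
- by rewrite mulNr subrr raddf0.
- by rewrite mulrN mulNr ii opprK half_half.
Qed.

(** In the real frame, a covector is the column obtained by applying [frame_mx] to its
    (dz, dzbar)-coordinates. *)
Lemma eigen_rows (J : 'M[R]_(n + n)) (A B : 'M[C]_n) (c : C) :
  map_mx (real_complex R) J *m (fr *m col_mx A^T B^T) = c *: (fr *m col_mx A^T B^T) ->
  row_mx A B *m (complexify_mx J)^T = c *: row_mx A B.
Proof.
move=> H; apply: trmx_inj; rewrite trmx_mul trmxK linearZ /= tr_row_mx /complexify_mx.
by rewrite -!mulmxA H -scalemxAr mulKmx ?frame_mx_unit.
Qed.
End Frame.

Section Deformed.
Variables (R : realType) (n : nat) (M : complexManifold R n) (eps : R) (D : deformation M eps)
  (phi : R -> beltrami M).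
Hypotheses (phi_describes : describes D phi) (D_small : small_deformation D phi).
Variables (a : chartIdx M) (j : famIdx D).
Local Notation C := R[i].
Local Notation V := 'rV[R]_(n + n).
Local Notation W := (V * R)%type.
Implicit Types (x : V) (z : W) (s r : 'I_(n + n)).

Definition chart_dom : set W := [set xt | crange a xt.1 /\ fdom j (param a xt.1, xt.2)].
Let N0 := chart_dom.
Let X al z : C := xi j al (param a z.1, z.2).

Lemma chart_dom_open : open N0.
Proof.
rewrite openE => -[x t] [/= cx fx].
change (nbhs (x, t) N0).
have nc : nbhs x (crange a) by apply: open_nbhs_nbhs; split => //; exact: crange_open.
have nf : nbhs (param a x, t) (fdom j).
  by apply: open_nbhs_nbhs; split => //; exact: fdom_open.
case: nf => -[P Q] /= [Px Qt] PQ.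
have pc : nbhs x (param a @^-1` P) by exact: (param_continuous cx Px).
exists (crange a `&` param a @^-1` P, Q) => /=.
  by split => //; exact: (@filterI _ _ (nbhs_filter x)).
by move=> [y s] /= [[cy Py] Qs]; split => //=; apply: PQ.
Qed.
Let oN0 := chart_dom_open.

Lemma xi_chart_smooth al : csmooth_on N0 (X al).
Proof. exact: xi_smooth. Qed.

Let g s al z : C := cderive (X al) z (hdir (delta_mx 0 s)).

Let gs s al : csmooth_on N0 (g s al).
Proof. exact: csmooth_cderive (xi_chart_smooth al). Qed.

Lemma dxi_dzE z al l : dxi_dz a j z.2 z.1 al l =
  2^-1 * (g (lshift n l) al z - 'i * g (rshift n l) al z).
Proof. by case: z => x t; rewrite mxE /wirt !(cderive_hslice (X al)). Qed.
Lemma dxi_dzbarE z al l : dxi_dzbar a j z.2 z.1 al l =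
  2^-1 * (g (lshift n l) al z + 'i * g (rshift n l) al z).
Proof. by case: z => x t; rewrite mxE /wirt_bar !(cderive_hslice (X al)). Qed.

Let As : msmooth N0 (fun z => dxi_dz a j z.2 z.1).
Proof.
move=> al l; apply: (@csmooth_eq _ _ _ (fun z =>
  2^-1 * (g (lshift n l) al z + - 'i * g (rshift n l) al z))) => //.
  by move=> z _; rewrite dxi_dzE mulNr.
apply: csmoothM => //; first exact: csmooth_cst.
by apply: csmoothD => //; apply: csmoothM => //; exact: csmooth_cst.
Qed.
Let Bs : msmooth N0 (fun z => dxi_dzbar a j z.2 z.1).
Proof.
move=> al l; apply: (@csmooth_eq _ _ _ (fun z =>
  2^-1 * (g (lshift n l) al z + 'i * g (rshift n l) al z))) => //.
  by move=> z _; rewrite dxi_dzbarE.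
apply: csmoothM => //; first exact: csmooth_cst.
by apply: csmoothD => //; apply: csmoothM => //; exact: csmooth_cst.
Qed.

Let Au z : N0 z -> dxi_dz a j z.2 z.1 \in unitmx.
Proof. by case: z => x t [/= cx fx]; exact: D_small.1. Qed.

Lemma chart_phi_smooth : msmooth N0 (fun z => phi z.2 a z.1).
Proof.
have H : msmooth N0 (fun z => invmx (dxi_dz a j z.2 z.1) *m dxi_dzbar a j z.2 z.1).
  by apply: (msmooth_mul oN0) => // al l; apply: csmooth_invmx.
move=> l k; apply: csmooth_eq oN0 _ (H l k) => z [cz fz].
by rewrite (phi_describes cz fz).
Qed.

Let cderive_row al z (v : V) : N0 z ->
  cderive (X al) z (hdir v) = \sum_s (v 0 s)%:C * g s al z.
Proof.
move=> Nz; pose h v := cderive (X al) z (hdir v).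
have hD v1 v2 : h (v1 + v2) = h v1 + h v2.
  rewrite /h -(cderive_addv oN0 _ _ (xi_chart_smooth al) Nz); congr (cderive _ _ _).
  by apply: injective_projections; rewrite //= addr0.
have hZ k v1 : h (k *: v1) = k%:C * h v1.
  rewrite /h -(cderive_scalev (hdir v1) k (xi_chart_smooth al) Nz).
  congr (cderive _ _ _).
  by apply: injective_projections; rewrite //= scaler0.
have h0 : h 0 = 0 by have := hZ 0 0; rewrite scale0r mul0r.
rewrite -/(h v) {1}(row_sum_delta v) (big_morph h hD h0).
by apply: eq_bigr => s _; rewrite hZ.
Qed.

Let half_sum (u w : C) : 2^-1 * (u - w) + 2^-1 * (u + w) = u.
Proof. by rewrite -mulrDr addrACA addNr addr0 mulrDr -mulrDl half_half mul1r. Qed.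

Let half_diff (u w : C) : 'i * (2^-1 * (u - 'i * w)) + - 'i * (2^-1 * (u + 'i * w)) = w.
Proof.
transitivity ((2^-1 + 2^-1) * (- ('i * 'i)) * w); first by ring.
by rewrite -expr2 sqr_i opprK mulr1 half_half mul1r.
Qed.

Let G z : 'M[C]_(n + n, n) := \matrix_(s, al) g s al z.

Let G_holo z : N0 z -> map_mx (real_complex R) (def_J D z.2 a z.1) *m G z = 'i *: G z.
Proof.
move=> Nz; have [cz fz] := Nz; apply/matrixP => r al; rewrite !mxE.
have := @xi_holomorphic _ _ _ _ D a j al z.2 z.1 (delta_mx 0 r) cz fz.
rewrite !(cderive_hslice (X al)) -surjective_pairing -rowE (cderive_row _ _ Nz) => <-.
by apply: eq_bigr => s _; rewrite !mxE.
Qed.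

Let frame_G z : frame_mx R n *m col_mx (dxi_dz a j z.2 z.1)^T (dxi_dzbar a j z.2 z.1)^T = G z.
Proof.
rewrite /frame_mx mul_block_col !mul1mx !mul_scalar_mx.
apply/matrixP => r al; rewrite [RHS]mxE; case: (split_ordP r) => l ->.
  by rewrite col_mxEu [LHS]mxE 2![(_^T) _ _]mxE dxi_dzE dxi_dzbarE half_sum.
rewrite col_mxEd [LHS]mxE [X in X + _]mxE [X in _ + X]mxE 2![(_^T) _ _]mxE dxi_dzE dxi_dzbarE.
exact: half_diff.
Qed.

Let frame_Gbar z : frame_mx R n *m col_mx (map_mx (@conjc R) (dxi_dzbar a j z.2 z.1))^T
    (map_mx (@conjc R) (dxi_dz a j z.2 z.1))^T = map_mx (@conjc R) (G z).
Proof.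
have cM (u v : C) : ('i * u + - 'i * v)^* = 'i * v^* + - 'i * u^*.
  case: u => u1 u2; case: v => v1 v2.
  by apply/eqP; rewrite eq_complex/=; apply/andP; split; apply/eqP; ring.
have cD (u v : C) : (u + v)^* = v^* + u^* by rewrite rmorphD addrC.
rewrite -(frame_G z); move: (dxi_dz a j z.2 z.1) (dxi_dzbar a j z.2 z.1) => A B.
rewrite /frame_mx !mul_block_col !mul1mx !mul_scalar_mx.
apply/matrixP => r al; rewrite [RHS]mxE; case: (split_ordP r) => l ->.
  by rewrite !col_mxEu !mxE cD.
by rewrite !col_mxEd !mxE cM.
Qed.

Let J_real z : map_mx (@conjc R) (map_mx (real_complex R) (def_J D z.2 a z.1)) =
  map_mx (real_complex R) (def_J D z.2 a z.1).
Proof. by apply/matrixP => r s; rewrite !mxE; apply/eqP; rewrite eq_complex/= oppr0 !eqxx. Qed.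

(** The differential of a holomorphic coordinate is complex linear for J_t; its
    (dz, dzbar)-coordinates are the rows of dxi/dz and dxi/dzbar, so J_t acts on
    these rows by i and on their conjugates by -i. Multiplying by the inverses of
    dxi/dz and of its conjugate gives the rows of (1 phi; phibar 1). *)
Lemma chart_phi_J z : N0 z ->
  beltrami_mx (phi z.2 a z.1) *m (complexify_mx (def_J D z.2 a z.1))^T =
  type_mx R n *m beltrami_mx (phi z.2 a z.1).
Proof.
move=> Nz; have [cz fz] := Nz.
pose A := dxi_dz a j z.2 z.1; pose B := dxi_dzbar a j z.2 z.1.
have uA : A \in unitmx by exact: Au.
have pE : phi z.2 a z.1 = invmx A *m B by rewrite (phi_describes cz fz).
have H1 : row_mx A B *m (complexify_mx (def_J D z.2 a z.1))^T = 'i *: row_mx A B.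
  by apply: eigen_rows; rewrite frame_G; exact: G_holo.
pose A' := map_mx (@conjc R) A; pose B' := map_mx (@conjc R) B.
have H2 : row_mx B' A' *m (complexify_mx (def_J D z.2 a z.1))^T = - 'i *: row_mx B' A'.
  apply: eigen_rows; rewrite frame_Gbar -{1}J_real -map_mxM (G_holo Nz) map_mxZ.
  by congr (_ *: _); apply/eqP; rewrite eq_complex/= oppr0 !eqxx.
have uA' : A' \in unitmx by rewrite map_unitmx.
have E1 : row_mx 1%:M (phi z.2 a z.1) = invmx A *m row_mx A B.
  by rewrite mul_mx_row mulVmx// pE.
have E2 : row_mx (map_mx (@conjc R) (phi z.2 a z.1)) 1%:M = invmx A' *m row_mx B' A'.
  by rewrite mul_mx_row mulVmx// pE map_mxM map_invmx.
transitivity (col_mx (row_mx 1%:M (phi z.2 a z.1)) (row_mx (map_mx (@conjc R) (phi z.2 a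
  z.1)) 1%:M)
    *m (complexify_mx (def_J D z.2 a z.1))^T); first by [].
rewrite mul_col_mx {1}E1 {1}E2 -2!mulmxA H1 H2 -2!scalemxAr -E1 -E2.
apply/esym; rewrite /type_mx /beltrami_mx {2}/block_mx.
by rewrite mul_block_col !mul0mx addr0 add0r !mul_scalar_mx.
Qed.

(** At t = 0 the coordinates are holomorphic for the standard structure. *)
Lemma chart_phi_0 x : N0 (x, 0) -> phi 0 a x = 0.
Proof.
move=> Nx; have [/= cx fx] := Nx.
rewrite (phi_describes cx fx) (_ : dxi_dzbar a j 0 x = 0) ?mulmx0//.
apply/matrixP => al l; rewrite (dxi_dzbarE (x, 0)) mxE.
have := @xi_holomorphic _ _ _ _ D a j al 0 x (delta_mx 0 (lshift n l)) cx fx.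
rewrite (def_J0 D cx) /J_std (_ : _ *m _ = delta_mx 0 (rshift n l)).
  rewrite !(cderive_hslice (X al)) -/(g _ al _) => ->.
  by rewrite mulrA -expr2 sqr_i mulN1r addrN mulr0.
rewrite -rowE; apply/rowP => s; rewrite [LHS]mxE [RHS]mxE; case: (split_ordP s) => s' ->.
  by rewrite block_mxEul mxE eq_lrshift andbF.
by rewrite block_mxEur mxE eqxx eq_rshift eq_sym.
Qed.
End Deformed.

(** * Powers of the metric and the main identity *)

Section Powers.
Variables (R : realType) (n : nat).
Local Notation C := R[i].
Local Notation W := ('rV[R]_(n + n) * R)%type.
Local Notation cext := (ext C (n + n)).
Variables (N : set W) (oN : open N).

Lemma wedge_pow_smooth (w : W -> cext) k : esmooth N w -> esmooth N (fun z => wedge_pow (w z) k).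
Proof.
move=> ws; elim: k => [|k IH]; first exact: (esmooth_cst N).
exact: (esmooth_wedge oN ws IH).
Qed.

(** Both sides obey the Leibniz rule, theta being a derivation. *)
Lemma wedge_pow_t (w u : W -> cext) (f : 'M[C]_n) k z v : esmooth N w -> esmooth N u -> N z ->
  w z = u z -> eder w z v = eder u z v + theta f (w z) ->
  eder (fun y => wedge_pow (w y) k) z v =
  eder (fun y => wedge_pow (u y) k) z v + theta f (wedge_pow (w z) k).
Proof.
move=> ws us Nz wu wt; elim: k => [|k IH].
  rewrite /wedge_pow /= !eder_cst add0r /theta contrE contr_barE.
  rewrite !big1 ?addr0//; move=> l _; rewrite big1// => m _;
  by rewrite /shift_op interior1 linear0 scaler0.
have wk := wedge_pow_smooth k ws; have uk := wedge_pow_smooth k us.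
apply: (etrans (eder_wedge oN v ws wk Nz)).
rewrite -[eder (fun y => wedge_pow (u y) k.+1) z v]/(eder (fun y =>
  wedge (u y) (wedge_pow (u y) k)) z v).
rewrite (eder_wedge oN v us uk Nz).
rewrite -[wedge_pow (w z) k.+1]/(wedge (w z) (wedge_pow (w z) k)) theta_wedge.
by rewrite IH wt -wu wedgeDl linearD addrACA.
Qed.
End Powers.

Section Conjugate.
Variables (R : realType) (n : nat).
Local Notation C := R[i].
Local Notation W := ('rV[R]_(n + n) * R)%type.
Local Notation cext := (ext C (n + n)).
Variables (N : set W) (oN : open N) (F : W -> 'M[C]_n).
Hypothesis F_smooth : forall l m, csmooth_on N (fun z => F z l m).

(** Conjugation exchanges the two Dolbeault operators and the two contractions; this
    rewrites the second half of the imaginary part. *)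
Lemma conj_std_del_contr (B : W -> cext) x t : esmooth N B -> N (x, t) ->
  conj_ext (std_del true (fun y => contr_of false (F y) (std_del true (fun z =>
    conj_ext (B z)) y)) (x, t)) =
  std_del false (fun y => contr_of true (F y) (std_del false B y)) (x, t).
Proof.
move=> Bs Nx.
pose G y := contr_of false (F y) (std_del true (fun z => conj_ext (B z)) y).
have Gs : esmooth N G.
  apply: (contr_of_smooth oN F_smooth false); apply: (std_del_smooth oN true).
  exact: (esmooth_conj oN Bs).
apply: (etrans (esym (std_del_conj oN false Gs Nx))).
apply: std_del_slice; apply: filterS (near_hslice oN Nx) => y Ny.
apply: (etrans (conj_contr _ _)).
apply: (congr1 (contr_of true (F (y, t)))).
apply: (etrans (congr1 (@conj_ext R n) (std_del_conj oN true Bs Ny))).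
exact: conj_extK.
Qed.
End Conjugate.

Theorem theorem3p21 (R : realType) (n k : nat) (M : complexManifold R n)
  (M_compact : compact [set: M]) (M_connected : connected [set: M])
  (eps : R) (eps_gt0 : 0 < eps)
  (D : deformation M eps) (phi : R -> beltrami M)
  (phi_describes : describes D phi) (D_small : small_deformation D phi)
  (omega_ : R -> cform M)
  (omega_hermitian : forall t, time_interval eps t ->
     hermitian_form (def_J D t) (omega_ t))
  (omega_smooth : smooth_family eps omega_)
  (omega : R -> cform M)
  (omega_type : forall t, time_interval eps t ->
     is_pq_form (J_std M) 1 1 (omega t))
  (omega_extension : forall t, time_interval eps t ->
     eqf (omega_ t) (extension_form (phi t) (omega t)))
  (k_range : (1 <= k <= n - 1)%N)
  (omega_closed : forall t, time_interval eps t ->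
     eqf (del (def_J D t) (delbar (def_J D t) (pow_form (omega_ t) k)))
         (zero_form M)) :
  let J := J_std M in
  let phi' := beltrami_deriv phi 0 in
  eqf (two_i_Im (fun alpha => del J (contr_form phi' (del J alpha)))
         (pow_form (omega 0) k))
      (del J (delbar J (form_deriv (fun t => pow_form (omega t) k) 0))).
Proof.
move=> J phi' a x0 cx0.
have t0 : time_interval eps 0 by rewrite /time_interval/= oppr_lt0 eps_gt0.
have [j fx0] := fdom_cover D (param a x0) t0.
(* Near (x0, 0) everything is expressed on V x R, in the chart a of M and
   the holomorphic coordinates xi_j of the family. *)
pose N0 : set ('rV[R]_(n + n) * R) := @chart_dom _ _ _ _ D a j.
have oN0 : open N0 by exact: chart_dom_open.
pose phz (z : 'rV[R]_(n + n) * R) := phi z.2 a z.1.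
pose Jz (z : 'rV[R]_(n + n) * R) := def_J D z.2 a z.1.
have phs : msmooth N0 phz by exact: chart_phi_smooth.
have phJ z : N0 z -> beltrami_mx (phz z) *m (complexify_mx (Jz z))^T =
  type_mx R n *m beltrami_mx (phz z).
  exact: chart_phi_J.
have ph0 x : N0 (x, 0) -> phz (x, 0) = 0 by exact: chart_phi_0.
pose w (z : 'rV[R]_(n + n) * R) := omega_ z.2 a z.1.
pose u (z : 'rV[R]_(n + n) * R) := omega z.2 a z.1.
have N0t z : N0 z -> crange a z.1 /\ time_interval eps z.2.
  by move=> [cz fz]; split => //; exact: fdom_time fz.
have ws : esmooth N0 w by move=> S; apply: csmooth_sub N0t _; exact: omega_smooth.
have wext z : N0 z -> w z = extension (phz z) (u z).
  by move=> /N0t[cz tz]; exact: omega_extension.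
pose Nb := beltrami_dom N0 phz.
have oNb : open Nb := beltrami_dom_open oN0 phs.
pose N1 := ext_dom N0 phz.
have oN1 : open N1 := ext_dom_open oN0 phs.
have us1 : esmooth N1 u := preimage_smooth oN0 phs ws wext.
(* On N the matrices (1 phi; phibar 1) and the matrix of the extension map are
   invertible; it contains the part of the slice t = 0 in N0. *)
pose N := Nb `&` N1.
have oN : open N by exact: openI.
have NNb : N `<=` Nb by move=> z [].
have NN1 : N `<=` N1 by move=> z [].
have NN0 : N `<=` N0 by move=> z [[]].
have N00 x : N0 (x, 0) -> N (x, 0).
  by move=> Nx; split; [exact: beltrami_dom0|exact: ext_dom0].
have Nx0 : N (x0, 0) by apply: N00; split.
have wsN : esmooth N w by move=> S; exact: csmooth_sub NN0 (ws S).
have usN : esmooth N u by move=> S; exact: csmooth_sub NN1 (us1 S).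
pose B z := wedge_pow (w z) k; pose B' z := wedge_pow (u z) k.
have Bs : esmooth N B by exact: wedge_pow_smooth.
have B's : esmooth N B' by exact: wedge_pow_smooth.
pose F z := mder phz z (tdir R n).
have Fs l m : csmooth_on N (fun z => F z l m).
  by apply: csmooth_sub NNb _; exact: beltrami_der_smooth.
have wu0 y : N (y, 0) -> w (y, 0) = u (y, 0).
  by move=> Ny; exact: (preimage_0 wext ph0 (NN0 _ Ny)).
have TB y : N (y, 0) -> eder B (y, 0) (tdir R n) =
  eder B' (y, 0) (tdir R n) + theta (F (y, 0)) (B (y, 0)).
  move=> Ny; apply: (wedge_pow_t oN k wsN usN Ny (wu0 y Ny)).
  by rewrite (wu0 y Ny); exact: (preimage_t oN0 phs ws wext ph0 (NN0 _ Ny)).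
have closed z : N z -> fam_del Jz true (fam_del Jz false B) z = 0.
  case: z => x t Nz; have [/= cx tt] := N0t _ (NN0 _ Nz).
  have inner y : delbar (def_J D t) (pow_form (omega_ t) k) a y = fam_del Jz false B (y, t).
    exact: (@delbarE _ _ _ (def_J D t) (pow_form (omega_ t) k) a Jz B y t (fun _ =>
      erefl) (fun _ => erefl)).
  have outer := @delE _ _ _ (def_J D t) _ a Jz _ x t (fun _ => erefl) inner.
  exact: (etrans (esym outer) (omega_closed t tt a x cx)).
have toNb x : N (x, 0) -> Nb (x, 0) by exact: NNb.
have main := variation_identity oN
  (fun s S => csmooth_sub NNb (beltrami_cov10_smooth oN0 phs phJ s S))
  (fun s S => csmooth_sub NNb (beltrami_cov01_smooth oN0 phs phJ s S))
  (fun x s Nx => beltrami_cov10_0 phJ ph0 s (toNb x Nx))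
  (fun x s Nx => beltrami_cov01_0 phJ ph0 s (toNb x Nx))
  (fun x s Nx => beltrami_cov10_t oN0 phs phJ s (toNb x Nx))
  (fun x s Nx => beltrami_cov01_t oN0 phs phJ s (toNb x Nx))
  (fun x l Nx => beltrami_drowl oN0 phs phJ ph0 l (toNb x Nx))
  (fun x l Nx => beltrami_drowr oN0 phs phJ ph0 l (toNb x Nx))
  Fs Bs B's TB closed Nx0.
(* The standard structure is constant in the chart, hence its types can be read
   off from J_0 at x0. *)
have Jx0 : Jz (x0, 0) = J_std M a x0 by exact: (def_J0 D cx0).
have c10 s := etrans (congr1 (fun J =>
  cov10 J s) (esym Jx0)) (beltrami_cov10_0 phJ ph0 s (toNb x0 Nx0)).
have c01 s := etrans (congr1 (fun J =>
  cov01 J s) (esym Jx0)) (beltrami_cov01_0 phJ ph0 s (toNb x0 Nx0)).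
(* All the forms below are restrictions to the slice t = 0 of families A. *)
have delS (beta : cform M) A x : (forall y, beta a y = A (y, 0)) ->
    del J beta a x = std_del true A (x, 0).
  move=> bA; apply: (etrans (@delE _ _ _ _ _ _ (fun=> J_std M a x0) A x 0 (fun y => erefl) bA)).
  by apply: fam_del_std => z s; [exact: c10|exact: c01].
have delbarS (beta : cform M) A x : (forall y, beta a y = A (y, 0)) ->
    delbar J beta a x = std_del false A (x, 0).
  move=> bA; apply: (etrans (@delbarE _ _ _ _ _ _ (fun=> J_std M a x0) A x 0 (fun y =>
    erefl) bA)).
  by apply: fam_del_std => z s; [exact: c10|exact: c01].
have phi'E y : phi' a y = F (y, 0).
  by apply/matrixP => l m; rewrite !mxE (cderive1_slice (fun z => phz z l m)).
have nearN := near_hslice oN Nx0.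
have B0 y : N (y, 0) -> pow_form (omega 0) k a y = B (y, 0).
  by move=> Ny; rewrite /B /pow_form wu0.
pose A0 (z : 'rV[R]_(n + n) * R) := pow_form (omega 0) k a z.1.
have E1 : del J (contr_form phi' (del J (pow_form (omega 0) k))) a x0 =
    std_del true (fun y => contr_of false (F y) (std_del true B y)) (x0, 0).
  rewrite (delS _ (fun z => contr (phi' a z.1) (std_del true A0 (z.1, 0)))); last first.
    by move=> y; apply: (congr1 (contr _)); exact: delS.
  apply: std_del_slice; apply: filterS nearN => y Ny; rewrite phi'E.
  apply: (congr1 (contr _)); apply: std_del_slice.
  by apply: filterS (near_hslice oN Ny) => y'; exact: B0.
have E2 : conj_ext (del J (contr_form phi' (del J (conj_form (pow_form (omega 0) k)))) a x0) =
    std_del false (fun y => contr_of true (F y) (std_del false B y)) (x0, 0).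
  rewrite -(conj_std_del_contr oN Fs Bs Nx0); apply: (congr1 (@conj_ext R n)).
  rewrite (delS _ (fun z => contr (phi' a z.1) (std_del true (fun z =>
    conj_ext (A0 z)) (z.1, 0)))); last first.
    by move=> y; apply: (congr1 (contr _)); exact: delS.
  apply: std_del_slice; apply: filterS nearN => y Ny; rewrite phi'E.
  apply: (congr1 (contr _)); apply: std_del_slice.
  apply: filterS (near_hslice oN Ny) => y' Ny'; apply: (congr1 (@conj_ext R n)); exact: B0.
have E3 : del J (delbar J (form_deriv (fun t => pow_form (omega t) k) 0)) a x0 =
    std_del true (std_del false (fun y => eder B' y (tdir R n))) (x0, 0).
  apply: delS => y; apply: delbarS => y'; apply/ffunP => S; rewrite !ffunE.
  exact: (cderive1_slice (fun z => B' z S)).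
rewrite E3 -main; exact: (f_equal2 (fun u v => u - v) E1 E2).
Qed.
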